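(* Consider an evolution equation \[ u_t=H(t,x,u_{(r,x)}), \] where $r>1$, $u_k=\partial^ku/\partial x^k$, $u_{(r,x)}=(u_0,u_1,\dots,u_r)$ with $u_0=u$, and $H_{u_r}\ne0$. Up to the equivalences of operators and of solution families, there exists a one-to-one correspondence between one-parametric families of solutions of this equation and its reduction operators with zero coefficient of $\partial_t$. Namely, each operator of this kind corresponds to the family of solutions which are invariant with respect to this operator. (Thus the construction of all one-parametric solution families of the equation and the exhaustive description of its reduction operators with zero coefficient of $\partial_t$ are completely equivalent problems.)
   Context: All considerations are local; functions are smooth. The independent variables are $t,x$, the dependent variable is $u$. For a vector field $Q=\tau\partial_t+\xi\partial_x+\eta\partial_u$ (coefficients functions of $(t,x,u)$, $(\tau,\xi)\neq(0,0)$) put $Q[u]=\eta-\tau u_t-\xi u_x$, and let $\mathcal Q_{(r)}$ be the submanifold of the jet space $J^r$ defined by $D_t^aD_x^bQ[u]=0$, $a+b<r$, where $D_t,D_x$ are the total derivatives. Writing the equation as $L=0$ with $L=u_t-H$, $Q$ is a reduction operator of the equation if the $r$th prolongation of $Q$ applied to $L$ vanishes on $\{L=0\}\cap\mathcal Q_{(r)}$. A function $u$ is $Q$-invariant if $Q[u]=0$. Operators $Q$ and $\tilde Q$ are equivalent if $\tilde Q=\lambda Q$ for a nonvanishing function $\lambda(t,x,u)$; being a reduction operator is compatible with this equivalence. Thus operators with zero coefficient of $\partial_t$ have representatives $\partial_x+\zeta(t,x,u)\partial_u$. A one-parametric family of solutions is a family $u=f(t,x,\varkappa)$ of solutions with $f_\varkappa\neq0$.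 Two families $u=f(t,x,\varkappa)$ and $u=\tilde f(t,x,\tilde\varkappa)$ are equivalent if they differ only by parameterization: $\tilde f(t,x,\theta(\varkappa))=f(t,x,\varkappa)$ for some function $\theta$ with $\theta_\varkappa\neq0$. *)

(* Defs.v *)
From HB Require Import structures.
From mathcomp Require Import all_boot all_order all_algebra.
From mathcomp Require Import all_classical all_reals all_analysis.

Set Implicit Arguments.
Unset Strict Implicit.
Unset Printing Implicit Defensive.

Import Order.TTheory GRing.Theory Num.Theory.
Import numFieldNormedType.Exports.

Local Open Scope classical_set_scope.
Local Open Scope ring_scope.

Section Smooth.
Context {R : realType} {V : normedModType R}.

(* For finite-dimensional V and open U this is the usual class C^k(U). *)
Fixpoint Ck (k : nat) (U : set V) (f : V -> R) : Prop :=
  if k is k'.+1 then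
    (forall p, U p -> differentiable f p) /\
    (forall v : V, Ck k' U (fun p => 'D_v f p))
  else forall p, U p -> {for p, continuous f}.

Definition smooth_on (U : set V) (f : V -> R) : Prop := forall k, Ck k U f.

Definition smooth_near (p : V) (f : V -> R) : Prop :=
  exists2 U, open_nbhs p U & smooth_on U f.

End Smooth.

(* Points of R^3 are ((t, x), u) or ((t, x), kappa).  A jet point is
   ((t, x), j) with j a b the coordinate of d^(a+b) u / dt^a dx^b.  Jets are of
   infinite order; a function on J^r is a function of a jet point that only
   depends on the coordinates j a b with a + b <= r. *)
Definition jetpt (R : realType) : Type := (R * R * (nat -> nat -> R))%type.
Definition dfun (R : realType) : Type := jetpt R -> R.

Section Jets.
Context {R : realType}.
Implicit Types (F : dfun R) (z : jetpt R) (a b : nat).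

Definition base z : R * R * R := (z.1, z.2 0%N 0%N).

Definition upd (j : nat -> nat -> R) a b (s : R) : nat -> nat -> R :=
  fun a' b' => if (a' == a) && (b' == b) then s else j a' b'.

Definition pd_t F z : R := derive1 (fun s : R => F ((s, z.1.2), z.2)) z.1.1.
Definition pd_x F z : R := derive1 (fun s : R => F ((z.1.1, s), z.2)) z.1.2.
Definition pd_u a b F z : R :=
  derive1 (fun s : R => F (z.1, upd z.2 a b s)) (z.2 a b).

(* The sums have finite support because differential functions are of finite
   order. *)
Definition Dt F : dfun R := fun z =>
  pd_t F z +
  \sum_(ab \in [set: nat * nat]) z.2 ab.1.+1 ab.2 * pd_u ab.1 ab.2 F z.
Definition Dx F : dfun R := fun z =>
  pd_x F z +
  \sum_(ab \in [set: nat * nat]) z.2 ab.1 ab.2.+1 * pd_u ab.1 ab.2 F z.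

Definition fun_dt (u : R * R -> R) : R * R -> R :=
  fun p => 'D_((1, 0) : R * R) u p.
Definition fun_dx (u : R * R -> R) : R * R -> R :=
  fun p => 'D_((0, 1) : R * R) u p.

Definition jet_of (u : R * R -> R) (p : R * R) : jetpt R :=
  (p, fun a b => iter a fun_dt (iter b fun_dx u) p).

End Jets.

Record operator (R : realType) := Operator {
  tau : R * R * R -> R ;
  xi : R * R * R -> R ;
  eta : R * R * R -> R }.

Section Operators.
Context {R : realType}.
Implicit Types (Q : operator R) (z : jetpt R).

(* Q[u] *)
Definition Qchar Q : dfun R := fun z =>
  eta Q (base z) - tau Q (base z) * z.2 1%N 0%N - xi Q (base z) * z.2 0%N 1%N.

(* Coefficient of d/du_{a,b} in the prolongation of Q; for a = b = 0 it is
   eta.  The derivatives of u of order a + b + 1 cancel. *)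
Definition prol_coef Q (a b : nat) : dfun R := fun z =>
  iter a Dt (iter b Dx (Qchar Q)) z
  + tau Q (base z) * z.2 a.+1 b + xi Q (base z) * z.2 a b.+1.

Definition prolongation (r : nat) Q (F : dfun R) : dfun R := fun z =>
  tau Q (base z) * pd_t F z + xi Q (base z) * pd_x F z
  + \sum_(ab \in [set ab : nat * nat | (ab.1 + ab.2 <= r)%N])
      prol_coef Q ab.1 ab.2 z * pd_u ab.1 ab.2 F z.

Definition Q_manifold (r : nat) Q : set (jetpt R) :=
  [set z | forall a b, (a + b < r)%N -> iter a Dt (iter b Dx (Qchar Q)) z = 0].

End Operators.

(* An evolution equation u_t = H(t, x, u_0, ..., u_r) is given by the open
   domain Om of H and by H, used only on Om. *)
Section Equation.
Context {R : realType} (r : nat).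
Variables (Om : set (R * R * 'rV[R]_r.+1)) (H : R * R * 'rV[R]_r.+1 -> R).

Definition xjet (z : jetpt R) : R * R * 'rV[R]_r.+1 :=
  (z.1, \row_(k < r.+1) z.2 0%N k).

Definition Lfun : dfun R := fun z => z.2 1%N 0%N - H (xjet z).

Definition L_manifold : set (jetpt R) := [set z | Om (xjet z) /\ Lfun z = 0].

(* The fourth clause says that the restricted equation makes sense over all of
   W: without it an operator whose invariant jets all lie outside the domain of
   H would satisfy the last clause vacuously. If Om is the whole space and
   tau = 0, it follows from the third clause. *)
Definition reduction_operator_on (W : set (R * R * R)) (Q : operator R) : Prop :=
  [/\ open W,
      [/\ smooth_on W (tau Q), smooth_on W (xi Q) & smooth_on W (eta Q)],
      (forall p, W p -> (tau Q p, xi Q p) <> (0, 0)),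
      (forall p, W p ->
         exists z, base z = p /\ (L_manifold `&` Q_manifold r Q) z)
    & (forall z, W (base z) -> (L_manifold `&` Q_manifold r Q) z ->
         prolongation r Q Lfun z = 0)].

Definition reduction_operator_at (p0 : R * R * R) (Q : operator R) : Prop :=
  exists2 W, W p0 & reduction_operator_on W Q.

Definition solution_on (O : set (R * R)) (u : R * R -> R) : Prop :=
  [/\ open O, smooth_on O u & forall p, O p -> L_manifold (jet_of u p)].

Definition invariant_on (Q : operator R) (O : set (R * R)) (u : R * R -> R) :
  Prop := forall p, O p -> Qchar Q (jet_of u p) = 0.

End Equation.

(* The germ at (t0, x0, kappa0), kappa0 = fam_par, of a function
   f(t, x, kappa). *)
Record function_family (R : realType) := Family {
  fam_fun : R * R * R -> R ;
  fam_par : R }.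

Section Germs.
Context {R : realType} (r : nat).
Variables (Om : set (R * R * 'rV[R]_r.+1)) (H : R * R * 'rV[R]_r.+1 -> R).
Variable p0 : R * R * R.
Implicit Types (Q : operator R) (f : function_family R).

Definition zero_dt_coef Q : Prop := \forall p \near p0, tau Q p = 0.

Definition operator_equiv Q Q' : Prop :=
  exists lam : R * R * R -> R,
    smooth_near p0 lam /\
    \forall p \near p0,
      [/\ lam p != 0, tau Q' p = lam p * tau Q p,
          xi Q' p = lam p * xi Q p & eta Q' p = lam p * eta Q p].

Definition solution_family f : Prop :=
  fam_fun f (p0.1, fam_par f) = p0.2 /\
  exists N : set (R * R * R),
    [/\ open_nbhs (p0.1, fam_par f) N,
        smooth_on N (fam_fun f),
        (forall q, N q -> 'D_((0, 0, 1) : R * R * R) (fam_fun f) q != 0)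
      & forall k : R, solution_on Om H [set p | N (p, k)]
                                  (fun p => fam_fun f (p, k))].

Definition family_equiv f f' : Prop :=
  exists th : R -> R,
    [/\ smooth_near (fam_par f) th,
        th (fam_par f) = fam_par f',
        (\forall k \near fam_par f, derive1 th k != 0)
      & \forall q \near (p0.1, fam_par f),
          fam_fun f' (q.1, th q.2) = fam_fun f q].

(* All members of f are Q-invariant and, conversely, each Q-invariant solution
   whose graph passes close to p0 locally coincides with a member of f. *)
Definition family_of_invariant_solutions Q f : Prop :=
  (\forall q \near (p0.1, fam_par f),
     Qchar Q (jet_of (fun p => fam_fun f (p, q.2)) q.1) = 0) /\
  (forall N : set (R * R * R), nbhs (p0.1, fam_par f) N ->
   exists2 W : set (R * R * R), open_nbhs p0 W &
     forall (O : set (R * R)) (v : R * R -> R) (p1 : R * R),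
       solution_on Om H O v -> invariant_on Q O v ->
       O p1 -> W (p1, v p1) ->
       exists2 k : R, N (p1, k) & \forall p \near p1, v p = fam_fun f (p, k)).

Definition reduction_operators0 : set (operator R) :=
  [set Q | reduction_operator_at Om H p0 Q /\ zero_dt_coef Q].

Definition solution_families : set (function_family R) :=
  [set f | solution_family f].

Definition operator_class Q : set (operator R) :=
  [set Q' | operator_equiv Q Q'].

Definition family_class f : set (function_family R) :=
  [set f' | family_equiv f f'].

End Germs.

(* Main.v *)
(* An operator with zero coefficient of d_t is equivalent to d_x + zeta d_u.  On
   the manifold D_t^a D_x^b Q[u] = 0 one has u_k = X^(k-1) zeta with
   X = d_x + zeta d_u.  Put G(t,x,u) = H(t,x,u,zeta,X zeta,...); then the
   prolonged operator applied to L equals xi (zeta_t + G zeta_u - G_x - zeta G_u),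
   so being a reduction operator is exactly the compatibility condition of the
   Frobenius system u_x = zeta, u_t = G.
   From an operator to a family: solve u_t = G along x = x0 with initial value u,
   then u_x = zeta for each t.  The defect w = f_t - G(f) vanishes at x = x0 and
   satisfies the linear equation w_x = zeta_u w, hence w = 0.
   From a family f with f_kappa <> 0 to an operator: invert f in kappa and put
   zeta(t,x,u) = f_x(t,x,kappa(t,x,u)).
   The inverse kappa(t,x,u) is a first integral of the system: it is constant
   along every invariant solution, so each invariant solution is a member of the
   family and two families of the same operator differ by a change of parameter. *)

Require Import Defs.
From HB Require Import structures.
From mathcomp Require Import all_boot all_order all_algebra.
From mathcomp Require Import all_classical all_reals all_analysis.
From mathcomp Require Import ring lra.

Set Implicit Arguments.
Unset Strict Implicit.
Unset Printing Implicit Defensive.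

Import Order.TTheory GRing.Theory Num.Theory.
Import numFieldNormedType.Exports.

Local Open Scope classical_set_scope.
Local Open Scope ring_scope.

(** * Functions of class C^k *)

(** Smoothness means that iterated directional derivatives exist in all directions, so the
    regularity proofs share one shape: the partial derivatives of a new function are expressed
    through the function itself and smooth data, and [Ck_partials] then lifts it from C^k to
    C^(k+1). This serves the implicit inverse, primitives with parameters and the flow of u_x =
    zeta, whose derivatives come from variation of constants. Total derivatives act on functions of
    infinite jets through finitely supported sums. They are computed on [dexp], a syntax of
    polynomials in the jet coordinates, where they become a recursion and the occurring coordinates
    can be listed. Operators and families are germs at p0, so most steps shrink a domain to a box.
    For a family of solutions the first half of [family_of_invariant_solutions], called
    [inv_family], implies the second; the correspondence is proved for [inv_family] as four
    statements: each side has a partner on the other, unique up to equivalence. The nonvacuity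
    clause of a reduction operator turns the vanishing of the prolongation into an identity at every
    point. *)

Section DeriveLines.
Context {R : realType} {V W : normedModType R}.
Implicit Types (f : V -> W) (p v : V).

Lemma is_derive_line f p v (s : R) (l : W) :
  is_derive s 1 (fun h : R => f (p + h *: v)) l <-> is_derive (p + s *: v) v f l.
Proof.
have E : (fun h : R => h^-1 *: (((fun h : R => f (p + h *: v)) \o shift s) (h *: 1) - f (p + s *: v))) =
   (fun h => h^-1 *: ((f \o shift (p + s *: v)) (h *: v) - f (p + s *: v))).
  apply/funext => h /=; congr (_ *: (f _ - _)).
  by rewrite [_ *: 1]mulr1 scalerDl addrCA.
split=> -[H1 <-]; split; move: H1; rewrite /derivable /derive /=.
- by rewrite -E.
- by move=> _; rewrite -E.
- by rewrite E.
- by move=> _; rewrite E.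
Qed.

Lemma is_derive_line0 f p v (l : W) :
  is_derive (0:R) 1 (fun h : R => f (p + h *: v)) l <-> is_derive p v f l.
Proof. by have := is_derive_line f p v 0 l; rewrite scale0r addr0. Qed.

Lemma differentiable_is_derive f p v :
  differentiable f p -> is_derive p v f ('D_v f p).
Proof. by move=> df; apply/derivableP/diff_derivable. Qed.

Lemma derive_scaled f p v (a : R) :
  differentiable f p -> 'D_(a *: v) f p = a *: 'D_v f p.
Proof. by move=> df; rewrite !deriveE // linearZ. Qed.

Lemma derive_addv f p v w :
  differentiable f p -> 'D_(v + w) f p = 'D_v f p + 'D_w f p.
Proof. by move=> df; rewrite !deriveE // linearD. Qed.

Lemma derive_sumv f p n (w : 'I_n -> V) :
  differentiable f p -> 'D_(\sum_(i < n) w i) f p = \sum_(i < n) 'D_(w i) f p.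
Proof.
move=> df; rewrite deriveE // linear_sum.
by apply: eq_bigr => i _; rewrite deriveE.
Qed.

End DeriveLines.

Section Differentiability.
Context {R : realType} {V W : normedModType R}.
Implicit Types f g : V -> W.

(** A candidate differential suffices: by uniqueness of the differential it is ['d f p]. *)
Lemma differentiable_eps f p (L : {linear V -> W}) : continuous L ->
  (forall e : R, 0 < e ->
     \forall h \near (0 : V), `|f (h + p) - f p - L h| <= e * `|h|) ->
  differentiable f p.
Proof.
move=> cL H.
have Ef : f \o shift p = cst (f p) + L +o_ (0 : V) id.
  apply/eqaddoP => _/posnumP[e]; have := H _ [gt0 of e%:num].
  apply: filterS => h; congr (`|_| <= _).
  rewrite -![(_ - _ : _ -> _) _]/(_ - _) -![(_ + _ : _ -> _) _]/(_ + _) /cst /=.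
  by rewrite opprD addrA.
have D := diff_unique cL Ef.
by apply/diff_locallyP; rewrite D; split.
Qed.

Lemma near_eq_differentiable f g p :
  (\forall q \near p, f q = g q) -> differentiable f p -> differentiable g p.
Proof.
move=> E df; apply: (@differentiable_eps _ _ ('d f p)); first exact: diff_continuous.
move=> e e0; have [_ /eqaddoP /(_ e e0)] := (diff_locallyP p f).1 df.
have := E; rewrite (near_shift 0 p).
apply: filterS2 => h /=; rewrite subr0 => Eh.
rewrite -![(_ - _ : _ -> _) _]/(_ - _) -![(_ + _ : _ -> _) _]/(_ + _) /cst /=.
by rewrite opprD addrA Eh (nbhs_singleton E).
Qed.

End Differentiability.

Section DeriveChain.
Context {R : realType} {U V W : normedModType R}.

(** The inner function needs a derivative in the single direction v only: restricted to the line p +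
    h v it is a differentiable curve, and the usual chain rule applies there. *)
Lemma is_derive_comp (f : U -> V) (g : V -> W) (p v : U) (w : V) :
  is_derive p v f w -> differentiable g (f p) ->
  is_derive p v (fun q => g (f q)) ('D_w g (f p)).
Proof.
move=> /is_derive_line0 [d1 E1] dg; apply/is_derive_line0.
have /derivable1_diffP d1' := d1.
pose c := fun h : R => f (p + h *: v).
have dg' : differentiable g (c 0) by rewrite /c scale0r addr0.
have dd : differentiable (g \o c) (0:R) by exact: differentiable_comp.
split; first by apply/derivable1_diffP.
rewrite (deriveE _ dd) diff_comp //=.
have -> : 'd c (0:R) (1:R) = w by rewrite -deriveE.
by rewrite -deriveE // /c scale0r addr0.
Qed.

End DeriveChain.

Section MeanValue.
Context {R : realType}.

(* Both orders of the end points are allowed. *)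
Lemma mean_value (f df : R -> R) (a b : R) :
  (forall x, Num.min a b <= x <= Num.max a b -> is_derive x 1 f (df x)) ->
  exists2 c, Num.min a b <= c <= Num.max a b & f b - f a = df c * (b - a).
Proof.
have main (a' b' : R) : a' <= b' -> (forall x, a' <= x <= b' -> is_derive x 1 f (df x)) ->
    exists2 c, a' <= c <= b' & f b' - f a' = df c * (b' - a').
  move=> ab H.
  have [||c] := @MVT_segment R f df a' b' ab.
  - move=> x; rewrite in_itv /= => /andP[x1 x2]; apply: H.
    by rewrite (ltW x1) (ltW x2).
  - apply: derivable_within_continuous => x; rewrite in_itv /= => x1.
    by have [] := H _ x1.
  by rewrite in_itv /= => c1 c2; exists c.
have [ab|/ltW ba] := leP a b => H; first by apply: main.
have [c c1 c2] := main _ _ ba H.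
by exists c => //; rewrite -opprB c2 -mulrN opprB.
Qed.

Lemma mean_value_line (V : normedModType R) (f : V -> R) (p v : V) :
  (forall s : R, 0 <= s <= 1 -> derivable f (p + s *: v) v) ->
  exists2 s : R, 0 <= s <= 1 & f (p + v) - f p = 'D_v f (p + s *: v).
Proof.
move=> H.
have [|c] := @mean_value (fun h => f (p + h *: v)) (fun h => 'D_v f (p + h *: v)) 0 1.
  rewrite min_l ?max_r// => x x1; apply/is_derive_line.
  exact/derivableP/H.
rewrite min_l ?max_r// => c1; rewrite scale1r scale0r addr0 subr0 mulr1.
by exists c.
Qed.

Lemma derive0_eq (f : R -> R) (a b : R) :
  (forall x, Num.min a b <= x <= Num.max a b -> is_derive x 1 f 0) -> f a = f b.
Proof.
move=> /(@mean_value f (fun=> 0)) [c _ /eqP].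
by rewrite mul0r subr_eq0 => /eqP.
Qed.

End MeanValue.

Section CkTheory.
Context {R : realType} {V : normedModType R}.
Implicit Types (U : set V) (f g : V -> R) (k : nat).

Lemma open_near U p : open U -> U p -> \forall q \near p, U q.
Proof. by move=> oU Up; apply: open_nbhs_nbhs. Qed.

Lemma derive_eq_on U f g p v :
  open U -> U p -> (forall q, U q -> f q = g q) -> 'D_v f p = 'D_v g p.
Proof.
move=> oU Up E; apply: near_eq_derive.
by apply: filterS (open_near oU Up) => q; apply: E.
Qed.

(** Derivatives at a point of the open set U see only nearby points, which lie in U. This lets a
    derivative be replaced by an explicit formula valid on U in the C^k arguments that follow. *)
Lemma Ck_eq k U f g :
  open U -> (forall q, U q -> f q = g q) -> Ck k U f -> Ck k U g.
Proof.
move=> oU; elim: k f g => [|k IH] f g E /=.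
  move=> H p Up; have Hc : f @ p --> f p := H p Up.
  suff : g @ p --> g p by [].
  rewrite -(E p Up); apply: cvg_trans Hc; apply: near_eq_cvg.
  by apply: filterS (open_near oU Up) => q Uq; rewrite E.
move=> [H1 H2]; split; last first.
  move=> v; apply: IH (H2 v) => q Uq; exact: derive_eq_on E.
move=> p Up.
have E' : \forall q \near p, f q = g q.
  by apply: filterS (open_near oU Up) => q; apply: E.
by apply: near_eq_differentiable E' _; apply: H1.
Qed.

End CkTheory.

Section CkClosure.
Context {R : realType} {V : normedModType R}.
Implicit Types (U : set V) (f g : V -> R) (k : nat).

Lemma Ck_subset k U U' f : U' `<=` U -> Ck k U f -> Ck k U' f.
Proof.
move=> s; elim: k f => [|k IH] f /= => [H p /s /H //|[H1 H2]].
by split=> [p /s /H1 //|v]; apply: IH.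
Qed.

Lemma CkW k U f : Ck k.+1 U f -> Ck k U f.
Proof.
elim: k f => [|k IH] f /= [H1 H2].
  by move=> p Up; apply: differentiable_continuous; apply: H1.
by split=> // v; apply: IH.
Qed.

Lemma Ck0 k U f : Ck k U f -> Ck 0 U f.
Proof. by elim: k => // k IH /CkW. Qed.

Lemma Ck_cst k U (c : R) : Ck k U (fun=> c).
Proof.
elim: k c => [|k IH] c /=; first by move=> p _; exact: cst_continuous.
split=> [p _|v]; first exact: differentiable_cst.
have -> : (fun p => 'D_v (fun _ : V => c) p) = (fun=> 0); last exact: IH.
by apply/funext => p; exact: derive_cst.
Qed.

Lemma Ck_add k U f g : open U -> Ck k U f -> Ck k U g ->
  Ck k U (fun p => f p + g p).
Proof.
move=> oU; elim: k f g => [|k IH] f g /=.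
  by move=> H1 H2 p Up; apply: continuousD; [exact: H1|exact: H2].
move=> [H1 H2] [H3 H4]; split=> [p Up|v].
  by apply: differentiableD; [exact: H1|exact: H3].
apply: Ck_eq (IH _ _ (H2 v) (H4 v)) => // p Up.
by rewrite -deriveD //; apply: diff_derivable; [exact: H1|exact: H3].
Qed.

Lemma Ck_mul k U f g : open U -> Ck k U f -> Ck k U g ->
  Ck k U (fun p => f p * g p).
Proof.
move=> oU; elim: k f g => [|k IH] f g.
  by move=> H1 H2 p Up; apply: continuousM; [exact: H1|exact: H2].
move=> F G; have := CkW G; have := CkW F; move: F G => [H1 H2] [H3 H4] F G.
split=> [p Up|v]; first by apply: differentiableM; [exact: H1|exact: H3].
apply: Ck_eq (Ck_add oU (IH _ _ F (H4 v)) (IH _ _ G (H2 v))) => // p Up.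
by rewrite -deriveM //; apply: diff_derivable; [exact: H1|exact: H3].
Qed.

Lemma Ck_scale k U (c : R) f : open U -> Ck k U f -> Ck k U (fun p => c * f p).
Proof. by move=> oU; apply: Ck_mul => //; apply: Ck_cst. Qed.

Lemma Ck_opp k U f : open U -> Ck k U f -> Ck k U (fun p => - f p).
Proof.
move=> oU /(Ck_scale (-1) oU); apply: Ck_eq => // p _; exact: mulN1r.
Qed.

Lemma Ck_sub k U f g : open U -> Ck k U f -> Ck k U g ->
  Ck k U (fun p => f p - g p).
Proof. by move=> oU Hf Hg; apply: Ck_add => //; apply: Ck_opp. Qed.

(** The derivative of 1/f is -(1/f)(1/f) D f, so the induction hypothesis for 1/f itself closes the
    step. *)
Lemma Ck_inv k U f : open U -> (forall p, U p -> f p != 0) -> Ck k U f ->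
  Ck k U (fun p => (f p)^-1).
Proof.
move=> oU f0; elim: k => [|k IH].
  by move=> H1 p Up; apply: continuousV; [exact: f0|exact: H1].
move=> F; have {}IH := IH (CkW F); move: F => [H1 H2].
split=> [p Up|v]; first by apply: differentiableV; [exact: H1|exact: f0].
have := Ck_mul oU (Ck_opp oU (Ck_mul oU IH IH)) (H2 v).
apply: Ck_eq => // p Up; rewrite deriveV ?f0 //; last exact/diff_derivable/H1.
by rewrite -invfM -expr2.
Qed.

Lemma Ck_sum k U n (f : 'I_n -> V -> R) : open U -> (forall i, Ck k U (f i)) ->
  Ck k U (fun p => \sum_(i < n) f i p).
Proof.
move=> oU; elim: n f => [|n IH] f H.
  by apply: Ck_eq (Ck_cst _ _ 0) => // p _; rewrite big_ord0.
apply: Ck_eq (Ck_add oU (IH (fun i => f (widen_ord (leqnSn n) i)) _) (H ord_max)) => //.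
by move=> p _; rewrite big_ord_recr.
Qed.

(* The inner map is given by its components h on finitely many fixed vectors w,
   so that its derivatives are again of this form. *)
Lemma Ck_comp (V' : normedModType R) (U' : set V') (g : V' -> R) k U n
    (h : 'I_n -> V -> R) (w : 'I_n -> V') (phi : V -> V') :
  open U -> smooth_on U' g -> (forall i, Ck k U (h i)) ->
  (forall p, U p -> phi p = \sum_(i < n) h i p *: w i) ->
  (forall p, U p -> U' (phi p)) -> Ck k U (fun p => g (phi p)).
Proof.
move=> oU + + Ephi Uphi; elim: k g h Ephi => [|k IH] g h Ephi gs hs.
  move=> p Up; apply: (@continuous_comp _ _ _ phi g); last exact/(gs 0%N)/Uphi.
  have E : {near p, (\sum_(i < n) (fun q => h i q *: w i)) =1 phi}.
    by apply: filterS (open_near oU Up) => q Uq; rewrite Ephi // fct_sumE.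
  suff : (\sum_(i < n) (fun q => h i q *: w i)) @ p --> phi p.
    by move=> H; apply: cvg_trans H; apply: near_eq_cvg; apply: filterS E => q /esym.
  rewrite Ephi //.
  elim/big_ind2 : _ => [|f1 f2 g1 g2 |i _]; first exact: cvg_cst.
    exact: cvgD.
  by apply: cvgZr_tmp; exact: hs.
have hd i p : U p -> differentiable (h i) p by move=> Up; have [+ _] := hs i; exact.
have gd q : U' q -> differentiable g q by move=> Uq; have [+ _] := gs 1%N; exact.
have E p : U p -> {near p, (\sum_(i < n) (fun q => h i q *: w i)) =1 phi}.
  by move=> Up; apply: filterS (open_near oU Up) => q Uq; rewrite Ephi // fct_sumE.
split=> [p Up|v].
  apply: (@differentiable_comp _ _ _ _ phi g); last exact/gd/Uphi.
  apply: near_eq_differentiable (E p Up) _; apply: differentiable_sum => i.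
  exact/differentiableZl/hd.
have phid p : U p -> is_derive p v phi (\sum_(i < n) 'D_v (h i) p *: w i).
  move=> Up; apply: near_eq_is_derive (E p Up) _.
  apply: is_derive_sum => i.
  have dz : differentiable (fun q => h i q *: w i) p by exact/differentiableZl/hd.
  split; first exact: diff_derivable.
  by rewrite deriveE // diffZl ?deriveE //; exact: hd.
(* The derivative is a sum of products in which the derivatives of g are again composed with phi;
   the induction therefore varies g and keeps phi. *)
apply: (@Ck_eq _ _ k U (fun p => \sum_(i < n) 'D_v (h i) p * 'D_(w i) g (phi p))) => //.
  move=> p Up; have -> := @derive_val _ _ _ _ _ _ _ (is_derive_comp (phid p Up) (gd _ (Uphi p Up))).
  rewrite derive_sumv; last exact/gd/Uphi.
  by apply: eq_bigr => i _; rewrite derive_scaled //; exact/gd/Uphi.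
apply: Ck_sum => // i; apply: Ck_mul => //; first by have [_ +] := hs i; exact.
apply: (IH (fun q => 'D_(w i) g q) h Ephi) => j; last exact: CkW.
by have [_ +] := gs j.+1; exact.
Qed.

(** Meant for affine embeddings and projections, whose derivative L is the same at all points: D_v
    of the composite is D_(L v) g composed with phi, so C^k regularity of g is enough. *)
Lemma Ck_precomp (V' : normedModType R) (U' : set V') (g : V' -> R) k U
    (phi : V -> V') (L : V -> V') :
  open U -> (forall p, U p -> differentiable phi p) ->
  (forall p v, U p -> 'D_v phi p = L v) ->
  (forall p, U p -> U' (phi p)) ->
  Ck k U' g -> Ck k U (fun p => g (phi p)).
Proof.
move=> oU dphi Dphi Uphi; elim: k g => [|k IH] g.
  move=> gs p Up; apply: (@continuous_comp _ _ _ phi g).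
    exact/differentiable_continuous/dphi.
  exact/gs/Uphi.
move=> [g1 g2]; split=> [p Up|v].
  by apply: (@differentiable_comp _ _ _ _ phi g); [exact: dphi|exact/g1/Uphi].
apply: Ck_eq (IH _ (g2 (L v))) => // p Up; rewrite -(Dphi p v Up).
apply/esym; apply: derive_val; apply: is_derive_comp; last exact/g1/Uphi.
exact/differentiable_is_derive/dphi.
Qed.

End CkClosure.

Lemma dist_half_le (R : realFieldType) (a b c e : R) :
  `|a - c| < e / 2 -> `|b - c| < e / 2 -> `|a - b| <= e.
Proof.
rewrite !ltr_norml => /andP[k1 k2] /andP[k3 k4].
by rewrite ler_norml; apply/andP; split; lra.
Qed.

Lemma subB_swap (V : zmodType) (a b c d : V) : a - b - (c - d) = a - c - (b - d).
Proof. by rewrite !opprB ![d - _]addrC addrACA. Qed.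

(** * Symmetry of second derivatives *)

Section Schwarz.
Context {R : realType} {V : normedModType R}.
Implicit Types (U : set V) (f : V -> R).

(** The mean value theorem is used twice: in direction v for f(. + w) - f, then in direction w for
    D_v f. *)
Lemma second_difference U f p v w : open U -> smooth_on U f ->
  (forall s s' : R, 0 <= s <= 1 -> 0 <= s' <= 1 -> U (p + s *: v + s' *: w)) ->
  exists s s' : R, [/\ 0 <= s <= 1, 0 <= s' <= 1 &
    f (p + v + w) - f (p + v) - (f (p + w) - f p) =
    'D_w (fun q => 'D_v f q) (p + s *: v + s' *: w)].
Proof.
move=> oU fs HU.
have df q : U q -> differentiable f q by move=> Uq; have [+ _] := fs 1%N; exact.
have ddf q : U q -> differentiable (fun q => 'D_v f q) q.
  by move=> Uq; have [_ /(_ v) [+ _]] := fs 2%N; exact.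
have U0 (s : R) : 0 <= s <= 1 -> U (p + s *: v).
  by move=> s1; rewrite -[_ + _]addr0 -(scale0r w); apply: HU; rewrite ?lexx ?ler01.
have U1 (s : R) : 0 <= s <= 1 -> U (p + w + s *: v).
  by move=> s1; rewrite addrAC -{1}(scale1r w); apply: HU; rewrite ?lexx ?ler01.
have [s s1 Es] : exists2 s : R, 0 <= s <= 1 &
    (f (p + w + 1 *: v) - f (p + 1 *: v)) - (f (p + w + 0 *: v) - f (p + 0 *: v))
    = ('D_v f (p + w + s *: v) - 'D_v f (p + s *: v)) * (1 - 0).
  have := @mean_value R (fun s => f (p + w + s *: v) - f (p + s *: v))
     (fun s => 'D_v f (p + w + s *: v) - 'D_v f (p + s *: v)) 0 1.
  rewrite min_l ?ler01 // max_r ?ler01 //; apply => s s1.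
  by apply: is_deriveB; apply/is_derive_line/differentiable_is_derive/df; [exact: U1|exact: U0].
have [|s' s'1 Es'] := @mean_value_line R V (fun q => 'D_v f q) (p + s *: v) w.
  by move=> s' s'1; apply/diff_derivable/ddf/HU.
exists s, s'; split=> //; rewrite -Es'; move: Es.
by rewrite !scale1r !scale0r !addr0 subr0 mulr1 (addrAC p w v) (addrAC p w) => ->.
Qed.

(** The second difference is symmetric in v and w, so the two mixed derivatives agree when each is
    taken at a suitable point close to p. Continuity transfers this to p up to an arbitrary e. *)
Lemma derive_comm U f v w p : open U -> U p -> smooth_on U f ->
  'D_w (fun q => 'D_v f q) p = 'D_v (fun q => 'D_w f q) p.
Proof.
move=> oU Up fs.
set A := LHS; set B := RHS.
apply/eqP; rewrite -subr_eq0 -normr_le0; apply/ler_addgt0Pl => e e0; rewrite addr0.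
have cA (a b : V) : {for p, continuous (fun q => 'D_b (fun q => 'D_a f q) q)}.
  by have [_ /(_ a) [_ /(_ b)]] := fs 2%N; exact.
have e20 : 0 < e / 2 by rewrite divr_gt0.
have := open_near oU Up.
have /cvgrPdist_lt /(_ _ e20) := cA v w.
have /cvgrPdist_lt /(_ _ e20) := cA w v.
move=> H1 H2 H3; have [d /= d0 Hd] := (nbhs_normP _ _).1 (filterI H1 (filterI H2 H3)).
have n0 : 0 < 1 + `|v| + `|w| by rewrite -addrA ltr_pwDl // addr_ge0.
(* The parallelogram at p spanned by s v and s w stays in the ball of radius d, where both mixed
   derivatives are within e / 2 of their values at p. *)
have [s s0 sd] : exists2 s : R, 0 < s & s * (1 + `|v| + `|w|) < d.
  exists (d / (2 * (1 + `|v| + `|w|))); first by rewrite divr_gt0 // mulr_gt0.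
  by rewrite invfM mulrA divfK ?gt_eqF //; lra.
have Hs a b : 0 <= a <= 1 -> 0 <= b <= 1 ->
    ball_ Num.norm p d (p + a *: (s *: v) + b *: (s *: w)).
  move=> /andP[a0 a1] /andP[b0 b1].
  rewrite /ball_ /= opprD opprD !addrA subrr sub0r -opprD normrN.
  rewrite (le_lt_trans (ler_normD _ _)) // !normrZ. rewrite !(ger0_norm a0) !(ger0_norm b0) (gtr0_norm s0).
  apply: le_lt_trans sd.
  have := normr_ge0 v; have := normr_ge0 w; move: (`|v|) (`|w|) => x y y0 x0.
  have : a * (s * x) <= s * x by rewrite ler_piMl ?mulr_ge0 // ltW.
  have : b * (s * y) <= s * y by rewrite ler_piMl ?mulr_ge0 // ltW.
  lra.
have Hs' a b : 0 <= a <= 1 -> 0 <= b <= 1 ->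
    ball_ Num.norm p d (p + a *: (s *: w) + b *: (s *: v)).
  by move=> a1 b1; rewrite addrAC; apply: Hs.
have HU a b : 0 <= a <= 1 -> 0 <= b <= 1 -> U (p + a *: (s *: v) + b *: (s *: w)).
  by move=> a1 b1; have [_ []] := Hd _ (Hs a b a1 b1).
have HU' a b : 0 <= a <= 1 -> 0 <= b <= 1 -> U (p + a *: (s *: w) + b *: (s *: v)).
  by move=> a1 b1; rewrite addrAC; apply: HU.
have sc (a b : V) q : U q ->
    'D_(s *: b) (fun q => 'D_(s *: a) f q) q = s ^+ 2 * 'D_b (fun q => 'D_a f q) q.
  move=> Uq.
  have E : forall q, U q -> 'D_(s *: a) f q = s * 'D_a f q.
    by move=> q' Uq'; rewrite derive_scaled //; have [+ _] := fs 1%N; exact.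
  rewrite (derive_eq_on _ oU Uq E).
  have dd : differentiable (fun q => 'D_a f q) q.
    by have [_ /(_ a) [+ _]] := fs 2%N; exact.
  rewrite (_ : (fun q => s * 'D_a f q) = s *: (fun q => 'D_a f q)) //.
  rewrite deriveZ; last exact: diff_derivable.
  by rewrite derive_scaled // expr2 -mulrA.
have [a [b [a1 b1 E1]]] := second_difference oU fs HU.
have [a' [b' [a1' b1' E2]]] := second_difference oU fs HU'.
have [K1 [K2 U1]] := Hd _ (Hs a b a1 b1).
have [K3 [K4 U2]] := Hd _ (Hs' a' b' a1' b1').
rewrite sc // in E1; rewrite sc // in E2.
move: E1 E2; rewrite (addrAC p) => E1 E2.
have : s ^+ 2 * 'D_w (fun q => 'D_v f q) (p + a *: (s *: v) + b *: (s *: w)) =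
       s ^+ 2 * 'D_v (fun q => 'D_w f q) (p + a' *: (s *: w) + b' *: (s *: v)).
  exact: etrans (esym E1) (etrans (subB_swap _ _ _ _) E2).
move/(mulfI _) => /(_ _) E.
have s20 : s ^+ 2 != 0 by rewrite expf_eq0 /= gt_eqF.
have {}K3 : `|B - 'D_v (fun q => 'D_w f q) (p + a' *: (s *: w) + b' *: (s *: v))| < e / 2 := K3.
have {}K2 : `|A - 'D_w (fun q => 'D_v f q) (p + a *: (s *: v) + b *: (s *: w))| < e / 2 := K2.
by rewrite (E s20) in K2; exact: dist_half_le K2 K3.
Qed.

End Schwarz.

(** * Partial derivatives of functions of three variables *)

Section Coordinates.
Context {R : realType}.
Notation R3 := (R * R * R)%type.
Implicit Types (U : set R3) (f : R3 -> R) (p q : R3).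

Lemma fst_cont (U V : topologicalType) : continuous (@fst U V).
Proof. by move=> x; exact: cvg_fst. Qed.

Lemma snd_cont (U V : topologicalType) : continuous (@snd U V).
Proof. by move=> x; exact: cvg_snd. Qed.

Lemma norm_coord3 p : [/\ `|p.1.1| <= `|p|, `|p.1.2| <= `|p| & `|p.2| <= `|p|].
Proof.
have E : `|p| = Num.max (Num.max `|p.1.1| `|p.1.2|) `|p.2| by [].
by rewrite E !le_max !lexx !orbT.
Qed.

Lemma norm_lt3 (a b c d : R) :
  `|a| < d -> `|b| < d -> `|c| < d -> `|((a, b, c) : R3)| < d.
Proof.
have E : `|((a, b, c) : R3)| = Num.max (Num.max `|a| `|b|) `|c| by [].
by rewrite E !gt_max => -> -> ->.
Qed.

Definition ex1 : R3 := (1, 0, 0).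
Definition ex2 : R3 := (0, 1, 0).
Definition ex3 : R3 := (0, 0, 1).

Lemma addR3 (x y z x' y' z' : R) :
  ((x, y, z) : R3) + (x', y', z') = (x + x', y + y', z + z').
Proof. by []. Qed.

Lemma scaleR3 (k x y z : R) : k *: ((x, y, z) : R3) = (k * x, k * y, k * z).
Proof. by []. Qed.

Lemma scale_ex1 (k : R) : k *: ex1 = (k, 0, 0).
Proof. by rewrite /ex1 scaleR3 !mulr0 mulr1. Qed.

Lemma scale_ex2 (k : R) : k *: ex2 = (0, k, 0).
Proof. by rewrite /ex2 scaleR3 !mulr0 mulr1. Qed.

Lemma scale_ex3 (k : R) : k *: ex3 = (0, 0, k).
Proof. by rewrite /ex3 scaleR3 !mulr0 mulr1. Qed.

Definition scale_ex := (scale_ex1, scale_ex2, scale_ex3).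

Lemma R3_decomp (v : R3) :
  v = v.1.1 *: ex1 + v.1.2 *: ex2 + v.2 *: ex3.
Proof.
by case: v => [[a b] c]; rewrite !scale_ex !addR3 !addr0 !add0r.
Qed.

Lemma is_derive_ex1 f (t x u l : R) :
  is_derive t 1 (fun s => f (s, x, u)) l <-> is_derive ((t, x, u) : R3) ex1 f l.
Proof.
have E (s : R) : ((0, x, u) : R3) + s *: ex1 = (s, x, u).
  by rewrite scale_ex addR3 ?addr0 ?add0r.
rewrite -(E t) -is_derive_line; split; apply: near_eq_is_derive; near=> s; by rewrite E.
Unshelve. all: by end_near. Qed.

Lemma is_derive_ex2 f (t x u l : R) :
  is_derive x 1 (fun s => f (t, s, u)) l <-> is_derive ((t, x, u) : R3) ex2 f l.
Proof.
have E (s : R) : ((t, 0, u) : R3) + s *: ex2 = (t, s, u).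
  by rewrite scale_ex addR3 ?addr0 ?add0r.
rewrite -(E x) -is_derive_line; split; apply: near_eq_is_derive; near=> s; by rewrite E.
Unshelve. all: by end_near. Qed.

Lemma is_derive_ex3 f (t x u l : R) :
  is_derive u 1 (fun s => f (t, x, s)) l <-> is_derive ((t, x, u) : R3) ex3 f l.
Proof.
have E (s : R) : ((t, x, 0) : R3) + s *: ex3 = (t, x, s).
  by rewrite scale_ex addR3 ?addr0 ?add0r.
rewrite -(E u) -is_derive_line; split; apply: near_eq_is_derive; near=> s; by rewrite E.
Unshelve. all: by end_near. Qed.

Lemma between_norm (a c : R) :
  Num.min 0 a <= c <= Num.max 0 a -> `|c| <= `|a|.
Proof.
have [a0|a0] := lerP 0 a.
  by move=> /andP[c0 ca]; rewrite !ger0_norm.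
move=> /andP[c0 ca].
by rewrite (ltr0_norm a0) ler0_norm // lerN2.
Qed.

(** The candidate differential with partial derivatives a, b, c, equipped with a linear structure so
    that [differentiable_eps] accepts it. *)
Definition lin3 (a b c : R) (h : R3) : R := h.1.1 * a + h.1.2 * b + h.2 * c.

Lemma lin3_linear a b c : linear (lin3 a b c).
Proof.
by move=> k [[x y] z] [[x' y'] z']; rewrite /lin3 /= [k *: _]mulrC /GRing.scale /=; ring.
Qed.

HB.instance Definition _ a b c :=
  GRing.isLinear.Build R R3 R *:%R (lin3 a b c) (@lin3_linear a b c).

Lemma lin3_continuous a b c : continuous (lin3 a b c).
Proof.
move=> h; apply: cvgD; first apply: cvgD.
- apply: cvgMr_tmp; apply: (@continuous_comp _ _ _ fst fst); exact: fst_cont.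
- apply: cvgMr_tmp; apply: (@continuous_comp _ _ _ fst snd).
    exact: fst_cont.
  exact: snd_cont.
- apply: cvgMr_tmp; exact: snd_cont.
Qed.

Lemma lin3_close (a b c x1 x2 x3 y1 y2 y3 e n : R) :
  `|y1 - x1| < e / 3 -> `|y2 - x2| < e / 3 -> `|y3 - x3| < e / 3 ->
  `|a| <= n -> `|b| <= n -> `|c| <= n ->
  `|x1 * a + x2 * b + x3 * c - lin3 y1 y2 y3 (a, b, c)| <= e * n.
Proof.
rewrite (distrC y1) (distrC y2) (distrC y3) => /ltW h1 /ltW h2 /ltW h3 ha hb hc.
have -> : x1 * a + x2 * b + x3 * c - lin3 y1 y2 y3 (a, b, c) =
    (x1 - y1) * a + (x2 - y2) * b + (x3 - y3) * c by rewrite /lin3 /=; ring.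
have -> : e * n = e / 3 * n + e / 3 * n + e / 3 * n by field.
rewrite (le_trans (ler_normD _ _)) // lerD // ?(le_trans (ler_normD _ _)) // ?lerD //.
all: by rewrite normrM ler_pM.
Qed.

Lemma telescope3 (x y z t : R) : t - x = (y - x) + (z - y) + (t - z).
Proof. ring. Qed.

(** The increment of f is split along three edges parallel to the axes; the mean value theorem on
    each edge and continuity of the partial derivatives at p produce the differential. This is the
    lifting step from C^k to C^(k+1) for the implicit inverse, the primitives and the flow. *)
Lemma Ck_partials k U f (g1 g2 g3 : R3 -> R) : open U ->
  Ck k U g1 -> Ck k U g2 -> Ck k U g3 ->
  (forall p, U p -> is_derive p ex1 f (g1 p)) ->
  (forall p, U p -> is_derive p ex2 f (g2 p)) ->
  (forall p, U p -> is_derive p ex3 f (g3 p)) -> Ck k.+1 U f.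
Proof.
move=> oU C1 C2 C3 D1 D2 D3.
have step (e : R3) g p (a : R) :
    (forall q, U q -> is_derive q e f (g q)) ->
    (forall c, `|c| <= `|a| -> U (p + c *: e)) ->
    exists2 c, `|c| <= `|a| & f (p + a *: e) - f p = g (p + c *: e) * a.
  move=> Dg Up.
  have [|c c1] := @mean_value R (fun s => f (p + s *: e)) (fun s => g (p + s *: e)) 0 a.
    by move=> s /between_norm /Up Us; apply/is_derive_line/Dg.
  by rewrite scale0r addr0 subr0 => E; exists c => //; apply: between_norm.
have dE p : U p -> differentiable f p /\ forall v, 'D_v f p = lin3 (g1 p) (g2 p) (g3 p) v.
  move=> Up; have df : differentiable f p.
    apply: (@differentiable_eps _ _ _ _ _ (lin3 (g1 p) (g2 p) (g3 p))).
      exact: lin3_continuous.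
    move=> e e0; have e30 : 0 < e / 3 by rewrite divr_gt0.
    have /cvgrPdist_lt /(_ _ e30) H1 : {for p, continuous g1} by exact: (Ck0 C1).
    have /cvgrPdist_lt /(_ _ e30) H2 : {for p, continuous g2} by exact: (Ck0 C2).
    have /cvgrPdist_lt /(_ _ e30) H3 : {for p, continuous g3} by exact: (Ck0 C3).
    have [d /= d0 Hd] := (nbhs_normP _ _).1 (filterI (open_near oU Up) (filterI H1 (filterI H2 H3))).
    have Hd' (a b c : R) : `|a| < d -> `|b| < d -> `|c| < d ->
       [/\ U (p + (a, b, c)), `|g1 p - g1 (p + (a, b, c))| < e / 3,
          `|g2 p - g2 (p + (a, b, c))| < e / 3 & `|g3 p - g3 (p + (a, b, c))| < e / 3].
      move=> ad bd cd; have [|K1 [K2 [K3 K4]]] := Hd (p + (a, b, c)) => //.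
      by rewrite /ball_ /= opprD addrA subrr sub0r normrN; apply: norm_lt3.
    apply/nbhs_normP; exists d => // h; rewrite /ball_ /= sub0r normrN => hd.
    have [h1 h2 h3] := norm_coord3 h.
    have hd1 := le_lt_trans h1 hd; have hd2 := le_lt_trans h2 hd.
    have hd3 := le_lt_trans h3 hd; have n0 : `|0 : R| < d by rewrite normr0.
    case: h hd h1 h2 h3 hd1 hd2 hd3 => [[a b] c] /= hd h1 h2 h3 hd1 hd2 hd3.
    have P1 (s : R) : p + s *: ex1 = p + (s, 0, 0).
      by rewrite scale_ex.
    have P2 (s : R) : p + (a, 0, 0) + s *: ex2 = p + (a, s, 0).
      by rewrite -addrA scale_ex addR3 !addr0 !add0r.
    have P3 (s : R) : p + (a, b, 0) + s *: ex3 = p + (a, b, s).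
      by rewrite -addrA scale_ex addR3 !addr0 !add0r.
    have [s sa|s1 s1a E1] := step ex1 g1 p a D1.
      by rewrite P1; have [] := Hd' s 0 0 (le_lt_trans sa hd1) n0 n0.
    have [s sb|s2 s2b E2] := step ex2 g2 (p + (a, 0, 0)) b D2.
      by rewrite P2; have [] := Hd' a s 0 hd1 (le_lt_trans sb hd2) n0.
    have [s sc|s3 s3c E3] := step ex3 g3 (p + (a, b, 0)) c D3.
      by rewrite P3; have [] := Hd' a b s hd1 hd2 (le_lt_trans sc hd3).
    rewrite !P1 in E1; rewrite !P2 in E2; rewrite !P3 in E3.
    have [_ + _ _] := Hd' s1 0 0 (le_lt_trans s1a hd1) n0 n0.
    have [_ _ + _] := Hd' a s2 0 hd1 (le_lt_trans s2b hd2) n0.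
    have [_ _ _] := Hd' a b s3 hd1 hd2 (le_lt_trans s3c hd3).
    rewrite [(a, b, c) + p]addrC.
    have -> : f (p + (a, b, c)) - f p = g1 (p + (s1, 0, 0)) * a +
       g2 (p + (a, s2, 0)) * b + g3 (p + (a, b, s3)) * c.
      by rewrite -E1 -E2 -E3; exact: telescope3.
    by move=> k3 k2 k1; apply: lin3_close.
  split=> // v; rewrite {1}(R3_decomp v) !derive_addv // !derive_scaled //.
  by rewrite (@derive_val _ _ _ _ _ _ _ (D1 p Up)) (@derive_val _ _ _ _ _ _ _ (D2 p Up)) (@derive_val _ _ _ _ _ _ _ (D3 p Up)).
split=> [p Up|v]; first by have [] := dE p Up.
apply: (@Ck_eq _ _ k U (lin3 (v.1.1) v.1.2 v.2 \o (fun p => (g1 p, g2 p, g3 p)))) => //.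
  by move=> p Up; have [_ ->] := dE p Up; rewrite /lin3 /=; ring.
rewrite /lin3 /=.
apply: Ck_add => //; first apply: Ck_add => //.
all: apply: Ck_mul => //; exact: Ck_cst.
Qed.

End Coordinates.

(** * Implicit functions *)

Lemma between_dist (R : realDomainType) (a b c : R) :
  Num.min a b <= c <= Num.max a b -> `|c - a| <= `|b - a|.
Proof.
have [ab|ab] := lerP a b => /andP[c1 c2].
  by rewrite !ger0_norm ?subr_ge0 // lerB.
by rewrite ![`|_ - a|]distrC !ger0_norm ?subr_ge0 ?(ltW ab) // lerB.
Qed.

Lemma between_near (R : realFieldType) (a b c k d : R) :
  `|a - k| < d -> `|b - k| < d -> Num.min a b <= c <= Num.max a b -> `|c - k| < d.
Proof.
rewrite !ltr_norml => /andP[h1 h2] /andP[h3 h4].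
by have [ab|ab] := lerP a b => /andP[c1 c2]; apply/andP; split; lra.
Qed.

Section Tools.
Context {R : realType}.
Notation R3 := (R * R * R)%type.

Lemma is_derive_cvg (V W : normedModType R) (f : V -> W) p v l :
  (fun h : R => h^-1 *: (f (h *: v + p) - f p)) @ 0^' --> l <-> is_derive p v f l.
Proof.
split=> [H|[/cvg_ex [l' Hl'] E]]; last first.
  suff <- : l' = l by [].
  by rewrite -E; apply/esym; apply: cvg_lim.
have c : derivable f p v by apply/cvg_ex; exists l.
by split=> //; apply: cvg_lim.
Qed.

Lemma is_derive_pair (U V W : normedModType R) (f : U -> V) (g : U -> W) p v a b :
  is_derive p v f a -> is_derive p v g b ->
  is_derive p v (fun q => (f q, g q)) (a, b).
Proof.
move=> /is_derive_cvg H1 /is_derive_cvg H2; apply/is_derive_cvg.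
exact: cvg_pair H1 H2.
Qed.

Lemma is_derive_comp3 (V : normedModType R) (g : R3 -> R) (a b c : V -> R) p v a' b' c' :
  is_derive p v a a' -> is_derive p v b b' -> is_derive p v c c' ->
  differentiable g (a p, b p, c p) ->
  is_derive p v (fun q => g (a q, b q, c q))
    ('D_ex1 g (a p, b p, c p) * a' + 'D_ex2 g (a p, b p, c p) * b' +
     'D_ex3 g (a p, b p, c p) * c').
Proof.
move=> da db dc dg.
apply: (is_derive_eq (is_derive_comp (is_derive_pair (is_derive_pair da db) dc) dg)).
rewrite {1}(R3_decomp (a', b', c')) !derive_addv // !derive_scaled //.
by rewrite ![_ *: _]mulrC.
Qed.

Lemma Ck_comp3 (V : normedModType R) U (g : R3 -> R) (U' : set R3) (a b c : V -> R) k :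
  open U -> smooth_on U' g -> Ck k U a -> Ck k U b -> Ck k U c ->
  (forall p, U p -> U' (a p, b p, c p)) ->
  Ck k U (fun p => g (a p, b p, c p)).
Proof.
move=> oU gs ca cb cc H.
apply: (@Ck_comp _ _ _ U' g k U 3
  (fun i : 'I_3 => if i == 0 :> nat then a else if i == 1%N :> nat then b else c)
  (fun i : 'I_3 => if i == 0 :> nat then ex1 else if i == 1%N :> nat then ex2 else ex3)) => //.
  by move=> i; do 2?case: ifP => _.
by move=> p _; rewrite !big_ord_recr big_ord0 /= add0r !scale_ex !addR3 !addr0 !add0r.
Qed.

Lemma Ck_fst k (U : set R3) : open U -> Ck k U (fun p : R3 => p.1.1).
Proof.
move=> oU; apply: CkW.
apply: (@Ck_partials R k U (fun p : R3 => p.1.1) (fun=> 1) (fun=> 0) (fun=> 0)) => //; try exact: Ck_cst.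
all: move=> [[t x] u] _.
- by apply/is_derive_ex1; exact: is_derive_id.
- by apply/is_derive_ex2; exact: is_derive_cst.
- by apply/is_derive_ex3; exact: is_derive_cst.
Qed.

Lemma Ck_snd k (U : set R3) : open U -> Ck k U (fun p : R3 => p.1.2).
Proof.
move=> oU; apply: CkW.
apply: (@Ck_partials R k U (fun p : R3 => p.1.2) (fun=> 0) (fun=> 1) (fun=> 0)) => //; try exact: Ck_cst.
all: move=> [[t x] u] _.
- by apply/is_derive_ex1; exact: is_derive_cst.
- by apply/is_derive_ex2; exact: is_derive_id.
- by apply/is_derive_ex3; exact: is_derive_cst.
Qed.

Lemma Ck_thd k (U : set R3) : open U -> Ck k U (fun p : R3 => p.2).
Proof.
move=> oU; apply: CkW.
apply: (@Ck_partials R k U (fun p : R3 => p.2) (fun=> 0) (fun=> 0) (fun=> 1)) => //; try exact: Ck_cst.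
all: move=> [[t x] u] _.
- by apply/is_derive_ex1; exact: is_derive_cst.
- by apply/is_derive_ex2; exact: is_derive_cst.
- by apply/is_derive_ex3; exact: is_derive_id.
Qed.

Lemma smooth_derive (V : normedModType R) (U : set V) (f : V -> R) v :
  smooth_on U f -> smooth_on U (fun p => 'D_v f p).
Proof. by move=> fs k; have [_ +] := fs k.+1; exact. Qed.

Lemma smooth_diff (V : normedModType R) (U : set V) (f : V -> R) p :
  smooth_on U f -> U p -> differentiable f p.
Proof. by move=> fs Up; have [+ _] := fs 1%N; exact. Qed.

Lemma smooth_cont (V : normedModType R) (U : set V) (f : V -> R) p :
  smooth_on U f -> U p -> {for p, continuous f}.
Proof. by move=> fs; apply: (fs 0%N). Qed.

(** The ball of the maximum norm, written by coordinates so that one coordinate can be changed while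
    the others stay. *)
Definition box3 (q0 : R3) (d : R) : set R3 :=
  [set q | [/\ `|q.1.1 - q0.1.1| < d, `|q.1.2 - q0.1.2| < d & `|q.2 - q0.2| < d]].

Lemma box3E q0 d q : box3 q0 d q <-> ball_ Num.norm q0 d q.
Proof.
rewrite /ball_ /= distrC; split=> [[h1 h2 h3]|h].
  by case: q h1 h2 h3 => [[a b] c]; case: q0 => [[a0 b0] c0]; apply: norm_lt3.
have [] := norm_coord3 (q - q0) => h1 h2 h3.
split; [exact: le_lt_trans h1 h|exact: le_lt_trans h2 h|exact: le_lt_trans h3 h].
Qed.

Lemma box3_open q0 d : open (box3 q0 d).
Proof.
rewrite (_ : box3 q0 d = ball q0 d); first exact: ball_open.
apply/seteqP; split=> q; rewrite -ball_normE => /box3E //.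
Qed.

Lemma near_box3 q0 (P : set R3) :
  (\forall q \near q0, P q) -> exists2 d : R, 0 < d & box3 q0 d `<=` P.
Proof.
move=> /nbhs_normP [d /= d0 H]; exists d => // q /box3E; exact: H.
Qed.

Lemma box3_near q0 (d : R) : 0 < d -> \forall q \near q0, box3 q0 d q.
Proof.
move=> d0; apply: open_near; first exact: box3_open.
by split; rewrite subrr normr0.
Qed.

Lemma near_dist_lt (T : topologicalType) (g : T -> R) (p : T) (a e : R) :
  {for p, continuous g} -> `|g p - a| < e -> \forall q \near p, `|g q - a| < e.
Proof.
move=> c h; have h' : 0 < e - `|g p - a| by rewrite subr_gt0.
have /cvgrPdist_lt /(_ _ h') := c; apply: filterS => q; rewrite distrC => h2.
rewrite -(subrKA (g p)); apply: le_lt_trans (ler_normD _ _) _.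
by rewrite -ltrBrDr.
Qed.

Lemma near_gt0 (T : topologicalType) (g : T -> R) (p : T) :
  {for p, continuous g} -> 0 < g p -> \forall q \near p, 0 < g q.
Proof.
move=> c h; have /cvgrPdist_lt /(_ _ h) := c; apply: filterS => q.
by rewrite ltr_norml => /andP[_]; rewrite ltrBlDr ltrDl.
Qed.

Lemma cont_pair (T U V : topologicalType) (f : T -> U) (g : T -> V) p :
  {for p, continuous f} -> {for p, continuous g} ->
  {for p, continuous (fun q => (f q, g q))}.
Proof. by move=> cf cg; exact: cvg_pair cf cg. Qed.

Lemma cont_fst3 : continuous (fun q : R3 => q.1.1).
Proof. by move=> p; apply: (@continuous_comp _ _ _ fst fst); exact: fst_cont. Qed.

Lemma cont_snd3 : continuous (fun q : R3 => q.1.2).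
Proof.
move=> p; apply: (@continuous_comp _ _ _ fst snd); first exact: fst_cont.
exact: snd_cont.
Qed.

Lemma cont_thd3 : continuous (fun q : R3 => q.2).
Proof. exact: snd_cont. Qed.

End Tools.

Lemma dist_lt_l (R : realFieldType) (a b e u : R) :
  `|a - b| < e -> a + 2 * e < u -> b < u - e.
Proof. by rewrite ltr_norml => /andP[h1 h2] h3; lra. Qed.

Lemma dist_lt_r (R : realFieldType) (a b e u : R) :
  `|a - b| < e -> u + 2 * e < a -> u + e < b.
Proof. by rewrite ltr_norml => /andP[h1 h2] h3; lra. Qed.

(** Solves the mean value identity for the difference quotient of the implicit inverse: k is the
    increment of the inverse, D the derivative at the intermediate point. *)
Lemma quotient_solve (R : fieldType) (h v2 f1 f0 D k : R) : h != 0 -> D != 0 ->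
  h * v2 + f0 - f1 = D * k -> (v2 - h^-1 * (f1 - f0)) / D = h^-1 * k.
Proof.
move=> h0 D0 E; have -> : k = (h * v2 + f0 - f1) / D by rewrite E mulrC mulKf.
by field; rewrite h0 D0.
Qed.

Section ImplicitFunction.
Context {R : realType}.
Notation R3 := (R * R * R)%type.

(** On a box f is strictly increasing in its third variable. Monotonicity gives uniqueness and
    continuity of the solution, the intermediate value theorem its existence. W and N' are matched
    so that (t, x, k) -> (t, x, f) and (t, x, u) -> (t, x, kap) are inverse to each other between
    them. *)
Lemma implicit_inverse_pos (f : R3 -> R) (N : set R3) (q0 : R3) :
  open N -> N q0 -> smooth_on N f -> (forall q, N q -> 0 < 'D_ex3 f q) ->
  exists (W N' : set R3) (kap : R3 -> R),
    [/\ [/\ open W, W (q0.1, f q0) & smooth_on W kap],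
        [/\ open N', N' q0 & N' `<=` N],
        (forall p, W p -> N' (p.1, kap p) /\ f (p.1, kap p) = p.2) &
        (forall q, N' q -> W (q.1, f q) /\ kap (q.1, f q) = q.2)].
Proof.
move=> oN Nq0 fs fpos.
have [d d0 dN] := near_box3 (open_near oN Nq0).
case: q0 Nq0 dN => [[t0 x0] k0] Nq0 dN.
have NB t x k : `|t - t0| < d -> `|x - x0| < d -> `|k - k0| < d -> N (t, x, k).
  by move=> h1 h2 h3; apply: dN.
have mono t x k k' : `|t - t0| < d -> `|x - x0| < d -> `|k - k0| < d ->
    `|k' - k0| < d -> k < k' -> f (t, x, k) < f (t, x, k').
  move=> h1 h2 h3 h4 kk'.
  have btw c : k <= c <= k' -> `|c - k0| < d.
    move: h3 h4; rewrite !ltr_norml => /andP[a1 a2] /andP[a3 a4] /andP[a5 a6].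
    by apply/andP; split; lra.
  have [|c] := @mean_value R (fun s => f (t, x, s)) (fun s => 'D_ex3 f (t, x, s)) k k'.
    rewrite min_l ?max_r ?(ltW kk') // => c /btw c1.
    apply/is_derive_ex3/differentiable_is_derive/(smooth_diff fs).
    exact: NB.
  rewrite min_l ?max_r ?(ltW kk') // => /btw c1 E.
  by rewrite -subr_gt0 E mulr_gt0 ?subr_gt0 //; apply/fpos/NB.
have cont t x k : `|t - t0| < d -> `|x - x0| < d -> `|k - k0| < d -> {for (t, x, k), continuous f}.
  by move=> h1 h2 h3; apply: (smooth_cont fs); exact: NB.
pose dl := d / 2; have dl0 : 0 < dl by rewrite divr_gt0.
have dld : dl < d by rewrite /dl; lra.
have n0 : `|0 : R| < d by rewrite normr0.
have np : `|k0 + dl - k0| < d by rewrite addrAC subrr add0r gtr0_norm.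
have nm : `|k0 - dl - k0| < d by rewrite addrAC subrr add0r normrN gtr0_norm.
have nt : `|t0 - t0| < d by rewrite subrr. have nx : `|x0 - x0| < d by rewrite subrr.
have nk : `|k0 - k0| < d by rewrite subrr.
set u0 := f (t0, x0, k0).
have Au : f (t0, x0, k0 - dl) < u0 by apply: mono => //; lra.
have uB : u0 < f (t0, x0, k0 + dl) by apply: mono => //; lra.
(* The gap is 2 e so that one e can be spent on moving (t, x) at the ends k0 - dl and k0 + dl, and
   the other on moving u around u0. *)
have [e e0 [eA eB]] : exists2 e : R, 0 < e &
    f (t0, x0, k0 - dl) + 2 * e < u0 /\ u0 + 2 * e < f (t0, x0, k0 + dl).
  move: Au uB; move: (f (t0, x0, k0 - dl)) (f (t0, x0, k0 + dl)) u0 => A B u Au uB.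
  exists (Num.min (u - A) (B - u) / 3); first by rewrite divr_gt0 // lt_min !subr_gt0 Au.
  have : Num.min (u - A) (B - u) <= u - A by rewrite ge_min lexx.
  have : Num.min (u - A) (B - u) <= B - u by rewrite ge_min lexx orbT.
  by move: (Num.min _ _) => m; lra.
have [et et0 [etd etA etB]] : exists2 et : R, 0 < et & [/\ et <= d,
    forall t x, `|t - t0| < et -> `|x - x0| < et -> f (t, x, k0 - dl) < u0 - e &
    forall t x, `|t - t0| < et -> `|x - x0| < et -> u0 + e < f (t, x, k0 + dl)].
  have [d1 d10 H1] : exists2 d1 : R, 0 < d1 & box3 (t0, x0, k0 - dl) d1 `<=` [set q | f q < u0 - e].
    apply: near_box3; have /cvgrPdist_lt /(_ _ e0) := cont t0 x0 (k0 - dl) nt nx nm.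
    by apply: filterS => q h; apply: dist_lt_l h eA.
  have [d2 d20 H2] : exists2 d1 : R, 0 < d1 & box3 (t0, x0, k0 + dl) d1 `<=` [set q | u0 + e < f q].
    apply: near_box3; have /cvgrPdist_lt /(_ _ e0) := cont t0 x0 (k0 + dl) nt nx np.
    by apply: filterS => q h; apply: dist_lt_r h eB.
  exists (Num.min d (Num.min d1 d2)); first by rewrite !lt_min d0 d10.
  split=> [|t x|t x]; rewrite ?ge_min ?lexx // !lt_min => /and3P[a1 a2 a3] /and3P[b1 b2 b3].
    by apply: H1; split; rewrite /= ?subrr ?normr0.
  by apply: H2; split; rewrite /= ?subrr ?normr0.
pose W : set R3 := [set p | [/\ `|p.1.1 - t0| < et, `|p.1.2 - x0| < et & `|p.2 - u0| < e]].
have oW : open W.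
  rewrite openE => p [p1 p2 p3].
  have H1 := near_dist_lt (@cont_fst3 R p) p1.
  have H2 := near_dist_lt (@cont_snd3 R p) p2.
  have H3 := near_dist_lt (@cont_thd3 R p) p3.
  by apply: filterS3 H1 H2 H3 => q.
pose N' : set R3 := [set q | W (q.1, f q) /\ `|q.2 - k0| < dl].
have N'N : N' `<=` N.
  move=> [[t x] k] [[/= h1 h2 h3] h4]; apply: NB; first exact: lt_le_trans etd.
    exact: lt_le_trans etd.
  exact: lt_trans dld.
have oN' : open N'.
  rewrite openE => q qN'; have Nq := N'N _ qN'; have [Wq hq] := qN'.
  have cT : {for q, continuous (fun q => (q.1, f q))}.
    by apply: cont_pair; [exact: fst_cont|apply: (smooth_cont fs)].
  have H1 : \forall q' \near q, W (q'.1, f q') by exact: (cT _ (open_near oW Wq)).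
  have H2 := near_dist_lt (@cont_thd3 R q) hq.
  by apply: filterS2 H1 H2 => q'.
have inj (t x k k' : R) : `|t - t0| < et -> `|x - x0| < et -> `|k - k0| < d ->
    `|k' - k0| < d -> f (t, x, k) = f (t, x, k') -> k = k'.
  move=> h1 h2 h3 h4 E; have h1' := lt_le_trans h1 etd; have h2' := lt_le_trans h2 etd.
  have [kk|kk|//] := ltgtP k k'.
    by have := mono _ _ _ _ h1' h2' h3 h4 kk; rewrite E ltxx.
  by have := mono _ _ _ _ h1' h2' h4 h3 kk; rewrite E ltxx.
have ex p : W p -> exists k, `|k - k0| < dl /\ f (p.1, k) = p.2.
  case: p => [[t x] u] [/= h1 h2 h3].
  have h1' := lt_le_trans h1 etd; have h2' := lt_le_trans h2 etd.
  have kB (k : R) : k0 - dl <= k <= k0 + dl -> `|k - k0| < d.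
    by move=> /andP[a1 a2]; rewrite ltr_norml; apply/andP; split; lra.
  have lA := etA _ _ h1 h2; have lB := etB _ _ h1 h2.
  move: h3; rewrite ltr_norml => /andP[h3 h4].
  have [|||k] := @IVT R (fun s => f (t, x, s)) (k0 - dl) (k0 + dl) u.
  - by lra.
  - apply: derivable_within_continuous => s; rewrite in_itv /= => /kB s1.
    have /is_derive_ex3 [] // := differentiable_is_derive ex3 (smooth_diff fs (NB _ _ _ h1' h2' s1)).
  - rewrite ge_min le_max; apply/andP; split; apply/orP; [left|right].
      by apply/ltW; apply: lt_trans lA _; lra.
    by apply/ltW; apply: lt_trans _ lB; lra.
  rewrite in_itv /= => /andP[k1 k2] E; exists k; split=> //.
  rewrite ltr_norml; apply/andP; split.
    rewrite ltrBrDr addrC lt_neqAle k1 andbT; apply/eqP => kE; move: E lA; rewrite -kE => ->; lra.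
  rewrite ltrBlDr addrC lt_neqAle k2 andbT; apply/eqP => kE; move: E lB; rewrite kE => ->; lra.
pose kap p := get [set k | `|k - k0| < dl /\ f (p.1, k) = p.2].
have kapP p : W p -> `|kap p - k0| < dl /\ f (p.1, kap p) = p.2.
  by move=> /ex; exact: getPex.
have kapN p : W p -> N' (p.1, kap p).
  by move=> Wp; have [h1 h2] := kapP _ Wp; split=> //=; rewrite h2 -surjective_pairing.
have fd q : N q -> differentiable f q by exact: smooth_diff.
(* Continuity by trapping: the inequalities f(., kap p - e2) < u < f(., kap p + e2) persist near p,
   and monotonicity then confines kap to within e2 of kap p. *)
have kc p : W p -> {for p, continuous kap}.
  move=> Wp; suff : kap @ p --> kap p by [].
  apply/cvgrPdist_lt => e1 e10; have [k1 k2] := kapP _ Wp.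
  have WN q : W q -> `|q.1.1 - t0| < d /\ `|q.1.2 - x0| < d.
    by move=> [q1 q2 _]; split; apply: lt_le_trans etd.
  have [p1 p2] := WN _ Wp.
  have [e2 [e20 e21] eB2] : exists2 e2 : R, 0 < e2 /\ e2 <= e1 &
      forall s : R, `|s| <= e2 -> `|kap p + s - k0| < dl.
    exists (Num.min e1 ((dl - `|kap p - k0|) / 2)).
      by rewrite lt_min e10 divr_gt0 ?subr_gt0 // ge_min lexx.
    move=> s; rewrite le_min => /andP[_ sB]; rewrite addrAC.
    by apply: le_lt_trans (ler_normD _ _) _; move: k1 sB; clear; move: `|_| `|_|; clear => a b; lra.
  have e2n : `|e2| <= e2 by rewrite gtr0_norm.
  have e2n' : `|- e2| <= e2 by rewrite normrN.
  have mB := lt_trans (eB2 _ e2n') dld; have pB := lt_trans (eB2 _ e2n) dld.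
  have cf (s : R) : `|kap p + s - k0| < d -> {for p, continuous (fun q : R3 => f (q.1, kap p + s))}.
    move=> sB; apply: (@continuous_comp _ _ _ (fun q : R3 => (q.1, kap p + s)) f).
      by apply: cont_pair; [exact: fst_cont|exact: cst_continuous].
    by case: p p1 p2 sB {Wp k1 k2 eB2 mB pB} => [[t x] u] p1 p2 sB; apply: cont.
  have kl : f (p.1, kap p - e2) < p.2.
    rewrite -k2; case: p p1 p2 mB k1 {Wp k2 eB2 pB cf} => [[t x] u] /= p1 p2 mB k1.
    by apply: mono => //; [exact: lt_trans dld|rewrite gtrBl].
  have kr : p.2 < f (p.1, kap p + e2).
    rewrite -k2; case: p p1 p2 pB k1 {Wp k2 eB2 mB cf kl} => [[t x] u] /= p1 p2 pB k1.
    by apply: mono => //; [exact: lt_trans dld|rewrite ltrDl].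
  have H1 : \forall q \near p, f (q.1, kap p - e2) < q.2.
    have c : {for p, continuous (fun q : R3 => q.2 - f (q.1, kap p - e2))}.
      by apply: continuousB; [exact: snd_cont|exact: cf].
    have c0 : 0 < p.2 - f (p.1, kap p - e2) by rewrite subr_gt0.
    by have := near_gt0 c c0; apply: filterS => q; rewrite subr_gt0.
  have H2 : \forall q \near p, q.2 < f (q.1, kap p + e2).
    have c : {for p, continuous (fun q : R3 => f (q.1, kap p + e2) - q.2)}.
      by apply: continuousB; [exact: cf|exact: snd_cont].
    have c0 : 0 < f (p.1, kap p + e2) - p.2 by rewrite subr_gt0.
    by have := near_gt0 c c0; apply: filterS => q; rewrite subr_gt0.
  apply: filterS3 (open_near oW Wp) H1 H2 => q Wq.
  have [q1 q2] := WN _ Wq; have [] := kapP _ Wq.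
  move: (kap q) => kq; case: q q1 q2 {Wq} => [[t x] u] /= q1 q2 /lt_trans /(_ dld) h1 <- h2 h3.
  rewrite distrC; apply: lt_le_trans e21; rewrite ltr_norml; apply/andP; split.
    rewrite ltrBrDl; rewrite ltNge; apply/negP; rewrite le_eqVlt => /predU1P[E|h].
      by move: h2; rewrite -E ltxx.
    by have := mono _ _ _ _ q1 q2 h1 mB h; rewrite ltNge (ltW h2).
  rewrite ltrBlDl; rewrite ltNge; apply/negP; rewrite le_eqVlt => /predU1P[E|h].
    by move: h3; rewrite -E ltxx.
  by have := mono _ _ _ _ q1 q2 pB h1 h; rewrite ltNge (ltW h3).
have kd p v : W p -> is_derive p v kap
    ((v.2 - 'D_(v.1, 0) f (p.1, kap p)) / 'D_ex3 f (p.1, kap p)).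
  move=> Wp; have [k1 k2] := kapP _ Wp; have Nq := N'N _ (kapN _ Wp).
  set q : R3 := (p.1, kap p) in Nq *.
  pose ph (h : R) : R3 := h *: v + p.
  have phc : {for (0 : R), continuous ph}.
    apply: continuousD; last exact: cst_continuous.
    exact: (@scalel_continuous _ _ v 0).
  have ph0 : ph 0 = p by rewrite /ph scale0r add0r.
  have Wph : \forall h \near (0 : R), W (ph h).
    have : nbhs (ph 0) W by rewrite ph0; apply: open_nbhs_nbhs.
    exact: phc.
  have kh0 : {for (0 : R), continuous (kap \o ph)}.
    by apply: (@continuous_comp _ _ _ ph kap 0 phc); rewrite ph0; apply: kc.
  (* xi h is a mean value point between kap p and kap (ph h), so it tends to kap p; dividing the
     identity by h gives the difference quotient of kap. *)
  have /choice [xi xiP] : forall h, exists c, W (ph h) ->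
      `|c - kap p| <= `|kap (ph h) - kap p| /\
      f ((ph h).1, kap (ph h)) - f ((ph h).1, kap p) =
      'D_ex3 f ((ph h).1, c) * (kap (ph h) - kap p).
    move=> h; have [Wh|nW] := pselect (W (ph h)); last by exists 0.
    have [h1 h2] := kapP _ Wh; have [w1 w2 _] := Wh.
    have [|c c1 c2] := @mean_value R (fun s => f ((ph h).1, s))
        (fun s => 'D_ex3 f ((ph h).1, s)) (kap p) (kap (ph h)).
      move=> c c1; have c2 := between_near (lt_trans k1 dld) (lt_trans h1 dld) c1.
      move: w1 w2 {h1 h2 Wh}; move: (ph h) => [[t x] u] /= w1 w2.
      apply/is_derive_ex3/differentiable_is_derive/fd/NB => //; exact: lt_le_trans etd.
    by exists c => _; split=> //; exact: between_dist.
  have xic : xi @ (0 : R) --> kap p.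
    apply/cvgrPdist_lt => e1 e10.
    have /cvgrPdist_lt /(_ _ e10) := kh0; apply: filterS2 Wph => h Wh /=.
    rewrite ph0 distrC => hh; rewrite distrC; apply: le_lt_trans hh.
    by have [] := xiP _ Wh.
  have D3c : (fun h => 'D_ex3 f ((ph h).1, xi h)) @ (0 : R)^' --> 'D_ex3 f q.
    apply: cvg_within_filter.
    have c : (fun h => ((ph h).1, xi h)) @ (0 : R) --> q.
      have c1 : (fun h => (ph h).1) @ (0 : R) --> p.1.
        by rewrite -ph0; exact: (@continuous_comp _ _ _ ph fst 0 phc (@fst_cont _ _ _)).
      exact: cvg_pair c1 xic.
    exact: (cvg_comp _ _ c (smooth_cont (smooth_derive ex3 fs) Nq)).
  have nz : 'D_ex3 f q != 0 by exact/lt0r_neq0/fpos.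
  have fq := (is_derive_cvg _ _ _ _).2 (differentiable_is_derive (v.1, 0) (fd _ Nq)).
  apply/is_derive_cvg.
  have lim : (fun h : R => (v.2 - h^-1 * (f (h *: (v.1, 0) + q) - f q)) /
       'D_ex3 f ((ph h).1, xi h)) @ (0 : R)^' -->
       (v.2 - 'D_(v.1, 0) f q) / 'D_ex3 f q.
    exact: cvgM (cvgB (cvg_cst v.2) fq) (cvgV nz D3c).
  apply: cvg_trans lim; apply: near_eq_cvg.
  have D3nz : \forall h \near (0 : R)^', 'D_ex3 f ((ph h).1, xi h) != 0.
    exact: (cvgr_neq0 _ D3c nz).
  have Wph' : \forall h \near (0 : R)^', W (ph h) by exact: cvg_within Wph.
  have hn0 : \forall h \near (0 : R)^', h != 0 by exact: nbhs_dnbhs_neq.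
  apply: filterS3 hn0 Wph' D3nz => h h0 Wh D3h /=.
  have [_ E] := xiP _ Wh; have [_ E1] := kapP _ Wh.
  move: E; rewrite E1 => E.
  have -> : h *: (v.1, 0) + q = ((ph h).1, kap p) by congr (_, _); rewrite /= ?scaler0 ?add0r.
  rewrite -/(ph h) k2.
  exact: (@quotient_solve R h v.2 _ p.2 _ _ h0 D3h E).
(* The derivative formula contains kap only inside smooth functions, so regularity is gained one
   order at a time. *)
have ck k : Ck k W kap.
  elim: k => [|k IH]; first exact: kc.
  have cT v : Ck k W (fun p => 'D_v f (p.1, kap p)).
    apply: (Ck_eq oW) (Ck_comp3 oW (smooth_derive v fs) (Ck_fst k oW) (Ck_snd k oW) IH _).
      by move=> [[t x] u].
    by move=> [[t x] u] /kapN /N'N.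
  have cI : Ck k W (fun p => ('D_ex3 f (p.1, kap p))^-1).
    by apply: Ck_inv; [|move=> p /kapN /N'N /fpos; exact: lt0r_neq0|].
  have cM (a : R) v : Ck k W (fun p => (a - 'D_v f (p.1, kap p)) / 'D_ex3 f (p.1, kap p)).
    by apply: Ck_mul => //; apply: Ck_sub => //; exact: Ck_cst.
  (* In direction [ex3] the part (v.1, 0) is zero and v.2 is 1, which explains the entry
     [cM 1 (0, 0, 0)]. *)
  exact: (Ck_partials oW (cM 0 ex1) (cM 0 ex2) (cM 1 (0, 0, 0)) (kd^~ ex1) (kd^~ ex2) (kd^~ ex3)).
exists W, N', kap; split=> //.
- split=> //; split; rewrite /= ?subrr ?normr0 //; exact: lt_le_trans et0 _.
- split=> //; split; last by rewrite /= subrr normr0.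
  by split; rewrite /= ?subrr ?normr0 //; exact: lt_le_trans et0 _.
- by move=> p Wp; split; [exact: kapN|have [] := kapP _ Wp].
move=> q [Wq hq]; split=> //; have [h1 h2] := kapP _ Wq.
have [w1 w2 _] := Wq.
case: q Wq hq h1 h2 w1 w2 => [[t x] k] /= Wq hq h1 h2 w1 w2.
by apply: inj h2 => //; apply: lt_trans dld.
Qed.
End ImplicitFunction.

Section ImplicitFunction2.
Context {R : realType}.
Notation R3 := (R * R * R)%type.

Lemma open_sub_pos (T : topologicalType) (N : set T) (g : T -> R) :
  open N -> (forall q, N q -> {for q, continuous g}) ->
  open [set q | N q /\ 0 < g q].
Proof.
move=> oN cg; rewrite openE => q [Nq gq].
have H1 : \forall q' \near q, N q' by exact: open_nbhs_nbhs.
by apply: filterS2 H1 (near_gt0 (cg _ Nq) gq).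
Qed.

(** N is shrunk to the open set where the derivative keeps the sign it has at q0. For a negative
    sign f is replaced by -f, and the inverse is read through the reflection [sg] of the last
    coordinate. *)
Lemma implicit_inverse (f : R3 -> R) (N : set R3) (q0 : R3) :
  open N -> N q0 -> smooth_on N f -> 'D_ex3 f q0 != 0 ->
  exists (W N' : set R3) (kap : R3 -> R),
    [/\ [/\ open W, W (q0.1, f q0) & smooth_on W kap],
        [/\ open N', N' q0 & N' `<=` N],
        (forall p, W p -> N' (p.1, kap p) /\ f (p.1, kap p) = p.2) &
        (forall q, N' q -> W (q.1, f q) /\ kap (q.1, f q) = q.2)].
Proof.
move=> oN Nq0 fs; rewrite neq_lt => /orP[neg|pos]; last first.
  have [W [N' [kap [H1 [H2 H3 H4] H5 H6]]]] := @implicit_inverse_pos R f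
     [set q | N q /\ 0 < 'D_ex3 f q] q0
     (open_sub_pos oN (fun q Nq => smooth_cont (smooth_derive ex3 fs) Nq)) (conj Nq0 pos)
     (fun k => Ck_subset (@subIsetl _ N _) (fs k)) (fun q => @proj2 _ _).
  by exists W, N', kap; split=> //; split=> // q /H4 [].
pose g q := - f q.
have gs : smooth_on N g by move=> k; apply: Ck_opp.
have Dg q : N q -> 'D_ex3 g q = - 'D_ex3 f q.
  by move=> Nq; apply: deriveN; apply/diff_derivable/smooth_diff.
have pos : 0 < 'D_ex3 g q0 by rewrite Dg // oppr_gt0.
have [W [N' [kap [[H1 H1' H1''] [H2 H3 H4] H5 H6]]]] := @implicit_inverse_pos R g
   [set q | N q /\ 0 < 'D_ex3 g q] q0
   (open_sub_pos oN (fun q Nq => smooth_cont (smooth_derive ex3 gs) Nq)) (conj Nq0 pos)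
   (fun k => Ck_subset (@subIsetl _ N _) (gs k)) (fun q => @proj2 _ _).
pose sg (p : R3) : R3 := (p.1, - p.2).
have csg : continuous sg.
  move=> p; apply: cont_pair; first exact: fst_cont.
  exact: (continuousN (@snd_cont _ _ p)).
have oW : open (sg @^-1` W) by apply: open_comp => // p _; exact: csg.
exists (sg @^-1` W), N', (kap \o sg); split.
- split=> // k.
  apply: (Ck_eq oW) (Ck_comp3 oW H1'' (Ck_fst k oW) (Ck_snd k oW)
     (Ck_opp oW (Ck_thd k oW)) _).
    by move=> [[t x] u].
  by move=> [[t x] u].
- by split=> // q /H4 [].
- move=> p /H5 [h1 h2]; split=> //=.
  by rewrite -[RHS]opprK -[LHS]opprK; congr (- _).
- move=> q /H6 [h1 h2]; split=> //.
Qed.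

End ImplicitFunction2.

(** * Ordinary differential equations and the Frobenius theorem *)

Section Primitive.
Context {R : realType}.
Implicit Types (g : R -> R) (a l r u x : R).

Lemma primitive_segment g a u : (forall x, a <= x <= u -> {for x, continuous g}) ->
  exists F : R -> R, forall x, a < x < u -> is_derive x 1 F (g x).
Proof.
move=> cg.
have [ua|au] := leP u a.
  by exists g => x /andP[h1 h2]; have := lt_trans h1 h2; rewrite ltNge ua.
have ig : (@lebesgue_measure R).-integrable `[a, u] (EFin \o g).
  apply: continuous_compact_integrable; first exact: segment_compact.
  by apply: continuous_in_subspaceT => x; rewrite inE /= in_itv /= => /cg.
exists (fun x => (\int[@lebesgue_measure R]_(t in `[a, x]) (g t))%R) => x /andP[ax xu].
have cx : {for x, continuous g} by apply: cg; rewrite (ltW ax) (ltW xu).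
have [d1 d2] := @continuous_FTC1_closed R g a x u xu ig ax cx.
by split; [exact: d1|exact: etrans (esym (derive1E _ _)) d2].
Qed.

(** g may fail to be integrable up to the ends of the open interval, so primitives on compact pieces
    are glued after being normalised at x0. *)
Lemma primitive_interval g l r x0 : l < x0 < r ->
  (forall x, l < x < r -> {for x, continuous g}) ->
  exists F : R -> R, F x0 = 0 /\ forall x, l < x < r -> is_derive x 1 F (g x).
Proof.
move=> /andP[lx0 x0r] cg.
(* The segment from A x to U x is a compact piece of the interval with x and x0 in its interior. *)
pose A x := (l + Num.min x x0) / 2; pose U x := (r + Num.max x x0) / 2.
have AU x : l < x < r -> [/\ l < A x, A x < x & A x < x0] /\ [/\ x < U x, x0 < U x & U x < r].
  move=> /andP[lx xr]; rewrite /A /U.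
  have h1 : l < Num.min x x0 by rewrite lt_min lx.
  have h2 : Num.min x x0 <= x by rewrite ge_min lexx.
  have h3 : Num.min x x0 <= x0 by rewrite ge_min lexx orbT.
  have h4 : Num.max x x0 < r by rewrite gt_max xr.
  have h5 : x <= Num.max x x0 by rewrite le_max lexx.
  have h6 : x0 <= Num.max x x0 by rewrite le_max lexx orbT.
  move: (Num.min _ _) (Num.max _ _) h1 h2 h3 h4 h5 h6 => m M.
  by clear -x x0; move=> *; split; split; lra.
have /choice [F FP] : forall x, exists F : R -> R, l < x < r ->
    forall y, A x < y < U x -> is_derive y 1 F (g y).
  move=> x; have [xlr|nx] := boolP (l < x < r); last by exists g.
  have [[a1 a2 a3] [a4 a5 a6]] := AU _ xlr.
  have [|F HF] := @primitive_segment g (A x) (U x); last by exists F.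
  by move=> y /andP[y1 y2]; apply: cg; rewrite (lt_le_trans a1 y1) (le_lt_trans y2 a6).
exists (fun x => F x x - F x x0); split; first by rewrite subrr.
move=> x xlr; have [[a1 a2 a3] [a4 a5 a6]] := AU _ xlr.
have dF : is_derive x 1 (fun y => F x y - F x x0) (g x).
  have -> : (fun y => F x y - F x x0) = F x \- cst (F x x0) by [].
  rewrite -[g x]subr0; apply: is_deriveB; first by apply: FP => //; rewrite a2.
apply: near_eq_is_derive dF.
have : \forall y \near x, A x < y < U x.
  by apply: near_in_itvoo; rewrite in_itv /= a2.
apply: filterS => y /andP[y1 y2].
have ylr : l < y < r by rewrite (lt_trans a1 y1) (lt_trans y2 a6).
have [[b1 b2 b3] [b4 b5 b6]] := AU _ ylr.
(* The primitives chosen for x and for y differ by a constant on the common part of their pieces,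
   which contains x0 and y; the normalisation at x0 removes this constant. *)
have : F x x0 - F y x0 = F x y - F y y; last first.
  by move=> E; apply/eqP; rewrite -subr_eq0 subB_swap -E subrr.
apply: (@derive0_eq R (fun z => F x z - F y z)) => z /andP[z1 z2].
have z3 : Num.max (A x) (A y) < z.
  by apply: lt_le_trans z1; rewrite lt_min !gt_max a3 b3 y1.
have z4 : z < Num.min (U x) (U y).
  by apply: le_lt_trans z2 _; rewrite gt_max !lt_min a5 b5 y2.
move: z3 z4; rewrite gt_max lt_min => /andP[z3 z3'] /andP[z4 z4'].
rewrite -(subrr (g z)); apply: is_deriveB.
  by apply: FP => //; rewrite z3.
by apply: FP => //; rewrite z3'.
Qed.

Lemma derive_bound (F F' : R -> R) (a b M : R) :
  (forall s, Num.min a b <= s <= Num.max a b -> is_derive s 1 F (F' s) /\ `|F' s| <= M) ->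
  `|F b - F a| <= M * `|b - a|.
Proof.
move=> H; have [|c c1 ->] := @mean_value R F F' a b; first by move=> s /H [].
by rewrite normrM ler_wpM2r //; have [] := H _ c1.
Qed.

(* If the rate of change of r is at most K |r| + c and K times the length of the
   interval is at most 1/2, then the maximum of |r| controls itself. *)
Lemma small_gronwall (r r' : R -> R) (x0 x K c d : R) : `|x - x0| <= d ->
  0 <= K -> 0 <= c -> K * d <= 1 / 2 ->
  (forall s, Num.min x0 x <= s <= Num.max x0 x ->
     is_derive s 1 r (r' s) /\ `|r' s| <= K * `|r s| + c) ->
  `|r x| <= 2 * (`|r x0| + d * c).
Proof.
move=> xd K0 c0 Kd H.
set a := Num.min x0 x; set b := Num.max x0 x.
have ab : a <= b by rewrite /a /b; case: (leP x0 x) => // /ltW.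
have [|m] := @EVT_max R (fun s => `|r s|) a b ab.
  apply: continuous_in_subspaceT => s; rewrite inE /= in_itv /= => /H [[ds _] _].
  have cs : {for s, continuous r} by apply/differentiable_continuous/derivable1_diffP.
  exact: (@continuous_comp _ _ _ r Num.norm s cs (@norm_continuous _ _ _)).
rewrite in_itv /= => mab Hm.
have xin : x \in `[a, b] by rewrite in_itv /= /a /b ge_min le_max lexx orbT /= orbT.
apply: le_trans (Hm _ xin) _.
have sub s : Num.min x0 m <= s <= Num.max x0 m -> a <= s <= b.
  move: mab => /andP[m1 m2] /andP[s1 s2]; apply/andP; split.
    by apply: le_trans s1; rewrite le_min m1 /a ge_min lexx.
  by apply: le_trans s2 _; rewrite ge_max m2 /b le_max lexx.
have md : `|m - x0| <= d.
  apply: le_trans xd; move: mab; rewrite /a /b.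
  case: (leP x0 x) => [h|/ltW h] /andP[m1 m2].
    by rewrite !ger0_norm ?subr_ge0 // lerB.
  by rewrite !(distrC _ x0) !ger0_norm ?subr_ge0 // lerB.
have B := @derive_bound r r' x0 m (K * `|r m| + c).
have {}B : `|r m - r x0| <= (K * `|r m| + c) * `|m - x0|.
  apply: B => s /sub s1; have [h1 h2] := H _ s1; split=> //.
  by apply: le_trans h2 _; rewrite lerD2r ler_wpM2l // Hm // in_itv.
have B2 : `|r m| <= `|r x0| + `|r m - r x0|.
  by have := ler_normD (r x0) (r m - r x0); rewrite addrC subrK.
have B3 : (K * `|r m| + c) * `|m - x0| <= (K * `|r m| + c) * d.
  by rewrite ler_wpM2l // addr_ge0 // mulr_ge0.
have B4 : K * d * `|r m| <= 1 / 2 * `|r m| by rewrite ler_wpM2r.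
move: B B2 B3 B4; move: (`|r m|) (`|r x0|) (`|r m - r x0|) ((K * _ + c) * `|_|) => y0 y1 y2 y3.
by clear; move=> B B2 B3 B4; nra.
Qed.

End Primitive.

(** * Primitives in x depending on parameters *)

Section Tube.
Context {R : realType}.
Notation R3 := (R * R * R)%type.

(** Compactness of the segment makes continuity at its points uniform along it. This is the
    uniformity needed to compare primitives on neighbouring lines. *)
Lemma tube (g : R3 -> R) (t k a b e : R) : 0 < e ->
  (forall s, a <= s <= b -> {for (t, s, k), continuous g}) ->
  exists2 d : R, 0 < d & forall t' k' s, `|t' - t| < d -> `|k' - k| < d ->
    a <= s <= b -> `|g (t', s, k') - g (t, s, k)| < e.
Proof.
move=> e0 cg.
have /compact_near_coveringP nc := @segment_compact R a b.
have : \forall i \near (t, k), `[a, b]%classic `<=`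
   (fun s : R => `|g (i.1, s, i.2) - g (t, s, k)| < e).
  apply: (nc _ (nbhs (t, k)) (fun i s => `|g (i.1, s, i.2) - g (t, s, k)| < e) _) => s.
  rewrite /= in_itv /= => /cg cs.
  have e20 : 0 < e / 2 by rewrite divr_gt0.
  have cphi : {for (s, (t, k)), continuous (fun z : R * (R * R) => (z.2.1, z.1, z.2.2))}.
    apply: cont_pair; first apply: cont_pair.
    - apply: (@continuous_comp _ _ _ snd fst); [exact: snd_cont|exact: fst_cont].
    - exact: fst_cont.
    - apply: (@continuous_comp _ _ _ snd snd); [exact: snd_cont|exact: snd_cont].
  have cpsi : {for (s, (t, k)), continuous (fun z : R * (R * R) => (t, z.1, k))}.
    apply: cont_pair; last exact: cst_continuous.
    by apply: cont_pair; [exact: cst_continuous|exact: fst_cont].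
  have /cvgrPdist_lt /(_ _ e20) h := cs.
  have H1 : \forall z \near (s, (t, k)), `|g (t, s, k) - g (z.2.1, z.1, z.2.2)| < e / 2.
    exact: (cphi _ h).
  have H2 : \forall z \near (s, (t, k)), `|g (t, s, k) - g (t, z.1, k)| < e / 2.
    exact: (cpsi _ h).
  suff : \forall z \near (s, (t, k)), `|g (z.2.1, z.1, z.2.2) - g (t, z.1, k)| < e by [].
  apply: filterS2 H1 H2 => z /= h1 h2; rewrite -(subrKA (g (t, s, k))).
  apply: le_lt_trans (ler_normD _ _) _; rewrite (splitr e) ltrD //.
  by rewrite distrC.
move=> /nbhs_normP [d /= d0 Hd]; exists d => // t' k' s ht hk hs.
apply: (Hd (t', k')); last by rewrite /= in_itv.
rewrite /ball_ /=; have -> : `|(t, k) - (t', k')| = Num.max `|t - t'| `|k - k'| by [].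
by rewrite gt_max distrC ht distrC.
Qed.

End Tube.

Section ParametricPrimitive.
Context {R : realType}.
Notation R3 := (R * R * R)%type.

Lemma is_derive_eps (V : normedModType R) (f : V -> R) p v l :
  (forall e : R, 0 < e -> exists2 d : R, 0 < d & forall h, `|h| < d ->
     `|f (p + h *: v) - f p - h * l| <= e * `|h|) -> is_derive p v f l.
Proof.
move=> H; apply/is_derive_cvg/cvgrPdist_le => e e0.
have [d d0 Hd] := H e e0.
have h0 : \forall h \near (0 : R)^', h != 0 by exact: nbhs_dnbhs_neq.
have hd : \forall h \near (0 : R)^', `|h| < d.
  apply: cvg_within; apply/nbhs_normP; exists d => // h.
  by rewrite /ball_ /= sub0r normrN.
apply: filterS2 h0 hd => h h0 /Hd; rewrite [p + _]addrC => Hh.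
have hp : 0 < `|h| by rewrite normr_gt0.
rewrite -(ler_pM2r hp) distrC -normrM mulrBl.
by rewrite /GRing.scale /= mulrAC mulVf // mul1r [l * h]mulrC.
Qed.

Variables (q0 : R3) (d : R).
Hypothesis d0 : 0 < d.
Let B := box3 q0 d.
Let x0 := q0.1.2.
Let oB : open B := @box3_open R q0 d.

(** The set from which P is chosen does not mention the x-coordinate of q, so all points of a line
    parallel to the x-axis share one P. Without this the choice would not be differentiable along
    x. *)
Definition param_prim (h : R3 -> R) (q : R3) : R :=
  get [set P : R -> R | P x0 = 0 /\
    forall x, x0 - d < x < x0 + d -> is_derive x 1 P (h (q.1.1, x, q.2))] q.1.2.

Lemma box_itv (x : R) : (`|x - x0| < d) = (x0 - d < x < x0 + d).
Proof. by rewrite ltr_distl. Qed.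

Lemma box_between q s : B q -> Num.min x0 q.1.2 <= s <= Num.max x0 q.1.2 ->
  B (q.1.1, s, q.2).
Proof.
move=> [h1 h2 h3] hs; split=> //=.
by apply: between_near hs => //; rewrite subrr normr0.
Qed.

Lemma param_primP h q : Ck 0 B h -> B q ->
  param_prim h (q.1.1, x0, q.2) = 0 /\
  forall x, `|x - x0| < d -> is_derive x 1 (fun s => param_prim h (q.1.1, s, q.2)) (h (q.1.1, x, q.2)).
Proof.
move=> ch [b1 b2 b3].
have : exists P : R -> R, P x0 = 0 /\
    forall x, x0 - d < x < x0 + d -> is_derive x 1 P (h (q.1.1, x, q.2)).
  apply: primitive_interval; first by rewrite gtrBl ltrDl d0.
  move=> x; rewrite -box_itv => hx.
  have c : {for (q.1.1, x, q.2), continuous h} by apply: ch; split.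
  apply: (@continuous_comp _ _ _ (fun x => (q.1.1, x, q.2)) h) => //.
  apply: cont_pair; last exact: cst_continuous.
  by apply: cont_pair; [exact: cst_continuous|].
move=> /getPex [P1 P2]; split; first exact: P1.
by move=> x; rewrite box_itv => /P2.
Qed.

Lemma param_prim0 h q : Ck 0 B h -> B q -> q.1.2 = x0 -> param_prim h q = 0.
Proof.
by move=> ch Bq E; have [+ _] := param_primP ch Bq; rewrite -E; case: q {Bq E} => [[]].
Qed.

Lemma param_prim_derive h q : Ck 0 B h -> B q -> is_derive q ex2 (param_prim h) (h q).
Proof.
move=> ch Bq; have [_ /(_ q.1.2)] := param_primP ch Bq; have [b1 b2 b3] := Bq.
move=> /(_ b2) H; case: q H {Bq b1 b2 b3} => [[t x] k] /= H.
exact/is_derive_ex2.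
Qed.

(** The way from q to q' passes through [qm], with the x of q and the parameters of q'. Changing x
    costs at most a bound M of h times the displacement; changing the parameters is controlled by
    [tube]. *)
Lemma Ck0_param_prim h : Ck 0 B h -> Ck 0 B (param_prim h).
Proof.
move=> ch q Bq; have [b1 b2 b3] := Bq.
suff : param_prim h @ q --> param_prim h q by [].
apply/cvgrPdist_lt => e e0.
set M := `|h q| + 1; have M0 : 0 < M by rewrite ltr_wpDl.
have [d1 d10 Hd1] : exists2 d1 : R, 0 < d1 &
    box3 q d1 `<=` [set q' | B q' /\ `|h q'| <= M].
  apply: near_box3; have /cvgrPdist_lt /(_ _ ltr01) := ch q Bq.
  apply: filterS2 (open_near oB Bq) => q' Bq' h1; split=> //.
  by rewrite -[h q'](subrK (h q)) /M addrC (le_trans (ler_normD _ _)) // lerD2l distrC ltW.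
have ed : 0 < e / (2 * d) by rewrite divr_gt0 // mulr_gt0.
have [|d2 d20 Hd2] := @tube R h q.1.1 q.2 (Num.min x0 q.1.2) (Num.max x0 q.1.2) _ ed.
  by move=> s /(box_between Bq); apply: ch.
have e2M : 0 < e / (2 * M) by rewrite divr_gt0 // mulr_gt0.
have := @box3_near R q (Num.min d1 (Num.min d2 (e / (2 * M)))).
rewrite !lt_min d10 d20 e2M => /(_ isT).
apply: filterS => q' [].
rewrite !lt_min => /and3P[u1 u2 _] /and3P[v1 _ v3] /and3P[w1 w2 _].
have Bq' : B q' by have [] := Hd1 q'.
have [b1' b2' b3'] := Bq'.
pose qm : R3 := (q'.1.1, q.1.2, q'.2).
have Bm : B qm by split.
have S1 : `|param_prim h q' - param_prim h qm| < e / 2.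
  have E : q' = (q'.1.1, q'.1.2, q'.2) by case: (q') => [[]].
  rewrite {1}E /qm.
  apply: le_lt_trans (@derive_bound R (fun s => param_prim h (q'.1.1, s, q'.2))
    (fun s => h (q'.1.1, s, q'.2)) q.1.2 q'.1.2 M _) _.
    move=> s hs; have [Bs hM] : B (q'.1.1, s, q'.2) /\ `|h (q'.1.1, s, q'.2)| <= M.
      apply: Hd1; split=> //=.
      by apply: between_near hs => //; rewrite subrr normr0.
    split=> //; have [_ b4 _] := Bs.
    by have [_ /(_ s b4)] := param_primP ch Bq'.
  have -> : e / 2 = M * (e / (2 * M)) by field; rewrite gt_eqF.
  by rewrite ltr_pM2l.
have S2 : `|param_prim h qm - param_prim h q| <= e / 2.
  have P0 : param_prim h (q'.1.1, x0, q'.2) = 0 by have [] := param_primP ch Bq'.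
  have P0' : param_prim h (q.1.1, x0, q.2) = 0 by have [] := param_primP ch Bq.
  have := @derive_bound R (fun s => param_prim h (q'.1.1, s, q'.2) - param_prim h (q.1.1, s, q.2))
    (fun s => h (q'.1.1, s, q'.2) - h (q.1.1, s, q.2)) x0 q.1.2 (e / (2 * d)).
  rewrite P0 P0' subrr subr0 => H.
  have E : q = (q.1.1, q.1.2, q.2) by case: (q) => [[]].
  rewrite {1}E /qm; apply: le_trans (H _) _.
    move=> s hs; split; last by apply/ltW/Hd2.
    have [_ c1 _] := box_between Bq hs.
    by apply: is_deriveB; [have [_ +] := param_primP ch Bq'|have [_ +] := param_primP ch Bq]; apply.
  have -> : e / 2 = e / (2 * d) * d by field; rewrite gt_eqF.
  by rewrite ler_wpM2l // ltW.
rewrite distrC -(subrKA (param_prim h qm)) (splitr e).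
by apply: le_lt_trans (ler_normD _ _) _; rewrite ltr_leD.
Qed.

(** Differentiation under the integral sign, in directions that fix x. The error of the linear
    approximation vanishes at x0, and its x-derivative is at most e / d times |h1| by the mean value
    theorem and [tube]; the length of integration is below d. *)
Lemma param_prim_dir h (a b : R) q : Ck 1 B h -> B q ->
  is_derive q (a, 0, b) (param_prim h) (param_prim (fun p => 'D_(a, 0, b) h p) q).
Proof.
move=> C1 Bq; have [dh ch'] := C1; have ch := CkW C1; 
pose h' p := 'D_(a, 0, b) h p; have {}ch' : Ck 0 B h' := ch' (a, 0, b).
rewrite -/h'.
have [b1 b2 b3] := Bq.
apply: is_derive_eps => e e0.
have ed : 0 < e / d by rewrite divr_gt0.
have [|d2 d20 Hd2] := @tube R h' q.1.1 q.2 (Num.min x0 q.1.2) (Num.max x0 q.1.2) _ ed.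
  by move=> s /(box_between Bq); apply: ch'.
have [d1 d10 Hd1] := near_box3 (open_near oB Bq).
(* The summand 1 keeps c positive when a = b = 0; dividing the radii by c keeps h1 a and h1 b inside
   them. *)
set c := `|a| + `|b| + 1; have c0 : 0 < c by rewrite ltr_wpDl // addr_ge0.
have ac (h1 : R) : `|h1| < Num.min d1 d2 / c -> forall s, 0 <= s <= 1 ->
    [/\ `|s * (h1 * a)| < d1, `|s * (h1 * b)| < d1, `|s * (h1 * a)| < d2 & `|s * (h1 * b)| < d2].
  rewrite ltr_pdivlMr // => H s /andP[s0 s1].
  have K z : `|z| <= c -> `|s * (h1 * z)| < Num.min d1 d2.
    move=> zc; apply: le_lt_trans H; rewrite !normrM (ger0_norm s0).
    apply: (@le_trans _ _ (1 * (`|h1| * `|z|))); first by rewrite ler_wpM2r // mulr_ge0.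
    by rewrite mul1r ler_wpM2l.
  have := K a; have := K b; rewrite !lt_min /c => Kb Ka.
  have /Ka /andP[-> ->] : `|a| <= `|a| + `|b| + 1 by rewrite -addrA lerDl addr_ge0.
  have /Kb /andP[-> ->] // : `|b| <= `|a| + `|b| + 1.
  by rewrite [`|a| + _]addrC -addrA lerDl addr_ge0.
exists (Num.min d1 d2 / c); first by rewrite divr_gt0 // lt_min d10.
move=> h1 h1d.
have Bl s th : Num.min x0 q.1.2 <= s <= Num.max x0 q.1.2 -> 0 <= th <= 1 ->
    B (q.1.1 + th * (h1 * a), s, q.2 + th * (h1 * b)).
  move=> hs hth; have [k1 k2 _ _] := ac _ h1d th hth.
  have : B (q.1.1 + th * (h1 * a), q.1.2, q.2 + th * (h1 * b)).
    by apply: Hd1; split; rewrite /= ?subrr ?normr0 // addrAC subrr add0r.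
  by move=> /box_between; apply.
have i1 : 0 <= (1 : R) <= 1 by rewrite ler01 lexx.
have x0in : Num.min x0 q.1.2 <= x0 <= Num.max x0 q.1.2.
  by rewrite ge_min le_max lexx.
pose q1 : R3 := (q.1.1 + h1 * a, q.1.2, q.2 + h1 * b).
have Bq1 : B q1.
  have := Bl q.1.2 1; rewrite !mul1r; apply=> //.
  by rewrite ge_min le_max lexx !orbT.
have P0 : param_prim h (q1.1.1, x0, q1.2) = 0 by have [] := param_primP ch Bq1.
have P1 : param_prim h (q.1.1, x0, q.2) = 0 by have [] := param_primP ch Bq.
have P2 : param_prim h' (q.1.1, x0, q.2) = 0 by have [] := param_primP ch' Bq.
have E : q = (q.1.1, q.1.2, q.2) by case: (q) => [[]].
have E1 : q + h1 *: (a, 0, b) = (q1.1.1, q.1.2, q1.2).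
  by rewrite scaleR3 {1}E addR3 mulr0 addr0.
have Ph g : param_prim g q = param_prim g (q.1.1, q.1.2, q.2) by rewrite -E.
rewrite E1 (Ph h) (Ph h').
have := @derive_bound R (fun s => param_prim h (q1.1.1, s, q1.2) -
   param_prim h (q.1.1, s, q.2) - h1 * param_prim h' (q.1.1, s, q.2))
   (fun s => h (q1.1.1, s, q1.2) - h (q.1.1, s, q.2) - h1 * h' (q.1.1, s, q.2))
   x0 q.1.2 (e / d * `|h1|).
rewrite P0 P1 P2 mulr0 !subr0 => H; apply: le_trans (H _) _; last first.
  have -> : e * `|h1| = e / d * `|h1| * d by field; rewrite gt_eqF.
  by apply: ler_wpM2l; [rewrite mulr_ge0 // ltW|exact: ltW b2].
move=> s hs; have [_ c1 _] := box_between Bq hs; split.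
  apply: is_deriveB; first apply: is_deriveB.
  - by have [_ +] := param_primP ch Bq1; apply.
  - by have [_ +] := param_primP ch Bq; apply.
  - by apply: is_deriveZ; have [_ +] := param_primP ch' Bq; apply.
have Es th : (q.1.1, s, q.2) + th *: (h1 *: ((a, 0, b) : R3)) =
    (q.1.1 + th * (h1 * a), s, q.2 + th * (h1 * b)).
  by rewrite scalerA scaleR3 addR3 mulr0 addr0 !mulrA.
have [th hth|th hth] := @mean_value_line R _ h (q.1.1, s, q.2) (h1 *: (a, 0, b)).
  by apply: diff_derivable; apply: dh; rewrite Es; apply: Bl.
have -> : (q.1.1, s, q.2) + h1 *: ((a, 0, b) : R3) = (q1.1.1, s, q1.2).
  by have := Es 1; rewrite scale1r !mul1r.
move=> ->; rewrite derive_scaled; last by apply: dh; rewrite Es; apply: Bl.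
rewrite -[_ *: _]/(h1 * h' _) -mulrBr normrM mulrC ler_wpM2r // ltW // Es.
have [_ _ k3 k4] := ac _ h1d th hth.
by apply: Hd2 => //; rewrite addrAC subrr add0r.
Qed.

(** The partial derivatives along t and the parameter are again primitives, covered by the induction
    hypothesis; the one along x is h. *)
Lemma Ck_param_prim k h : Ck k B h -> Ck k B (param_prim h).
Proof.
elim: k h => [|k IH] h; first exact: Ck0_param_prim.
move=> Ch; have ch := Ck0 Ch; have C1 : Ck 1 B h.
  by split; [have [] := Ch|move=> v; have [_ /(_ v) /Ck0] := Ch].
have [_ Dh] := Ch.
apply: (@Ck_partials R k B _ (param_prim (fun p => 'D_ex1 h p)) h
   (param_prim (fun p => 'D_ex3 h p)) oB).
- exact/IH/Dh.
- exact: CkW.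
- exact/IH/Dh.
- by move=> p; apply: param_prim_dir.
- by move=> p; apply: param_prim_derive.
- by move=> p; apply: param_prim_dir.
Qed.

End ParametricPrimitive.

(** * Existence of the flow of u_x = zeta *)

Section Flow.
Context {R : realType}.
Notation R3 := (R * R * R)%type.

(** The intervals of radius 2 c / 2^n around u n are nested, and the supremum of their left ends
    lies in all of them. *)
Lemma geometric_limit (u : nat -> R) (c : R) :
  (forall n, `|u n.+1 - u n| <= c / 2 ^+ n) ->
  exists l, forall n, `|u n - l| <= 2 * c / 2 ^+ n.
Proof.
move=> H; pose v n := u n - 2 * c / 2 ^+ n; pose w n := u n + 2 * c / 2 ^+ n.
have E n : 2 * c / 2 ^+ n = 2 * (2 * c / 2 ^+ n.+1).
  by rewrite exprS; field; rewrite expf_neq0.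
have E' n : c / 2 ^+ n = 2 * c / 2 ^+ n.+1.
  by rewrite exprS; field; rewrite expf_neq0.
have vS n : v n <= v n.+1.
  have := H n; rewrite ler_norml /v (E n) (E' n) => /andP[h1 h2].
  by move: h1 h2; move: (u n) (u n.+1) (2 * c / 2 ^+ n.+1) => a b e; clear => h1 h2; lra.
have wS n : w n.+1 <= w n.
  have := H n; rewrite ler_norml /w (E n) (E' n) => /andP[h1 h2].
  by move: h1 h2; move: (u n) (u n.+1) (2 * c / 2 ^+ n.+1) => a b e; clear => h1 h2; lra.
have c0 : 0 <= c by have := le_trans (normr_ge0 _) (H 0%N); rewrite expr0 divr1.
have vw n : v n <= w n by rewrite lerD2l ge0_cp // divr_ge0 ?mulr_ge0 // exprn_ge0.
have vmono m n : (m <= n)%N -> v m <= v n by move=> mn; exact: (homo_leq (@lexx _ R) (@le_trans _ R) vS).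
have wmono m n : (m <= n)%N -> w n <= w m by move=> mn; exact: (homo_leq (@lexx _ R) (fun y x z h1 h2 => @le_trans _ R y z x h2 h1) wS).
have vwmn m n : v m <= w n.
  apply: le_trans (vmono _ _ (leq_maxl m n)) _.
  by apply: le_trans (vw _) _; apply: wmono; exact: leq_maxr.
have ub n : ubound (range v) (w n) by move=> _ [m _ <-].
exists (sup (range v)) => n.
have h1 : v n <= sup (range v) by apply: ub_le_sup; [exists (w 0%N)|exists n].
have h2 : sup (range v) <= w n by apply: ge_sup; [exists (v 0%N), 0%N|].
move: h1 h2; rewrite /v /w ler_norml.
by move: (u n) (2 * c / 2 ^+ n) (sup _) => a b e; clear => h1 h2; apply/andP; split; lra.
Qed.

Lemma near_convex (a b k d s : R) : 0 <= s <= 1 -> `|a - k| < d -> `|b - k| < d ->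
  `|a + s * (b - a) - k| < d.
Proof.
move=> /andP[s0 s1] ha hb; have -> : a + s * (b - a) - k = (1 - s) * (a - k) + s * (b - k) by ring.
apply: le_lt_trans (ler_normD _ _) _; rewrite !normrM (ger0_norm s0) ger0_norm ?subr_ge0 //.
move: ha hb s0 s1; move: `|a - k| `|b - k|; clear => x y hx hy s0 s1.
apply: (@le_lt_trans _ _ (Num.max x y)); last by rewrite gt_max hx.
have h1 : x <= Num.max x y by rewrite le_max lexx.
have h2 : y <= Num.max x y by rewrite le_max lexx orbT.
have -> : Num.max x y = (1 - s) * Num.max x y + s * Num.max x y by ring.
by rewrite lerD // ler_wpM2l // subr_ge0.
Qed.

Section Taylor.
Variables (W : set R3) (p0 : R3) (rho : R).
Hypothesis BW : box3 p0 rho `<=` W.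

(** The box is convex, so the mean value theorem applies on the segment. The two points share their
    x, hence only derivatives in the first and third variable appear. *)
Lemma seg_step (g : R3 -> R) t x u t' u' : smooth_on W g ->
  box3 p0 rho (t, x, u) -> box3 p0 rho (t', x, u') ->
  exists s : R, [/\ 0 <= s <= 1, box3 p0 rho (t + s * (t' - t), x, u + s * (u' - u)) &
   g (t', x, u') - g (t, x, u) =
   (t' - t) * 'D_ex1 g (t + s * (t' - t), x, u + s * (u' - u)) +
   (u' - u) * 'D_ex3 g (t + s * (t' - t), x, u + s * (u' - u))].
Proof.
move=> gs [/= a1 a2 a3] [/= b1 b2 b3].
have Bs s : 0 <= s <= 1 -> box3 p0 rho (t + s * (t' - t), x, u + s * (u' - u)).
  by move=> s1; split=> //=; apply: near_convex.
have Es (s : R) : ((t, x, u) : R3) + s *: (t' - t, 0, u' - u) =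
    (t + s * (t' - t), x, u + s * (u' - u)).
  by rewrite scaleR3 addR3 mulr0 addr0.
have dg s : 0 <= s <= 1 -> differentiable g ((t, x, u) + s *: (t' - t, 0, u' - u)).
  by move=> s1; rewrite Es; apply: (smooth_diff gs); exact/BW/Bs.
have [s s1|s s1] := @mean_value_line R _ g (t, x, u) (t' - t, 0, u' - u).
  exact/diff_derivable/dg.
rewrite addR3 addr0 !subrKC => ->; exists s; split=> //; first exact: Bs.
have E : ((t' - t, 0, u' - u) : R3) = (t' - t) *: ex1 + (u' - u) *: ex3.
  by rewrite !scale_ex addR3 !addr0 add0r.
have := dg s s1; rewrite Es => dgs.
by rewrite E derive_addv ?derive_scaled.
Qed.

Lemma box_lipschitz (g : R3 -> R) (K : R) t x u t' u' : smooth_on W g ->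
  (forall q, box3 p0 rho q -> `|'D_ex1 g q| <= K /\ `|'D_ex3 g q| <= K) ->
  box3 p0 rho (t, x, u) -> box3 p0 rho (t', x, u') ->
  `|g (t', x, u') - g (t, x, u)| <= K * (`|t' - t| + `|u' - u|).
Proof.
move=> gs HK b b'; have [s [_ Bs ->]] := seg_step gs b b'.
have [h1 h2] := HK _ Bs.
apply: le_trans (ler_normD _ _) _; rewrite [leRHS]mulrDr !normrM.
by apply: lerD; rewrite mulrC; apply: ler_wpM2r.
Qed.

Lemma box_taylor (g : R3 -> R) (K : R) t x u t' u' : smooth_on W g ->
  (forall q, box3 p0 rho q -> `|'D_ex1 (fun p => 'D_ex1 g p) q| <= K /\
     `|'D_ex3 (fun p => 'D_ex1 g p) q| <= K) ->
  (forall q, box3 p0 rho q -> `|'D_ex1 (fun p => 'D_ex3 g p) q| <= K /\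
     `|'D_ex3 (fun p => 'D_ex3 g p) q| <= K) ->
  box3 p0 rho (t, x, u) -> box3 p0 rho (t', x, u') ->
  `|g (t', x, u') - g (t, x, u) -
    ((t' - t) * 'D_ex1 g (t, x, u) + (u' - u) * 'D_ex3 g (t, x, u))| <=
  K * (`|t' - t| + `|u' - u|) ^+ 2.
Proof.
move=> gs H1 H3 b b'; have [s [/andP[s0 s1] Bs ->]] := seg_step gs b b'.
have L1 := box_lipschitz (smooth_derive ex1 gs) H1 b Bs.
have L3 := box_lipschitz (smooth_derive ex3 gs) H3 b Bs.
have K0 : 0 <= K by have [h _] := H1 _ b; exact: le_trans (normr_ge0 _) h.
set A := `|t' - t| + `|u' - u|; have A0 : 0 <= A by rewrite addr_ge0.
have bd : K * (`|t + s * (t' - t) - t| + `|u + s * (u' - u) - u|) <= K * A.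
  rewrite ler_wpM2l // (addrC t) (addrC u) !addrK !normrM (ger0_norm s0) -mulrDr.
  by rewrite -[leRHS]mul1r ler_wpM2r.
have {}L1 := le_trans L1 bd; have {}L3 := le_trans L3 bd.
have -> : (t' - t) * 'D_ex1 g (t + s * (t' - t), x, u + s * (u' - u)) +
   (u' - u) * 'D_ex3 g (t + s * (t' - t), x, u + s * (u' - u)) -
   ((t' - t) * 'D_ex1 g (t, x, u) + (u' - u) * 'D_ex3 g (t, x, u)) =
   (t' - t) * ('D_ex1 g (t + s * (t' - t), x, u + s * (u' - u)) - 'D_ex1 g (t, x, u)) +
   (u' - u) * ('D_ex3 g (t + s * (t' - t), x, u + s * (u' - u)) - 'D_ex3 g (t, x, u)).
  by rewrite !mulrBr opprD addrACA.
have -> : K * A ^+ 2 = `|t' - t| * (K * A) + `|u' - u| * (K * A).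
  by rewrite -mulrDl -/A expr2 mulrCA.
by apply: le_trans (ler_normD _ _) _; rewrite !normrM; apply: lerD; apply: ler_wpM2l.
Qed.

End Taylor.

Lemma local_bound (W : set R3) (g : R3 -> R) p0 : smooth_on W g -> W p0 ->
  exists2 c, 0 <= c & \forall q \near p0, `|g q| <= c.
Proof.
move=> gs Wp; have /cvgrPdist_lt /(_ _ ltr01) := smooth_cont gs Wp.
move=> H; exists (`|g p0| + 1); first by rewrite addr_ge0.
apply: filterS H => q h1.
by rewrite -[g q](subrK (g p0)) addrC (le_trans (ler_normD _ _)) // lerD2l distrC ltW.
Qed.

End Flow.

Lemma small_constants (R : realFieldType) (K d m rho : R) : 0 < K ->
  d * (1 + K) = m / 2 -> 0 < d -> m <= 1 -> m <= rho -> 0 < m ->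
  [/\ 0 < d, 0 < K, K * d <= 1 / 2 & d + K * d < rho].
Proof. by move=> K0 dE d0 h1 h2 m0; split=> //; nra. Qed.

Section FlowExistence.
Context {R : realType}.
Notation R3 := (R * R * R)%type.

Lemma smooth_expR : smooth_on setT (@expR R).
Proof.
move=> k; elim: k => [|k IH]; first by move=> p _; exact: continuous_expR.
have dE (p : R) : differentiable (@expR R) p by apply/derivable1_diffP; exact: derivable_expR.
split=> [p _|v]; first exact: dE.
apply: (Ck_eq openT) (Ck_scale v openT IH) => p _.
have -> : 'D_v (@expR R) p = 'D_(v *: 1) (@expR R) p by rewrite [_ *: 1]mulr1.
rewrite derive_scaled //; congr (_ * _); apply/esym.
exact: (@derive_val _ _ _ _ _ _ _ (is_derive_expR p)).
Qed.

Lemma Ck_expR (V : normedModType R) k (U : set V) (h : V -> R) :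
  open U -> Ck k U h -> Ck k U (fun p => expR (h p)).
Proof.
move=> oU ch; apply: (@Ck_comp _ _ R setT (@expR R) k U 1 (fun=> h) (fun=> 1)) => //.
  exact: smooth_expR.
by move=> p _; rewrite big_ord1 [_ *: 1]mulr1.
Qed.

Variables (W : set R3) (zeta : R3 -> R) (p0 : R3).
Hypotheses (oW : open W) (Wp0 : W p0) (zs : smooth_on W zeta).

Definition along (g f : R3 -> R) : R3 -> R := fun q => g (q.1.1, q.1.2, f q).

(** K d <= 1/2 is what both the Picard contraction and [small_gronwall] ask for; d + K d < rho keeps
    the graphs of the iterates over the box of radius d inside the box of radius rho. The bounds on
    second derivatives serve the Taylor estimate behind differentiability of the flow. *)
Lemma flow_constants : exists (rho d K : R),
  [/\ [/\ 0 < d, 0 < K, K * d <= 1 / 2 & d + K * d < rho],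
      box3 p0 rho `<=` W,
      (forall q, box3 p0 rho q -> [/\ `|zeta q| <= K, `|'D_ex1 zeta q| <= K & `|'D_ex3 zeta q| <= K]) &
      (forall q, box3 p0 rho q ->
        (`|'D_ex1 (fun p => 'D_ex1 zeta p) q| <= K /\ `|'D_ex3 (fun p => 'D_ex1 zeta p) q| <= K) /\
        (`|'D_ex1 (fun p => 'D_ex3 zeta p) q| <= K /\ `|'D_ex3 (fun p => 'D_ex3 zeta p) q| <= K))].
Proof.
have z1 := smooth_derive ex1 zs; have z3 := smooth_derive ex3 zs.
have z11 := smooth_derive ex1 z1; have z13 := smooth_derive ex3 z1.
have z31 := smooth_derive ex1 z3; have z33 := smooth_derive ex3 z3.
have [c0 n0 b0] := local_bound zs Wp0.
have [c1 n1 b1] := local_bound z1 Wp0; have [c3 n3 b3] := local_bound z3 Wp0.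
have [c11 n11 b11] := local_bound z11 Wp0; have [c13 n13 b13] := local_bound z13 Wp0.
have [c31 n31 b31] := local_bound z31 Wp0; have [c33 n33 b33] := local_bound z33 Wp0.
pose K := c0 + c1 + c3 + c11 + c13 + c31 + c33 + 1 : R.
have K0 : 0 < K by rewrite ltr_wpDl // !addr_ge0.
have [rho rho0 Hr] := near_box3 (filterI (open_near oW Wp0) (filterI (filterI b0 (filterI b1 b3))
   (filterI (filterI b11 b13) (filterI b31 b33)))).
have m0 : 0 < Num.min rho 1 by rewrite lt_min rho0 ltr01.
have K1 : 0 < 2 * (1 + K) by rewrite mulr_gt0 // ltr_wpDl // ltW.
have K1' : 1 + K != 0 by rewrite gt_eqF // ltr_wpDl // ltW.
(* d satisfies d (1 + K) = min(rho, 1) / 2: the bound by 1 gives K d <= 1/2, the bound by rho gives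
   d + K d < rho. *)
exists rho, (Num.min rho 1 / (2 * (1 + K))), K; split.
- have dE : Num.min rho 1 / (2 * (1 + K)) * (1 + K) = Num.min rho 1 / 2 by field.
  have d0 : 0 < Num.min rho 1 / (2 * (1 + K)) by rewrite divr_gt0.
  have h1 : Num.min rho 1 <= 1 by rewrite ge_min lexx orbT.
  have h2 : Num.min rho 1 <= rho by rewrite ge_min lexx.
  exact: small_constants K0 dE d0 h1 h2 m0.
- by move=> q /Hr [].
- move=> q /Hr [_ [[h0 [h1 h3]] _]].
  by split; [apply: le_trans h0 _|apply: le_trans h1 _|apply: le_trans h3 _];
     rewrite /K; clear -n0 n1 n3 n11 n13 n31 n33; lra.
- move=> q /Hr [_ [_ [[h11 h13] [h31 h33]]]].
  by split; split; [apply: le_trans h11 _|apply: le_trans h13 _|apply: le_trans h31 _|apply: le_trans h33 _];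
     rewrite /K; clear -n0 n1 n3 n11 n13 n31 n33; lra.
Qed.

Section Picard.
Variables (rho d K : R).
Hypotheses (d0 : 0 < d) (K0 : 0 < K) (Kd : K * d <= 1 / 2) (dr : d + K * d < rho)
  (BW : box3 p0 rho `<=` W)
  (HK : forall q, box3 p0 rho q -> [/\ `|zeta q| <= K, `|'D_ex1 zeta q| <= K & `|'D_ex3 zeta q| <= K]).
Let B := box3 p0 d.
Let oB : open B := @box3_open R p0 d.
Let x0 := p0.1.2.

Let drho : d < rho.
Proof. by apply: le_lt_trans dr; rewrite lerDl mulr_ge0 // ltW. Qed.

(** The space on which the Picard map acts: a slope at most K over a length below d moves the
    initial value by at most K d. *)
Definition stays (f : R3 -> R) := Ck 0 B f /\ forall q, B q -> `|f q - q.2| <= K * d.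

Lemma stays_box f q : stays f -> B q -> box3 p0 rho (q.1.1, q.1.2, f q).
Proof.
move=> [_ Hf] Bq; have [b1 b2 b3] := Bq; split => /=; [exact: lt_trans b1 drho|exact: lt_trans b2 drho|].
apply: le_lt_trans dr; rewrite -(subrKA q.2) addrC.
by apply: le_trans (ler_normD _ _) _; apply: lerD; [exact: ltW|exact: Hf].
Qed.

Lemma stays_along k g f : smooth_on W g -> (forall q, B q -> box3 p0 rho (q.1.1, q.1.2, f q)) ->
  Ck k B f -> Ck k B (along g f).
Proof.
move=> gs Hf Cf; apply: (Ck_comp3 oB gs (Ck_fst k oB) (Ck_snd k oB) Cf).
by move=> q /Hf /BW.
Qed.

Definition picard (f : R3 -> R) : R3 -> R :=
  fun q => q.2 + param_prim p0 d (along zeta f) q.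

Lemma stays_along0 f : stays f -> Ck 0 B (along zeta f).
Proof. by move=> sf; apply: stays_along zs _ sf.1 => q; exact: stays_box. Qed.

Lemma picard_derive f q : stays f -> B q ->
  picard f (q.1.1, x0, q.2) = q.2 /\
  forall s, `|s - x0| < d -> is_derive s 1 (fun s => picard f (q.1.1, s, q.2)) (zeta (q.1.1, s, f (q.1.1, s, q.2))).
Proof.
move=> sf Bq; have [P1 P2] := param_primP d0 (stays_along0 sf) Bq.
split; first by rewrite /picard P1 addr0.
move=> s hs; rewrite -[zeta _]add0r.
exact: (is_deriveD (is_derive_cst (q.2 : R) s (1 : R)) (P2 s hs)).
Qed.

Lemma box_slice q s : B q -> `|s - x0| < d -> B (q.1.1, s, q.2).
Proof. by move=> [h1 h2 h3] hs; split. Qed.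

Lemma seg_slice q s : B q -> Num.min x0 q.1.2 <= s <= Num.max x0 q.1.2 -> `|s - x0| < d.
Proof. by move=> Bq hs; have [_ +] := box_between d0 Bq hs. Qed.

Lemma q_eta (q : R3) : q = (q.1.1, q.1.2, q.2). Proof. by case: q => [[]]. Qed.

Lemma picard_stays f : stays f -> stays (picard f).
Proof.
move=> sf; split.
  exact: (Ck_add oB (Ck_thd 0 oB) (Ck_param_prim d0 (stays_along0 sf))).
move=> q Bq; have [b1 b2 b3] := Bq.
have [P1 P2] := picard_derive sf Bq.
have Hb s (hs : Num.min x0 q.1.2 <= s <= Num.max x0 q.1.2) :
    `|zeta (q.1.1, s, f (q.1.1, s, q.2))| <= K.
  by have [h _ _] := HK (stays_box sf (box_slice Bq (seg_slice Bq hs))); exact: h.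
have := derive_bound (fun s hs => conj (P2 s (seg_slice Bq hs)) (Hb s hs)).
rewrite P1 -q_eta => H.
by apply: le_trans H _; rewrite ler_wpM2l // ltW.
Qed.

(** zeta is Lipschitz in u with constant K and the integration length is below d, so the contraction
    factor is K d <= 1/2. *)
Lemma picard_contract f g (c : R) : stays f -> stays g ->
  (forall q, B q -> `|f q - g q| <= c) ->
  forall q, B q -> `|picard f q - picard g q| <= c / 2.
Proof.
move=> sf sg Hc q Bq.
have [P1 P2] := picard_derive sf Bq; have [Q1 Q2] := picard_derive sg Bq.
have Df s (hs : Num.min x0 q.1.2 <= s <= Num.max x0 q.1.2) :=
  is_deriveB (P2 s (seg_slice Bq hs)) (Q2 s (seg_slice Bq hs)).
have c0 : 0 <= c by exact: le_trans (normr_ge0 _) (Hc _ Bq).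
have Hb s (hs : Num.min x0 q.1.2 <= s <= Num.max x0 q.1.2) :
    `|zeta (q.1.1, s, f (q.1.1, s, q.2)) - zeta (q.1.1, s, g (q.1.1, s, q.2))| <= K * c.
  have Bs := box_slice Bq (seg_slice Bq hs).
  have b1 : box3 p0 rho (q.1.1, s, f (q.1.1, s, q.2)) := stays_box sf Bs.
  have b2 : box3 p0 rho (q.1.1, s, g (q.1.1, s, q.2)) := stays_box sg Bs.
  have HK' p : box3 p0 rho p -> `|'D_ex1 zeta p| <= K /\ `|'D_ex3 zeta p| <= K.
    by move=> /HK [].
  apply: le_trans (box_lipschitz BW zs HK' b2 b1) _.
  by rewrite subrr normr0 add0r; apply: ler_wpM2l; [exact: ltW|exact: (Hc _ Bs)].
have := derive_bound (fun s hs => conj (Df s hs) (Hb s hs)).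
rewrite -![(_ - _ : _ -> _) _]/(_ - _) P1 Q1 subrr subr0 -!q_eta => H; apply: le_trans H _.
have [_ b2 _] := Bq.
apply: (@le_trans _ _ (K * c * d)); first by rewrite ler_wpM2l ?mulr_ge0 ?(ltW K0) // ltW.
have -> : K * c * d = K * d * c by rewrite mulrAC.
have -> : c / 2 = 1 / 2 * c by rewrite mul1r mulrC.
exact: ler_wpM2r.
Qed.

Lemma le_geometric (x y a : R) : 0 <= a -> (forall n, x <= y + a / 2 ^+ n) -> x <= y.
Proof.
move=> a0 H; apply/ler_addgt0Pr => e e0.
have [n an] : exists n : nat, a / 2 ^+ n <= e.
  have := archi_boundP (divr_ge0 a0 (ltW e0)); set n := Num.Def.archi_bound _ => an.
  exists n; rewrite ler_pdivrMr ?exprn_gt0 // mulrC -ler_pdivrMr //.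
  apply: le_trans (ltW an) _; rewrite -natrX ler_nat; exact/ltnW/ltn_expl.
by apply: le_trans (H n) _; rewrite lerD2l.
Qed.

(** The first correction is at most K d and the corrections halve, so the iterates converge at a
    rate uniform over the box; uniformity passes continuity to the limit. *)
Lemma picard_fixpoint : exists2 f, stays f & forall q, B q -> f q = picard f q.
Proof.
pose u n := iter n picard (fun q : R3 => q.2).
have Kd0 : 0 <= K * d by rewrite mulr_ge0 // ltW.
have su n : stays (u n).
  elim: n => [|n IH]; last exact: picard_stays.
  by split; [exact: (Ck_thd 0 oB)|move=> q _; rewrite /u /= subrr normr0].
have du n q : B q -> `|u n.+1 q - u n q| <= K * d / 2 ^+ n.
  elim: n q => [|n IH] q Bq.
    by rewrite expr0 divr1; have [_] := su 1%N; apply.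
  by rewrite exprSr invfM mulrA; apply: (picard_contract (su n.+1) (su n)).
have /choice [f Hf] : forall q, exists l, B q -> forall n, `|u n q - l| <= 2 * (K * d) / 2 ^+ n.
  move=> q; have [Bq|nB] := pselect (B q); last by exists 0.
  by have [l Hl] := geometric_limit (fun n => du n q Bq); exists l.
have c0 : 0 <= 2 * (K * d) by rewrite mulr_ge0.
have sf : stays f; last first.
  exists f => // q Bq; apply/eqP; rewrite -subr_eq0 -normr_le0.
  apply: (le_geometric c0) => n; rewrite add0r.
  rewrite -(subrKA (u n.+1 q)); apply: le_trans (ler_normD _ _) _.
  have -> : 2 * (K * d) / 2 ^+ n = 2 * (K * d) / 2 ^+ n.+1 + 2 * (K * d) / 2 ^+ n / 2.
    by rewrite exprS; field; rewrite expf_neq0.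
  apply: lerD; first by rewrite distrC; exact: Hf.
  by apply: (picard_contract (su n) sf) => // q' Bq'; exact: Hf.
split; last first.
  move=> q Bq; apply: (le_geometric c0) => n.
  rewrite -(subrKA (u n q)) addrC; apply: le_trans (ler_normD _ _) _.
  by apply: lerD; [have [_] := su n; apply|rewrite distrC; exact: Hf].
move=> q Bq; suff : f @ q --> f q by [].
apply/cvgrPdist_le => e e0; have e30 : 0 < e / 3 by rewrite divr_gt0.
have [n Hn] : exists n : nat, 2 * (K * d) / 2 ^+ n <= e / 3.
  apply: contrapT => nH; have : e / 3 <= 0; last by rewrite leNgt e30.
  apply: (le_geometric c0) => n; rewrite add0r leNgt; apply/negP => h.
  by apply: nH; exists n; exact: ltW.
have /cvgrPdist_le /(_ _ e30) : {for q, continuous (u n)} by have [+ _] := su n; exact.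
apply: filterS2 (open_near oB Bq) => q' Bq' h.
have h1 := le_trans (Hf _ Bq n) Hn; have h2 := le_trans (Hf _ Bq' n) Hn.
rewrite -(subrKA (u n q)); apply: le_trans (ler_normD _ _) _.
have -> : e = e / 3 + (e / 3 + e / 3) by field.
apply: lerD; first by rewrite distrC.
rewrite -(subrKA (u n q')); apply: le_trans (ler_normD _ _) _.
exact: lerD.
Qed.

End Picard.
End FlowExistence.

(** * Smooth dependence of the flow on its parameters *)

Section FlowSmooth.
Context {R : realType}.
Notation R3 := (R * R * R)%type.
Variables (W : set R3) (zeta : R3 -> R) (p0 : R3).
Hypotheses (zs : smooth_on W zeta).
Variables (rho d K : R).
Hypotheses (d0 : 0 < d) (K0 : 0 < K) (Kd : K * d <= 1 / 2) (dr : d + K * d < rho)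
  (BW : box3 p0 rho `<=` W)
  (HK : forall q, box3 p0 rho q -> [/\ `|zeta q| <= K, `|'D_ex1 zeta q| <= K & `|'D_ex3 zeta q| <= K])
  (HK2 : forall q, box3 p0 rho q ->
        (`|'D_ex1 (fun p => 'D_ex1 zeta p) q| <= K /\ `|'D_ex3 (fun p => 'D_ex1 zeta p) q| <= K) /\
        (`|'D_ex1 (fun p => 'D_ex3 zeta p) q| <= K /\ `|'D_ex3 (fun p => 'D_ex3 zeta p) q| <= K)).
Let B := box3 p0 d.
Let oB : open B := @box3_open R p0 d.
Let x0 := p0.1.2.
Variable f : R3 -> R.
Hypotheses (sf : stays p0 d K f) (ff : forall q, B q -> f q = picard zeta p0 d f q).

Let z1 := smooth_derive ex1 zs.
Let z3 := smooth_derive ex3 zs.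
Let fbox q (Bq : B q) : box3 p0 rho (q.1.1, q.1.2, f q) := stays_box d0 K0 dr sf Bq.

Lemma flow_along k g : smooth_on W g -> Ck k B f -> Ck k B (along g f).
Proof. by move=> gs; apply: (stays_along BW gs) => q; exact: fbox. Qed.

Lemma flow_init q : B q -> q.1.2 = x0 -> f q = q.2.
Proof.
move=> Bq E; rewrite ff // /picard param_prim0 ?addr0 //.
by apply: flow_along => //; exact: sf.1.
Qed.

Lemma flow_derive_ex2 q : B q -> is_derive q ex2 f (along zeta f q).
Proof.
move=> Bq.
have E : \forall p \near q, picard zeta p0 d f p = f p.
  by apply: filterS (open_near oB Bq) => p Bp; rewrite ff.
apply: near_eq_is_derive E _.
have h1 : is_derive q ex2 (fun p : R3 => p.2) 0.
  by case: q {Bq} => [[t x] u]; apply/is_derive_ex2; exact: is_derive_cst.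
have h2 : is_derive q ex2 (param_prim p0 d (along zeta f)) (along zeta f q).
  by apply: param_prim_derive => //; apply: flow_along => //; exact: sf.1.
by apply: (is_derive_eq (is_deriveD h1 h2)); rewrite add0r.
Qed.

Lemma slice_derive (g g' : R3 -> R) q s : (forall p, B p -> is_derive p ex2 g (g' p)) ->
  B q -> `|s - x0| < d ->
  is_derive s 1 (fun s => g (q.1.1, s, q.2)) (g' (q.1.1, s, q.2)).
Proof. by move=> H Bq hs; apply/is_derive_ex2/H; exact: box_slice. Qed.

Section Direction.
Variables (a b : R).

(** The exponent of the fundamental solution of the linearised equation v_x = zeta_u v along f;
    [var_src] is the source a zeta_t divided by that fundamental solution. *)
Definition var_exp : R3 -> R := fun q => param_prim p0 d (along (fun p => 'D_ex3 zeta p) f) q.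
Definition var_src : R3 -> R := fun q => a * along (fun p => 'D_ex1 zeta p) f q * expR (- var_exp q).
(* The solution of v_x = zeta_u v + a zeta_t with v = b at x = x0, by variation
   of constants. *)
Definition variation : R3 -> R := fun q => expR (var_exp q) * (b + param_prim p0 d var_src q).

Lemma Ck_var_exp k : Ck k B f -> Ck k B var_exp.
Proof. by move=> Cf; apply: Ck_param_prim => //; apply: flow_along. Qed.

Lemma Ck_var_src k : Ck k B f -> Ck k B var_src.
Proof.
move=> Cf; apply: (Ck_mul oB); first by apply: (Ck_scale _ oB); apply: flow_along.
by apply: (Ck_expR oB); apply: (Ck_opp oB); exact: Ck_var_exp.
Qed.

Lemma Ck_variation k : Ck k B f -> Ck k B variation.
Proof.
move=> Cf; apply: (Ck_mul oB); first by apply: (Ck_expR oB); exact: Ck_var_exp.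
apply: (Ck_add oB); first exact: Ck_cst.
by apply: Ck_param_prim => //; exact: Ck_var_src.
Qed.

Lemma variation_init q : B q -> q.1.2 = x0 -> variation q = b.
Proof.
move=> Bq E; rewrite /variation /var_exp !param_prim0 // ?expR0 ?addr0 ?mul1r //.
  by apply: Ck_var_src; exact: sf.1.
by apply: flow_along => //; exact: sf.1.
Qed.

Lemma variation_derive q : B q -> is_derive q ex2 variation
  (along (fun p => 'D_ex3 zeta p) f q * variation q + a * along (fun p => 'D_ex1 zeta p) f q).
Proof.
move=> Bq.
have h1 : is_derive q ex2 var_exp (along (fun p => 'D_ex3 zeta p) f q).
  by apply: param_prim_derive => //; apply: flow_along => //; exact: sf.1.
have h2 : is_derive q ex2 (param_prim p0 d var_src) (var_src q).
  by apply: param_prim_derive => //; apply: Ck_var_src; exact: sf.1.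
have dE : differentiable (@expR R) (var_exp q) by apply: (smooth_diff (@smooth_expR R)).
have h3 := is_derive_comp h1 dE.
have h4 := is_deriveD (is_derive_cst (b : R) q ex2) h2.
apply: (is_derive_eq (is_deriveM h3 h4)).
have -> : 'D_(along (fun p => 'D_ex3 zeta p) f q) (@expR R) (var_exp q) =
   along (fun p => 'D_ex3 zeta p) f q * expR (var_exp q).
  set w := along _ _ _; have -> : 'D_w (@expR R) (var_exp q) = 'D_(w *: 1) (@expR R) (var_exp q).
    by rewrite [_ *: 1]mulr1.
  rewrite derive_scaled //; congr (_ * _).
  exact: (@derive_val _ _ _ _ _ _ _ (is_derive_expR _)).
rewrite add0r /variation /var_src -![_ *: _]/(_ * _) /=.
have : expR (var_exp q) * expR (- var_exp q) = 1 by rewrite -expRD subrr expR0.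
rewrite -[(_ + _ : _ -> _) q]/(_ + _) /=.
move: (expR (var_exp q)) (expR (- var_exp q)) (along _ _ _) (along _ _ _) (param_prim _ _ _ _).
clear => E E' z3 z1 P H.
have -> : E * (a * z1 * E') = a * z1 * (E * E') by ring.
rewrite H; ring.
Qed.

(** Let D be the difference of the solutions with data shifted by h (a, 0, b). [small_gronwall]
    first gives D = O(h). Then r = D - h v, with v the [variation], vanishes at x0 and satisfies the
    linearised equation up to the Taylor remainder of zeta, which is O(h^2); a second use gives r =
    O(h^2). *)
Lemma flow_derive_dir q : B q -> is_derive q (a, 0, b) f (variation q).
Proof.
move=> Bq; have [b1 b2 b3] := Bq.
apply: is_derive_eps => e e0.
have [d1 d10 Hd1] := near_box3 (open_near oB Bq).
(* M and C are the outputs of [small_gronwall] divided by |h| and by |h|^2: for D the initial value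
   is h b and the source K |h a|, for r the initial value is 0 and the source K (|a| + M)^2
   |h|^2. *)
pose M := 2 * (`|b| + d * (K * `|a|)).
have M0 : 0 <= M by rewrite mulr_ge0 // addr_ge0 // !mulr_ge0 // ltW.
pose C := 2 * (d * (K * (`|a| + M) ^+ 2)).
have C0 : 0 <= C by rewrite !mulr_ge0 ?exprn_ge0 ?addr_ge0 // ltW.
have c1 : 0 < `|a| + `|b| + 1 by rewrite ltr_wpDl // addr_ge0.
exists (Num.min (d1 / (`|a| + `|b| + 1)) (e / (C + 1))).
  by rewrite lt_min !divr_gt0 // ltr_wpDl.
move=> h; rewrite lt_min ltr_pdivlMr // ltr_pdivlMr; last by rewrite ltr_wpDl.
move=> /andP[hd he].
pose q1 : R3 := (q.1.1 + h * a, q.1.2, q.2 + h * b).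
have Bq1 : B q1.
  apply: Hd1; split; rewrite /= ?subrr ?normr0 // addrAC subrr add0r normrM.
    apply: le_lt_trans hd; apply: ler_wpM2l => //.
    by rewrite -addrA lerDl addr_ge0.
  apply: le_lt_trans hd; apply: ler_wpM2l => //.
  by rewrite [`|a| + _]addrC -addrA lerDl addr_ge0.
have -> : q + h *: (a, 0, b) = q1 by rewrite scaleR3 {1}(q_eta q) addR3 mulr0 addr0.
have Fd := slice_derive flow_derive_ex2.
have Vd := slice_derive variation_derive.
pose D s := f (q1.1.1, s, q1.2) - f (q.1.1, s, q.2).
pose D' s := zeta (q1.1.1, s, f (q1.1.1, s, q1.2)) - zeta (q.1.1, s, f (q.1.1, s, q.2)).
have bx s : `|s - x0| < d -> box3 p0 rho (q.1.1, s, f (q.1.1, s, q.2)) /\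
     box3 p0 rho (q1.1.1, s, f (q1.1.1, s, q1.2)).
  by move=> hs; split; [exact: (fbox (box_slice Bq hs))|exact: (fbox (box_slice Bq1 hs))].
have dD s : `|s - x0| < d -> is_derive s 1 D (D' s).
  by move=> hs; apply: is_deriveB; exact: Fd.
have HK' p : box3 p0 rho p -> `|'D_ex1 zeta p| <= K /\ `|'D_ex3 zeta p| <= K.
  by move=> /HK [].
have ht : q1.1.1 - q.1.1 = h * a by rewrite /q1 /= addrAC subrr add0r.
have Bx0 p : B p -> B (p.1.1, x0, p.2).
  by move=> Bp; apply: box_slice => //; rewrite subrr normr0.
have Dx0 : D x0 = h * b.
  rewrite /D !flow_init //; last exact: (Bx0 q1).
  - by rewrite /q1 /= addrAC subrr add0r.
  - exact: Bx0.
have sg := seg_slice d0 Bq.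
have Dbound s : Num.min x0 q.1.2 <= s <= Num.max x0 q.1.2 -> `|D s| <= M * `|h|.
  move=> hs; have hs' := sg s hs.
  have sub s' : Num.min x0 s <= s' <= Num.max x0 s -> `|s' - x0| < d.
    by apply: between_near => //; rewrite subrr normr0.
  have := @small_gronwall R D D' x0 s K (K * `|h * a|) d (ltW hs') (ltW K0) _ Kd.
  move=> /(_ (mulr_ge0 (ltW K0) (normr_ge0 _))) H; apply: le_trans (H _) _.
    move=> s' /sub hs2; split; first exact: dD.
    have [bx1 bx2] := bx _ hs2.
    apply: le_trans (box_lipschitz BW zs HK' bx1 bx2) _.
    by rewrite ht -mulrDr addrC.
  rewrite Dx0 !normrM.
  by have -> : M * `|h| = 2 * (`|h| * `|b| + d * (K * (`|h| * `|a|))) by rewrite /M; ring.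
pose r s := D s - h * variation (q.1.1, s, q.2).
pose r' s := D' s - h * (along (fun p => 'D_ex3 zeta p) f (q.1.1, s, q.2) * variation (q.1.1, s, q.2)
   + a * along (fun p => 'D_ex1 zeta p) f (q.1.1, s, q.2)).
have rx0 : r x0 = 0.
  by rewrite /r Dx0 variation_init ?subrr //; exact: Bx0.
have := @small_gronwall R r r' x0 q.1.2 K (K * (`|a| + M) ^+ 2 * `|h| ^+ 2) d (ltW b2) (ltW K0) _ Kd.
rewrite rx0 normr0 add0r => H.
have {H} : `|r q.1.2| <= 2 * (d * (K * (`|a| + M) ^+ 2 * `|h| ^+ 2)).
  apply: H; first by rewrite !mulr_ge0 ?exprn_ge0 ?addr_ge0 // ltW.
  move=> s hs; have hs' := sg s hs; split.
    apply: is_deriveB; first exact: dD.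
    by apply: is_deriveZ; apply: Vd.
  have [bx1 bx2] := bx _ hs'.
  have T := box_taylor BW zs (fun p Bp => (HK2 Bp).1) (fun p Bp => (HK2 Bp).2) bx1 bx2.
  have [_ k3] := HK' _ bx1.
  rewrite ht -/(D s) in T.
  (* Splits r' into the Taylor remainder of zeta and zeta_u r, the shape required by
     [small_gronwall]. *)
  have Er : r' s = (D' s - (h * a * 'D_ex1 zeta (q.1.1, s, f (q.1.1, s, q.2)) +
      D s * 'D_ex3 zeta (q.1.1, s, f (q.1.1, s, q.2)))) +
      'D_ex3 zeta (q.1.1, s, f (q.1.1, s, q.2)) * r s.
    rewrite /r' /r /along /=.
    move: ('D_ex1 zeta _) ('D_ex3 zeta _) (variation _) (D s) (D' s).
    clear => y1 y3 v Ds Ds'; ring.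
  rewrite Er addrC; apply: le_trans (ler_normD _ _) _; apply: lerD.
    by rewrite normrM; apply: ler_wpM2r.
  apply: le_trans T _; rewrite -mulrA; apply: ler_wpM2l; first exact: ltW.
  rewrite -exprMn; apply: lerXn2r; rewrite ?nnegrE ?mulr_ge0 ?addr_ge0 //.
  by rewrite normrM mulrDl mulrC lerD2l; exact: Dbound.
rewrite /r /D /= -!q_eta => Hr; apply: le_trans Hr _.
have -> : 2 * (d * (K * (`|a| + M) ^+ 2 * `|h| ^+ 2)) = C * `|h| * `|h| by rewrite /C; ring.
apply: ler_wpM2r => //; apply: le_trans (ltW he); rewrite mulrC.
by apply: ler_wpM2l => //; rewrite lerDl.
Qed.

End Direction.

(** [variation] consists of primitives and exponentials of smooth functions along f, so it is as
    regular as f, and f gains one order in each step. The pairs (1, 0) and (0, 1) are the directions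
    [ex1] and [ex3]. *)
Lemma flow_smooth : smooth_on B f.
Proof.
move=> k; elim: k => [|k IH]; first exact: sf.1.
apply: (Ck_partials oB (Ck_variation 1 0 IH) (flow_along zs IH) (Ck_variation 0 1 IH)).
- by move=> p; apply: flow_derive_dir.
- by move=> p; apply: flow_derive_ex2.
- by move=> p; apply: flow_derive_dir.
Qed.

End FlowSmooth.

Theorem flow_exists (R : realType) (W : set (R * R * R)) (zeta : R * R * R -> R) p0 :
  open W -> W p0 -> smooth_on W zeta ->
  exists (d : R) (f : R * R * R -> R),
    [/\ 0 < d, smooth_on (box3 p0 d) f,
      (forall q, box3 p0 d q -> W (q.1.1, q.1.2, f q)),
      (forall q, box3 p0 d q -> is_derive q ex2 f (zeta (q.1.1, q.1.2, f q))) &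
      (forall q, box3 p0 d q -> q.1.2 = p0.1.2 -> f q = q.2)].
Proof.
move=> oW Wp0 zs.
have [rho [d [K [[d0 K0 Kd dr] BW HK HK2]]]] := flow_constants oW Wp0 zs.
have [f sf ff] := picard_fixpoint zs d0 K0 Kd dr BW HK.
exists d, f; split=> //.
- exact: (flow_smooth zs d0 K0 Kd dr BW HK HK2 sf ff).
- by move=> q Bq; apply: BW; exact: (stays_box d0 K0 dr sf Bq).
- by move=> q Bq; exact: (flow_derive_ex2 zs d0 K0 dr BW sf ff Bq).
- by move=> q Bq; exact: (flow_init zs d0 K0 dr BW sf ff Bq).
Qed.

(** * The Frobenius system u_x = zeta, u_t = G *)

Section Frobenius.
Context {R : realType}.
Notation R3 := (R * R * R)%type.

Lemma is_derive_fst3 (q v : R3) : is_derive q v (fun p : R3 => p.1.1) v.1.1.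
Proof.
apply: is_derive_eps => e e0; exists 1 => // h _.
have -> : (q + h *: v).1.1 - q.1.1 - h * v.1.1 = q.1.1 + h * v.1.1 - q.1.1 - h * v.1.1 by [].
by rewrite (addrC q.1.1) addrK subrr normr0 mulr_ge0 // ltW.
Qed.

Lemma is_derive_snd3 (q v : R3) : is_derive q v (fun p : R3 => p.1.2) v.1.2.
Proof.
apply: is_derive_eps => e e0; exists 1 => // h _.
have -> : (q + h *: v).1.2 - q.1.2 - h * v.1.2 = q.1.2 + h * v.1.2 - q.1.2 - h * v.1.2 by [].
by rewrite (addrC q.1.2) addrK subrr normr0 mulr_ge0 // ltW.
Qed.

Lemma is_derive_thd3 (q v : R3) : is_derive q v (fun p : R3 => p.2) v.2.
Proof.
apply: is_derive_eps => e e0; exists 1 => // h _.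
have -> : (q + h *: v).2 - q.2 - h * v.2 = q.2 + h * v.2 - q.2 - h * v.2 by [].
by rewrite (addrC q.2) addrK subrr normr0 mulr_ge0 // ltW.
Qed.

Lemma along_derive (g f : R3 -> R) (q v : R3) f' : is_derive q v f f' ->
  differentiable g (q.1.1, q.1.2, f q) ->
  is_derive q v (along g f) (along (fun p => 'D_ex1 g p) f q * v.1.1 +
    along (fun p => 'D_ex2 g p) f q * v.1.2 + along (fun p => 'D_ex3 g p) f q * f').
Proof.
move=> df dg; apply: is_derive_comp3 => //; [exact: is_derive_fst3|exact: is_derive_snd3].
Qed.

Lemma along_derive1 (g f : R3 -> R) (q : R3) f' : is_derive q ex1 f f' ->
  differentiable g (q.1.1, q.1.2, f q) ->
  is_derive q ex1 (along g f) (along (fun p => 'D_ex1 g p) f q +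
    along (fun p => 'D_ex3 g p) f q * f').
Proof.
move=> df dg; apply: (is_derive_eq (along_derive df dg)).
have H (a b c : R) : a + c * f' = a * (@ex1 R).1.1 + b * (@ex1 R).1.2 + c * f'.
  by rewrite /ex1 /= mulr1 mulr0 addr0.
apply: esym; exact: H.
Qed.

Lemma along_derive2 (g f : R3 -> R) (q : R3) f' : is_derive q ex2 f f' ->
  differentiable g (q.1.1, q.1.2, f q) ->
  is_derive q ex2 (along g f) (along (fun p => 'D_ex2 g p) f q +
    along (fun p => 'D_ex3 g p) f q * f').
Proof.
move=> df dg; apply: (is_derive_eq (along_derive df dg)).
have H (a b c : R) : b + c * f' = a * (@ex2 R).1.1 + b * (@ex2 R).1.2 + c * f'.
  by rewrite /ex2 /= mulr1 mulr0 add0r.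
apply: esym; exact: H.
Qed.

(** Here y1, y2 are zeta_t, zeta_u, y3, y4 are G_x, G_u, y5 is f_t, and y6, y7 are zeta, G. The
    compatibility condition turns the x-derivative of the defect f_t - G into zeta_u times the
    defect. *)
Lemma compat_algebra (y1 y2 y3 y4 y5 y6 y7 : R) : y1 + y7 * y2 = y3 + y6 * y4 ->
  y2 * (y5 - y7) = y1 + y2 * y5 - (y3 + y4 * y6).
Proof.
move=> C; have -> : y1 = y3 + y6 * y4 - y7 * y2 by rewrite -C addrK.
ring.
Qed.

Lemma is_derive_val (V W : normedModType R) (f : V -> W) p v l :
  is_derive p v f l -> 'D_v f p = l.
Proof. by case. Qed.

Section Compat.
Variables (W : set R3) (zeta G : R3 -> R).
Hypotheses (oW : open W) (zs : smooth_on W zeta) (Gs : smooth_on W G).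
Hypothesis compat : forall p, W p ->
  'D_ex1 zeta p + G p * 'D_ex3 zeta p = 'D_ex2 G p + zeta p * 'D_ex3 G p.

Lemma compat_propagates p0 d f : 0 < d -> smooth_on (box3 p0 d) f ->
  (forall q, box3 p0 d q -> W (q.1.1, q.1.2, f q)) ->
  (forall q, box3 p0 d q -> is_derive q ex2 f (along zeta f q)) ->
  (forall q, box3 p0 d q -> q.1.2 = p0.1.2 -> 'D_ex1 f q = along G f q) ->
  forall q, box3 p0 d q -> 'D_ex1 f q = along G f q.
Proof.
move=> d0 fs fW fz fG q Bq; set B := box3 p0 d in fs fW fz fG Bq.
have oB : open B by exact: box3_open.
have dz p : B p -> differentiable zeta (p.1.1, p.1.2, f p) by move=> /fW; exact: smooth_diff.
have dG p : B p -> differentiable G (p.1.1, p.1.2, f p) by move=> /fW; exact: smooth_diff.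
pose w p := 'D_ex1 f p - along G f p.
have Dw p : B p -> is_derive p ex2 w (along (fun p => 'D_ex3 zeta p) f p * w p).
  move=> Bp.
  have h1 : is_derive p ex2 (fun p => 'D_ex1 f p) (along (fun p => 'D_ex1 zeta p) f p +
     along (fun p => 'D_ex3 zeta p) f p * 'D_ex1 f p).
    apply: (is_derive_eq (differentiable_is_derive ex2 (smooth_diff (smooth_derive ex1 fs) Bp))).
    rewrite (derive_comm ex1 ex2 oB Bp fs).
    have E : forall q, B q -> 'D_ex2 f q = along zeta f q.
      by move=> q' Bq'; exact: is_derive_val (fz _ Bq').
    rewrite (derive_eq_on _ oB Bp E).
    have df := differentiable_is_derive ex1 (smooth_diff fs Bp).
    exact: is_derive_val (along_derive1 df (dz _ Bp)).
  have h2 := along_derive2 (fz _ Bp) (dG _ Bp).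
  apply: (is_derive_eq (is_deriveB h1 h2)).
  apply: esym; exact: (@compat_algebra _ _ _ _ _ _ _ (compat (fW _ Bp))).
have cz3 : Ck 0 B (along (fun p => 'D_ex3 zeta p) f).
  apply: (Ck_comp3 oB (smooth_derive ex3 zs) (Ck_fst 0 oB) (Ck_snd 0 oB) (fs 0%N)).
  exact: fW.
pose P := param_prim p0 d (along (fun p => 'D_ex3 zeta p) f).
have DP p : B p -> is_derive p ex2 P (along (fun p => 'D_ex3 zeta p) f p).
  by move=> Bp; apply: param_prim_derive.
(* Integrating factor: since P has x-derivative zeta_u, the product F does not depend on x, and it
   vanishes on x = x0. *)
pose F p := w p * expR (- P p).
have DF p : B p -> is_derive p ex2 F 0.
  move=> Bp.
  have dE : differentiable (@expR R) (- P p) by apply: (smooth_diff (@smooth_expR R)).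
  have h := is_derive_comp (is_deriveN (DP _ Bp)) dE.
  apply: (is_derive_eq (is_deriveM (Dw _ Bp) h)).
  set z := along _ _ _; have -> : 'D_(- z) (@expR R) (- P p) = - z * expR (- P p).
    have -> : 'D_(- z) (@expR R) (- P p) = 'D_(- z *: 1) (@expR R) (- P p).
      by rewrite [_ *: 1]mulr1.
    rewrite derive_scaled //; congr (_ * _).
    exact: (@derive_val _ _ _ _ _ _ _ (is_derive_expR _)).
  rewrite -![_ *: _]/(_ * _) /= -[(- P) p]/(- P p).
  by move: (w p) (expR _); clear => y1 y2; ring.
have E : F q = F (q.1.1, p0.1.2, q.2).
  rewrite [in LHS](q_eta q); apply/esym.
  apply: (@derive0_eq R (fun s => F (q.1.1, s, q.2))) => s hs.
  by apply/is_derive_ex2/DF; apply: (box_slice Bq); exact: (seg_slice d0 Bq hs).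
have Bx : B (q.1.1, p0.1.2, q.2) by apply: (box_slice Bq); rewrite subrr normr0.
have F0 : F (q.1.1, p0.1.2, q.2) = 0 by rewrite /F /w fG // subrr mul0r.
have n0 : expR (- P q) != 0 by rewrite gt_eqF // expR_gt0.
rewrite F0 in E; have : w q * expR (- P q) == 0 by rewrite -E.
by rewrite mulf_eq0 (negbTE n0) orbF subr_eq0 => /eqP.
Qed.

Theorem frobenius p0 : W p0 ->
  exists (d : R) (f : R3 -> R),
    [/\ 0 < d, smooth_on (box3 p0 d) f,
      f p0 = p0.2,
      (forall q, box3 p0 d q -> W (q.1.1, q.1.2, f q) /\ 'D_ex3 f q != 0) &
      (forall q, box3 p0 d q -> 'D_ex1 f q = along G f q /\ 'D_ex2 f q = along zeta f q)].
Proof.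
move=> Wp0.
have [d1 [phi [d10 phis phiW phiz phi0]]] := flow_exists oW Wp0 zs.
(* [flow_exists] integrates along the second coordinate, so for u_t = G the time takes that place.
   The first coordinate is a dummy parameter, and x is frozen at its value in p0. *)
pose sw (q : R3) : R3 := (q.1.2, p0.1.2, q.2).
have csw : continuous sw.
  move=> q; apply: cont_pair; last exact: snd_cont.
  by apply: cont_pair; [exact: cont_snd3|exact: cst_continuous].
have oW' : open (sw @^-1` W) by apply: open_comp => // q _; exact: csw.
have Gs' : smooth_on (sw @^-1` W) (fun q => G (sw q)).
  move=> k; apply: (Ck_comp3 oW' Gs (Ck_snd k oW') (Ck_cst k _ _) (Ck_thd k oW')).
  by move=> q.
pose p0' : R3 := (0, p0.1.1, p0.2).
have Wp0' : (sw @^-1` W) p0' by rewrite /sw /= -q_eta.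
have [d2 [psi [d20 psis psiW psiG psi0]]] := flow_exists oW' Wp0' Gs'.
have B20 : box3 p0' d2 p0' by split; rewrite subrr normr0.
have psip0 : psi p0' = p0.2 by rewrite psi0.
(* Values of psi become initial values for phi, so they must stay within d1 of the last coordinate
   of p0. *)
have [d3 d30 Hd3] : exists2 d3 : R, 0 < d3 & box3 p0' d3 `<=` [set q | `|psi q - p0.2| < d1].
  apply: near_box3; apply: near_dist_lt; first exact: smooth_cont psis B20.
  by rewrite psip0 subrr normr0.
pose cc (q : R3) := psi (0, q.1.1, q.2).
pose f (q : R3) := phi (q.1.1, q.1.2, cc q).
pose d4 := Num.min d1 (Num.min d2 d3).
have d40 : 0 < d4 by rewrite !lt_min d10 d20.
pose B := box3 p0 d4; have oB : open B by exact: box3_open.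
have B1 q : B q -> box3 p0 d1 (q.1.1, q.1.2, cc q).
  move=> [h1 h2 h3]; move: h1 h2 h3; rewrite !lt_min => /and3P[a1 a2 a3] /and3P[b1 b2 b3] /and3P[c1 c2 c3].
  split=> //=; apply: Hd3; split=> //=; by rewrite subrr normr0.
have B2 q : B q -> box3 p0' d2 (0, q.1.1, q.2).
  move=> [h1 h2 h3]; move: h1 h2 h3; rewrite !lt_min => /and3P[a1 a2 a3] /and3P[b1 b2 b3] /and3P[c1 c2 c3].
  by split=> //=; rewrite subrr normr0.
have ccs : smooth_on B cc.
  move=> k; apply: (Ck_comp3 oB psis (Ck_cst k _ _) (Ck_fst k oB) (Ck_thd k oB)).
  exact: B2.
have fs : smooth_on B f.
  by move=> k; apply: (Ck_comp3 oB phis (Ck_fst k oB) (Ck_snd k oB) (ccs k)).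
have fW q : B q -> W (q.1.1, q.1.2, f q) by move=> /B1 /phiW.
have fz q : B q -> is_derive q ex2 f (along zeta f q).
  move=> Bq; have := phiz _ (B1 _ Bq).
  by case: q Bq => [[t x] k] Bq /is_derive_ex2 H; apply/is_derive_ex2.
have fx0 t k : B (t, p0.1.2, k) -> f (t, p0.1.2, k) = psi (0, t, k).
  by move=> Bq; rewrite /f phi0 //; exact: (B1 _ Bq).
have fG q : B q -> q.1.2 = p0.1.2 -> 'D_ex1 f q = along G f q.
  case: q => [[t x] k] Bq /= xE; rewrite xE in Bq *.
  apply: is_derive_val; apply/is_derive_ex1.
  have E : \forall s \near t, psi (0, s, k) = f (s, p0.1.2, k).
    have [h1 h2 h3] := Bq.
    have cid : {for t, continuous (fun s : R => s)} by exact: cvg_id.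
    have := near_dist_lt cid h1; apply: filterS => s hs.
    by rewrite fx0 //; split.
  apply: near_eq_is_derive E _.
  have /is_derive_ex2 := psiG _ (B2 _ Bq).
  by rewrite /along /sw /= fx0.
have fp0 : f p0 = p0.2.
  have Bp0 : B p0 by split; rewrite subrr normr0.
  by rewrite (q_eta p0) fx0 -?q_eta.
(* Over the base point both flows are at their initial line, so f is the identity in its parameter
   there; by continuity its derivative stays positive nearby. *)
have f3p0 : 'D_ex3 f p0 = 1.
  rewrite (q_eta p0); apply: is_derive_val; apply/is_derive_ex3.
  have E : \forall s \near p0.2, s = f (p0.1.1, p0.1.2, s).
    have h : `|p0.2 - p0.2| < d4 by rewrite subrr normr0.
    have cid : {for p0.2, continuous (fun s : R => s)} by exact: cvg_id.
    have := near_dist_lt cid h; apply: filterS => s hs.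
    have Bs : B (p0.1.1, p0.1.2, s) by split; rewrite /= ?subrr ?normr0.
    by rewrite fx0 // psi0 //; exact: (B2 _ Bs).
  apply: near_eq_is_derive E _; exact: is_derive_id.
have Bp0 : B p0 by split; rewrite subrr normr0.
have [d5 d50 Hd5] : exists2 d5 : R, 0 < d5 & box3 p0 d5 `<=` [set q | 0 < 'D_ex3 f q].
  apply: near_box3; apply: near_gt0; last by rewrite f3p0.
  exact: smooth_cont (smooth_derive ex3 fs) Bp0.
have sub : box3 p0 (Num.min d4 d5) `<=` B `&` box3 p0 d5.
  by move=> q [h1 h2 h3]; move: h1 h2 h3; rewrite !(@lt_min _ _ _ d4) => /andP[a1 a2] /andP[b1 b2] /andP[c1 c2]; split; split.
exists (Num.min d4 d5), f; split=> //.
- by rewrite lt_min d40.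
- by move=> k; apply: Ck_subset (fs k) => q /sub [].
- by move=> q /sub [Bq /Hd5 h]; split; [exact: fW|exact: lt0r_neq0].
move=> q /sub [Bq _]; split; first exact: (compat_propagates d40 fs fW fz fG).
by apply: is_derive_val; exact: fz.
Qed.

End Compat.
End Frobenius.

(** * Differential polynomials on the jet space *)

Section LinearForms.
Context {R : pzRingType}.
Implicit Types a b c : R.

Lemma lin_form01 a b c : a * 0 + b * 1 + c = b + c.
Proof. by rewrite mulr0 add0r mulr1. Qed.

Lemma lin_form10 a b c : a * 1 + b * 0 + c = a + c.
Proof. by rewrite mulr0 addr0 mulr1. Qed.

Lemma lin_form000 a b c : a * 0 + b * 0 + c * 0 = 0.
Proof. by rewrite !mulr0 !addr0. Qed.

Lemma lin_form00 a b c : a * 0 + b * 0 + c = c.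
Proof. by rewrite !mulr0 !add0r. Qed.

End LinearForms.

Section DifferentialPolynomials.
Context {R : realType}.
Notation R3 := (R * R * R)%type.
Implicit Types (z : jetpt R).

(* Polynomials in the jet coordinates whose coefficients are functions of
   (t, x, u). *)
Inductive dexp : Type :=
  | DB of (R3 -> R)
  | DC of nat & nat
  | DAdd of dexp & dexp
  | DMul of dexp & dexp.

Fixpoint ev (e : dexp) z : R :=
  match e with
  | DB g => g (base z)
  | DC a b => z.2 a b
  | DAdd e1 e2 => ev e1 z + ev e2 z
  | DMul e1 e2 => ev e1 z * ev e2 z
  end.

Fixpoint wf (W : set R3) (e : dexp) : Prop :=
  match e with
  | DB g => smooth_on W g
  | DC _ _ => True
  | DAdd e1 e2 | DMul e1 e2 => wf W e1 /\ wf W e2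
  end.

(* Differential of ev e at z applied to the tangent vector (vt, vx, vu). *)
Fixpoint dev (e : dexp) z (vt vx : R) (vu : nat -> nat -> R) : R :=
  match e with
  | DB g => 'D_ex1 g (base z) * vt + 'D_ex2 g (base z) * vx + 'D_ex3 g (base z) * vu 0%N 0%N
  | DC a b => vu a b
  | DAdd e1 e2 => dev e1 z vt vx vu + dev e2 z vt vx vu
  | DMul e1 e2 => ev e1 z * dev e2 z vt vx vu + ev e2 z * dev e1 z vt vx vu
  end.

(** A finite list of coordinates outside which the partial derivatives vanish; it turns the sums in
    [Dx] and [Dt] into sums over a list. A coefficient function depends on u, hence the pair (0,
    0). *)
Fixpoint occ (e : dexp) : seq (nat * nat) :=
  match e with
  | DB _ => [:: (0, 0)]
  | DC a b => [:: (a, b)]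
  | DAdd e1 e2 | DMul e1 e2 => occ e1 ++ occ e2
  end%N.

(** The total derivative as an operation on syntax, so that its iterates stay within [dexp]; [Dx_ev]
    identifies it with the sum that defines [Dx]. *)
Fixpoint dtotx (e : dexp) : dexp :=
  match e with
  | DB g => DAdd (DB (fun p => 'D_ex2 g p)) (DMul (DB (fun p => 'D_ex3 g p)) (DC 0 1))
  | DC a b => DC a b.+1
  | DAdd e1 e2 => DAdd (dtotx e1) (dtotx e2)
  | DMul e1 e2 => DAdd (DMul e1 (dtotx e2)) (DMul e2 (dtotx e1))
  end.

Fixpoint dtott (e : dexp) : dexp :=
  match e with
  | DB g => DAdd (DB (fun p => 'D_ex1 g p)) (DMul (DB (fun p => 'D_ex3 g p)) (DC 1 0))
  | DC a b => DC a.+1 b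
  | DAdd e1 e2 => DAdd (dtott e1) (dtott e2)
  | DMul e1 e2 => DAdd (DMul e1 (dtott e2)) (DMul e2 (dtott e1))
  end.

Lemma wf_dtotx W e : wf W e -> wf W (dtotx e).
Proof.
elim: e => //= [g gs|e1 IH1 e2 IH2 [/IH1 ? /IH2 ?]|e1 IH1 e2 IH2 [w1 w2]] //.
  by split; [|split=> //]; exact: smooth_derive.
by split; split=> //; [exact: IH2|exact: IH1].
Qed.

Lemma wf_dtott W e : wf W e -> wf W (dtott e).
Proof.
elim: e => //= [g gs|e1 IH1 e2 IH2 [/IH1 ? /IH2 ?]|e1 IH1 e2 IH2 [w1 w2]] //.
  by split; [|split=> //]; exact: smooth_derive.
by split; split=> //; [exact: IH2|exact: IH1].
Qed.

Lemma ev_dtotx e z : ev (dtotx e) z = dev e z 0 1 (fun a b => z.2 a b.+1).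
Proof.
elim: e => //= [g|e1 -> e2 ->|e1 -> e2 ->] //.
exact: esym (lin_form01 _ _ _).
Qed.

Lemma ev_dtott e z : ev (dtott e) z = dev e z 1 0 (fun a b => z.2 a.+1 b).
Proof.
elim: e => //= [g|e1 -> e2 ->|e1 -> e2 ->] //.
exact: esym (lin_form10 _ _ _).
Qed.

Lemma ev_agree e z z' : z.1 = z'.1 -> base z = base z' ->
  (forall ab, ab \in occ e -> z.2 ab.1 ab.2 = z'.2 ab.1 ab.2) -> ev e z = ev e z'.
Proof.
move=> E1 Eb; elim: e => //= [g _|a b H|e1 IH1 e2 IH2 H|e1 IH1 e2 IH2 H].
- by rewrite Eb.
- by apply: (H (a, b)); rewrite inE.
- by rewrite IH1 ?IH2 // => ab h; apply: H; rewrite mem_cat h ?orbT.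
- by rewrite IH1 ?IH2 // => ab h; apply: H; rewrite mem_cat h ?orbT.
Qed.

Lemma dev_agree e z vt vx vu vu' :
  (forall ab, ab \in occ e -> vu ab.1 ab.2 = vu' ab.1 ab.2) ->
  dev e z vt vx vu = dev e z vt vx vu'.
Proof.
elim: e => //= [g H|a b H|e1 IH1 e2 IH2 H|e1 IH1 e2 IH2 H].
- by rewrite (H (0, 0)%N) ?inE.
- by apply: (H (a, b)); rewrite inE.
- by rewrite IH1 ?IH2 // => ab h; apply: H; rewrite mem_cat h ?orbT.
- by rewrite IH1 ?IH2 // => ab h; apply: H; rewrite mem_cat h ?orbT.
Qed.

Definition delta (ab : nat * nat) : nat -> nat -> R :=
  fun a b => ((a == ab.1) && (b == ab.2))%:R.
Definition null : nat -> nat -> R := fun _ _ => 0.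

Lemma dev_delta0 e z ab : ab \notin occ e -> dev e z 0 0 (delta ab) = 0.
Proof.
case: ab => a0 b0.
elim: e => //= [g|a b|e1 IH1 e2 IH2|e1 IH1 e2 IH2].
- rewrite inE /delta /= => h.
  have -> : (0%N == a0) && (0%N == b0) = false.
    by apply/negP => /andP[/eqP e1 /eqP e2]; rewrite -e1 -e2 eqxx in h.
  exact: lin_form000.
- rewrite inE /delta /= => h.
  have -> // : (a == a0) && (b == b0) = false.
    by apply/negP => /andP[/eqP e1 /eqP e2]; rewrite -e1 -e2 eqxx in h.
- by rewrite mem_cat negb_or => /andP[/IH1 -> /IH2 ->]; rewrite addr0.
- by rewrite mem_cat negb_or => /andP[/IH1 -> /IH2 ->]; rewrite !mulr0 addr0.
Qed.

Lemma sum_delta (s : seq (nat * nat)) (v : nat -> nat -> R) a b : uniq s -> (a, b) \in s ->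
  \sum_(ab <- s) v ab.1 ab.2 * delta ab a b = v a b.
Proof.
move=> us ain; rewrite (bigD1_seq (a, b)) //= /delta /= !eqxx mulr1 big1_seq ?addr0 //.
move=> [a' b'] /andP[h _] /=.
have -> : (a == a') && (b == b') = false.
  by apply/negP => /andP[/eqP e1 /eqP e2]; rewrite e1 e2 eqxx in h.
by rewrite mulr0.
Qed.

(** The differential is linear in the tangent vector. The coefficients on the right are the partial
    derivatives of [ev e], so this matches [dev] with the sums in the total derivatives. *)
Lemma dev_decomp e z vt vx vu (s : seq (nat * nat)) : uniq s -> {subset occ e <= s} ->
  dev e z vt vx vu = vt * dev e z 1 0 null + vx * dev e z 0 1 null +
    \sum_(ab <- s) vu ab.1 ab.2 * dev e z 0 0 (delta ab).
Proof.
move=> us; elim: e => [g|a b|e1 IH1 e2 IH2|e1 IH1 e2 IH2] sub.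
- have S : (0, 0)%N \in s by apply: sub; rewrite inE.
  have -> : \sum_(ab <- s) vu ab.1 ab.2 * dev (DB g) z 0 0 (delta ab) =
     'D_ex3 g (base z) * vu 0%N 0%N.
    rewrite -(sum_delta vu us S) mulr_sumr; apply: eq_bigr => ab _ /=.
    by rewrite lin_form00 mulrCA.
  rewrite /= /null.
  have H (A B C D : R) : A * vt + B * vx + D =
     vt * (A * 1 + B * 0 + C * 0) + vx * (A * 0 + B * 1 + C * 0) + D by ring.
  exact: H.
- rewrite /= /null !mulr0 !add0r sum_delta //.
  by apply: sub; rewrite inE.
- rewrite /= IH1 ?IH2 => [|ab h|ab h]; try by apply: sub; rewrite mem_cat h ?orbT.
  under [in RHS]eq_bigr do rewrite mulrDr.
  rewrite big_split /=; ring.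
- rewrite /= IH1 ?IH2 => [|ab h|ab h]; try by apply: sub; rewrite mem_cat h ?orbT.
  under [in RHS]eq_bigr do rewrite mulrDr mulrCA (mulrCA _ (ev e2 z)).
  rewrite big_split /= -!mulr_sumr; ring.
Qed.

(** The chain rule along an arbitrary family of jets. It yields the partial derivatives when one
    coordinate moves, the derivatives along the jet of a function, and those along the section
    [sigma0]. *)
Lemma ev_chain (V : normedModType R) (W : set R3) e (p v : V) (ct cx : V -> R)
    (cu : V -> nat -> nat -> R) vt vx vu :
  wf W e -> W (ct p, cx p, cu p 0%N 0%N) ->
  is_derive p v ct vt -> is_derive p v cx vx ->
  is_derive p v (fun q => cu q 0%N 0%N) (vu 0%N 0%N) ->
  (forall ab, ab \in occ e -> is_derive p v (fun q => cu q ab.1 ab.2) (vu ab.1 ab.2)) ->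
  is_derive p v (fun q => ev e ((ct q, cx q), cu q)) (dev e ((ct p, cx p), cu p) vt vx vu).
Proof.
move=> we Wp dt dx d0; elim: e we => [g gs _|a b _ H|e1 IH1 e2 IH2 [w1 w2] H|e1 IH1 e2 IH2 [w1 w2] H].
- by apply: is_derive_comp3 => //; apply: (smooth_diff gs).
- by apply: (H (a, b)); rewrite inE.
- by apply: is_deriveD; [apply: IH1|apply: IH2] => // ab h; apply: H; rewrite mem_cat h ?orbT.
- by apply: is_deriveM; [apply: IH1|apply: IH2] => // ab h; apply: H; rewrite mem_cat h ?orbT.
Qed.

Lemma derive1_val (f : R -> R) (x l : R) : is_derive x 1 f l -> derive1 f x = l.
Proof. by move=> [_ <-]; exact: derive1E. Qed.

Lemma pd_t_ev W e z : wf W e -> W (base z) -> pd_t (ev e) z = dev e z 1 0 null.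
Proof.
case: z => [[t x] j] we Wz; apply: derive1_val.
by apply: (@ev_chain R W e t 1 id (fun=> x) (fun=> j)) => //;
  first [exact: is_derive_id | move=> *; exact: is_derive_cst].
Qed.

Lemma pd_x_ev W e z : wf W e -> W (base z) -> pd_x (ev e) z = dev e z 0 1 null.
Proof.
case: z => [[t x] j] we Wz; apply: derive1_val.
by apply: (@ev_chain R W e x 1 (fun=> t) id (fun=> j)) => //;
  first [exact: is_derive_id | move=> *; exact: is_derive_cst].
Qed.

Lemma upd_id (j : nat -> nat -> R) a b : upd j a b (j a b) = j.
Proof.
apply/funext => a'; apply/funext => b'; rewrite /upd.
by case: ifP => // /andP[/eqP -> /eqP ->].
Qed.

Lemma is_derive_upd (j : nat -> nat -> R) a b a' b' (s : R) :
  is_derive s 1 (fun s => upd j a b s a' b') (delta (a, b) a' b').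
Proof.
rewrite /upd /delta /=; case: ((a' == a) && (b' == b)); first exact: is_derive_id.
exact: is_derive_cst.
Qed.

Lemma pd_u_ev W e z a b : wf W e -> W (base z) -> pd_u a b (ev e) z = dev e z 0 0 (delta (a, b)).
Proof.
case: z => [[t x] j] we Wz; apply: derive1_val => /=.
have := @ev_chain R W e (j a b) 1 (fun=> t) (fun=> x) (fun s => upd j a b s) 0 0 (delta (a, b)) we.
rewrite upd_id; apply=> //; try exact: is_derive_cst.
  exact: is_derive_upd.
by move=> ab _; exact: is_derive_upd.
Qed.

Lemma Dx_ev W e z : wf W e -> W (base z) -> Dx (ev e) z = ev (dtotx e) z.
Proof.
move=> we Wz; rewrite /Dx (pd_x_ev we Wz) ev_dtotx.
have H0 ab : [set: nat * nat] ab -> ab \notin undup (occ e) ->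
    z.2 ab.1 ab.2.+1 * pd_u ab.1 ab.2 (ev e) z = 0.
  case: ab => a b _; rewrite mem_undup => h /=.
  by rewrite (pd_u_ev _ _ we Wz) dev_delta0 ?mulr0.
rewrite (fsbigE _ _ (undup_uniq _) (@subsetT _ _) H0).
have sub : {subset occ e <= undup (occ e)} by move=> ab; rewrite mem_undup.
rewrite (dev_decomp z 0 1 (fun a b => z.2 a b.+1) (undup_uniq _) sub) mul0r add0r mul1r.
congr (_ + _); rewrite big_mkcond; apply: eq_bigr => ab _.
by rewrite in_setT (pd_u_ev _ _ we Wz); case: ab.
Qed.

Lemma Dt_ev W e z : wf W e -> W (base z) -> Dt (ev e) z = ev (dtott e) z.
Proof.
move=> we Wz; rewrite /Dt (pd_t_ev we Wz) ev_dtott.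
have H0 ab : [set: nat * nat] ab -> ab \notin undup (occ e) ->
    z.2 ab.1.+1 ab.2 * pd_u ab.1 ab.2 (ev e) z = 0.
  case: ab => a b _; rewrite mem_undup => h /=.
  by rewrite (pd_u_ev _ _ we Wz) dev_delta0 ?mulr0.
rewrite (fsbigE _ _ (undup_uniq _) (@subsetT _ _) H0).
have sub : {subset occ e <= undup (occ e)} by move=> ab; rewrite mem_undup.
rewrite (dev_decomp z 1 0 (fun a b => z.2 a.+1 b) (undup_uniq _) sub) mul0r addr0 mul1r.
congr (_ + _); rewrite big_mkcond; apply: eq_bigr => ab _.
by rewrite in_setT (pd_u_ev _ _ we Wz); case: ab.
Qed.

Lemma near_eq_derive1 (f g : R -> R) (x : R) :
  (\forall s \near x, f s = g s) -> derive1 f x = derive1 g x.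
Proof. by move=> H; rewrite !derive1E; exact: near_eq_derive. Qed.

Section Congruence.
Variables (W : set R3) (F F' : dfun R) (z : jetpt R).
Hypotheses (oW : open W) (Wz : W (base z)) (E : forall z, W (base z) -> F z = F' z).

(** Moving one jet coordinate a little keeps the base point in the open set W, so agreement over W
    is enough to equate derivatives. The same holds for the other partial derivatives, hence for
    [Dx] and [Dt], which can then be iterated. *)
Lemma pd_t_eq : pd_t F z = pd_t F' z.
Proof.
apply: near_eq_derive1.
have c : {for z.1.1, continuous (fun s : R => (s, z.1.2, z.2 0%N 0%N))}.
  by apply: cont_pair; [apply: cont_pair; [exact: cvg_id|exact: cst_continuous]|exact: cst_continuous].
have : \forall s \near z.1.1, W (s, z.1.2, z.2 0%N 0%N).
  apply: (c _ (open_near oW _)); rewrite -surjective_pairing; exact: Wz.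
by apply: filterS => s Ws; apply: E.
Qed.

Lemma pd_x_eq : pd_x F z = pd_x F' z.
Proof.
apply: near_eq_derive1.
have c : {for z.1.2, continuous (fun s : R => (z.1.1, s, z.2 0%N 0%N))}.
  by apply: cont_pair; [apply: cont_pair; [exact: cst_continuous|exact: cvg_id]|exact: cst_continuous].
have : \forall s \near z.1.2, W (z.1.1, s, z.2 0%N 0%N).
  apply: (c _ (open_near oW _)); rewrite -surjective_pairing; exact: Wz.
by apply: filterS => s Ws; apply: E.
Qed.

Lemma pd_u_eq a b : pd_u a b F z = pd_u a b F' z.
Proof.
apply: near_eq_derive1.
have c : {for z.2 a b, continuous (fun s : R => (z.1, upd z.2 a b s 0%N 0%N))}.
  apply: cont_pair; first exact: cst_continuous.
  by rewrite /upd; case: ((0%N == a) && (0%N == b)); [exact: cvg_id|exact: cst_continuous].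
have : \forall s \near z.2 a b, W (z.1, upd z.2 a b s 0%N 0%N).
  by apply: (c _ (open_near oW _)); rewrite upd_id.
by apply: filterS => s Ws; apply: E.
Qed.

Lemma Dx_eq : Dx F z = Dx F' z.
Proof.
rewrite /Dx pd_x_eq; congr (_ + _); apply: eq_fsbigr => ab _.
by rewrite pd_u_eq.
Qed.

Lemma Dt_eq : Dt F z = Dt F' z.
Proof.
rewrite /Dt pd_t_eq; congr (_ + _); apply: eq_fsbigr => ab _.
by rewrite pd_u_eq.
Qed.

End Congruence.

Lemma iter_Dx_ev W F e b z : open W -> wf W e -> (forall z, W (base z) -> F z = ev e z) ->
  W (base z) -> iter b Dx F z = ev (iter b dtotx e) z.
Proof.
move=> oW we E Wz; elim: b z Wz => [|b IH] z Wz; first exact: E.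
rewrite !iterS (Dx_eq oW Wz IH); apply: (Dx_ev (W := W)) => //.
by elim: b {IH} => //= b; exact: wf_dtotx.
Qed.

Lemma iter_Dt_ev W F e a z : open W -> wf W e -> (forall z, W (base z) -> F z = ev e z) ->
  W (base z) -> iter a Dt F z = ev (iter a dtott e) z.
Proof.
move=> oW we E Wz; elim: a z Wz => [|a IH] z Wz; first exact: E.
rewrite !iterS (Dt_eq oW Wz IH); apply: (Dt_ev (W := W)) => //.
by elim: a {IH} => //= a; exact: wf_dtott.
Qed.

End DifferentialPolynomials.

Section FiniteComposition.
Context {R : realType} {V V' : normedModType R}.

Lemma differentiable_sumZ n (h : 'I_n -> V -> R) (w : 'I_n -> V') (p : V) :
  (forall i, differentiable (h i) p) ->
  differentiable (fun q => \sum_(i < n) h i q *: w i) p.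
Proof.
move=> dh; rewrite -[X in differentiable X _](_ : \sum_(i < n) (fun q => h i q *: w i) = _).
  by apply: differentiable_sum => i; exact: differentiableZl.
by apply/funext => q; rewrite fct_sumE.
Qed.

Lemma is_derive_sumZ n (h : 'I_n -> V -> R) (w : 'I_n -> V') (p v : V) (l : 'I_n -> R) :
  (forall i, differentiable (h i) p) -> (forall i, 'D_v (h i) p = l i) ->
  is_derive p v (fun q => \sum_(i < n) h i q *: w i) (\sum_(i < n) l i *: w i).
Proof.
move=> dh dl; rewrite -[X in is_derive _ _ X](_ : \sum_(i < n) (fun q => h i q *: w i) = _).
  apply: is_derive_sum => i; split; first exact/diff_derivable/differentiableZl.
  by rewrite deriveE ?diffZl -?deriveE ?dl //; exact: differentiableZl.
by apply/funext => q; rewrite fct_sumE.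
Qed.

Lemma is_derive_comp_sumZ (g : V' -> R) n (h : 'I_n -> V -> R) (w : 'I_n -> V') (p v : V)
    (l : 'I_n -> R) :
  (forall i, differentiable (h i) p) -> (forall i, 'D_v (h i) p = l i) ->
  differentiable g (\sum_(i < n) h i p *: w i) ->
  is_derive p v (fun q => g (\sum_(i < n) h i q *: w i))
    (\sum_(i < n) l i * 'D_(w i) g (\sum_(i < n) h i p *: w i)).
Proof.
move=> dh dl dg; apply: (is_derive_eq (is_derive_comp (is_derive_sumZ w dh dl) dg)).
by rewrite derive_sumv //; apply: eq_bigr => i _; rewrite derive_scaled.
Qed.

End FiniteComposition.

(** * The vector field X = d_x + zeta d_u and its action on H *)

Section VectorFields.
Context {R : realType}.
Notation R3 := (R * R * R)%type.

Definition vfield (e : R3) (c h : R3 -> R) : R3 -> R :=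
  fun p => 'D_e h p + c p * 'D_ex3 h p.

Lemma Ck_vfield k W e c h : open W -> smooth_on W c -> smooth_on W h -> Ck k W (vfield e c h).
Proof.
move=> oW cs hs; apply: (Ck_add oW); first exact: (smooth_derive e hs).
by apply: (Ck_mul oW); [exact: cs|exact: (smooth_derive ex3 hs)].
Qed.

Lemma vfield_dir e c h p : differentiable h p ->
  'D_(e + c p *: ex3) h p = vfield e c h p.
Proof. by move=> dh; rewrite derive_addv // derive_scaled. Qed.

(** The iteration starts at the coordinate u, with X u = zeta, so that the index k equals the order
    of the derivative u_k which this function replaces on the manifold of Q. *)
Definition xprol (zeta : R3 -> R) (k : nat) : R3 -> R := iter k (vfield ex2 zeta) (fun p => p.2).

Lemma smooth_xprol W zeta k : open W -> smooth_on W zeta -> smooth_on W (xprol zeta k).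
Proof.
move=> oW zs; elim: k => [|k IH] n; first exact: Ck_thd.
exact: Ck_vfield.
Qed.

Lemma xprol1 zeta p : xprol zeta 1%N p = zeta p.
Proof.
rewrite /xprol /= /vfield (is_derive_val (is_derive_thd3 p ex2)) (is_derive_val (is_derive_thd3 p ex3)).
by rewrite /ex2 /ex3 /= add0r mulr1.
Qed.

Variable r : nat.
Notation V := (R * R * 'rV[R]_r.+1)%type.

(** Numbers t, x, u_0, ..., u_r consecutively, so that H composed with a jet fits the form with one
    finite family of components used in [Ck_comp]. *)
Definition xjet_basis (i : nat) : V :=
  match i with
  | 0%N => (1, 0, 0)
  | 1%N => (0, 1, 0)
  | k.+2 => (0, 0, delta_mx 0 (inord k))
  end.

Definition xjet_coord (zeta : R3 -> R) (i : nat) : R3 -> R :=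
  match i with
  | 0%N => fun p => p.1.1
  | 1%N => fun p => p.1.2
  | k.+2 => xprol zeta k
  end.

Definition xjet_of (zeta : R3 -> R) (p : R3) : V :=
  ((p.1.1, p.1.2), \row_(k < r.+1) xprol zeta k p).

Lemma pair_sum (U U' : zmodType) n (f : 'I_n -> U) (g : 'I_n -> U') :
  \sum_(i < n) (f i, g i) = (\sum_(i < n) f i, \sum_(i < n) g i).
Proof. by elim/big_ind3: _ => // *; subst. Qed.

Lemma sum_xjet_basis (t x : R) (c : nat -> R) (v : V) : v = ((t, x), \row_(k < r.+1) c k) ->
  v = \sum_(i < r.+3) (match i : nat with 0%N => t | 1%N => x | k.+2 => c k end) *: xjet_basis i.
Proof.
move=> ->; rewrite big_ord_recl big_ord_recl /=.
have S (a y z : R) (m : 'rV[R]_r.+1) : a *: ((y, z, m) : V) = (a * y, a * z, a *: m) by [].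
have -> : \sum_(i < r.+1) c i *: ((0, 0, delta_mx 0 (inord i)) : V) =
   ((0, 0), \row_(k < r.+1) c k).
  have -> : \row_(k < r.+1) c k = \sum_(i < r.+1) c i *: delta_mx 0 i.
    by rewrite [LHS]row_sum_delta; apply: eq_bigr => i _; rewrite mxE.
  have E (i : 'I_r.+1) : c i *: ((0, 0, delta_mx 0 (inord i)) : V) = (0, 0, c i *: delta_mx 0 i).
    by rewrite inord_val S !mulr0.
  under eq_bigr do rewrite E.
  rewrite !pair_sum; congr (_, _, _); exact: big1.
rewrite !S !mulr0 !mulr1 !scaler0.
have A (a b a' b' : R) (m m' : 'rV[R]_r.+1) : ((a, b, m) : V) + (a', b', m') = (a + a', b + b', m + m') by [].
by rewrite !A !addr0 !add0r.
Qed.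

Lemma xjet_of_sum zeta p : xjet_of zeta p = \sum_(i < r.+3) xjet_coord zeta i p *: xjet_basis i.
Proof.
rewrite [LHS](sum_xjet_basis (c := fun k => xprol zeta k p) (erefl _)).
by apply: eq_bigr => [[[|[|k]] hk] _].
Qed.

Lemma smooth_xjet_coord W zeta i : open W -> smooth_on W zeta -> smooth_on W (xjet_coord zeta i).
Proof.
move=> oW zs; case: i => [|[|i]] k; [exact: Ck_fst|exact: Ck_snd|].
exact: smooth_xprol.
Qed.

Lemma Ck_xjet_comp (Om : set V) (H : V -> R) W zeta k : open W -> smooth_on W zeta ->
  smooth_on Om H -> (forall p, W p -> Om (xjet_of zeta p)) ->
  Ck k W (fun p => H (xjet_of zeta p)).
Proof.
move=> oW zs Hs HO.
apply: (Ck_comp (h := fun i : 'I_r.+3 => xjet_coord zeta i) (w := fun i => xjet_basis i) oW Hs _ _ HO).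
  by move=> i; exact: smooth_xjet_coord.
by move=> p _; exact: xjet_of_sum.
Qed.

(** X sends t to 0, x to 1 and each [xprol zeta k] to the next one. Up to the factor -xi, the result
    is what the prolonged operator does to the H part of the equation. *)
Lemma vfield_xjet_comp (H : V -> R) W zeta p : open W -> smooth_on W zeta -> W p ->
  differentiable H (xjet_of zeta p) ->
  vfield ex2 zeta (fun p => H (xjet_of zeta p)) p =
  'D_((0, 1, 0) : V) H (xjet_of zeta p) +
  \sum_(k < r.+1) xprol zeta k.+1 p * 'D_((0, 0, delta_mx 0 k) : V) H (xjet_of zeta p).
Proof.
move=> oW zs Wp dH.
have E : (fun p => H (xjet_of zeta p)) =
    (fun p => H (\sum_(i < r.+3) xjet_coord zeta i p *: xjet_basis i)).
  by apply/funext => q; rewrite -xjet_of_sum.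
have dc (i : 'I_r.+3) : differentiable (xjet_coord zeta i) p.
  by apply: smooth_diff Wp; exact: smooth_xjet_coord.
have dH' : differentiable H (\sum_(i < r.+3) xjet_coord zeta i p *: xjet_basis i).
  by rewrite -xjet_of_sum.
have dHx : differentiable (fun p => H (xjet_of zeta p)) p.
  rewrite E; apply: (@differentiable_comp _ _ _ _ (fun p => \sum_(i < r.+3) xjet_coord zeta i p *: xjet_basis i) H) => //.
  exact: differentiable_sumZ.
rewrite -vfield_dir // E.
rewrite (is_derive_val (is_derive_comp_sumZ (v := ex2 + zeta p *: ex3) dc (fun i => erefl _) dH')).
rewrite -xjet_of_sum big_ord_recl big_ord_recl /=.
have -> : 'D_(ex2 + zeta p *: ex3) (fun p : R3 => p.1.1) p = 0.
  rewrite (is_derive_val (is_derive_fst3 _ _)) /ex2 /ex3 /=; exact: etrans (add0r _) (mulr0 _).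
have -> : 'D_(ex2 + zeta p *: ex3) (fun p : R3 => p.1.2) p = 1.
  rewrite (is_derive_val (is_derive_snd3 _ _)) /ex2 /ex3 /=.
  by rewrite -[X in _ + X]/(zeta p * 0) mulr0 addr0.
rewrite mul0r add0r mul1r; congr (_ + _); apply: eq_bigr => i _.
rewrite inord_val; congr (_ * _); rewrite vfield_dir //.
by apply: smooth_diff Wp; exact: smooth_xprol.
Qed.

End VectorFields.

(** * The prolongation formula *)

Section OperatorManifold.
Context {R : realType}.
Notation R3 := (R * R * R)%type.
Variables (W : set R3) (Q : operator R).
Hypotheses (oW : open W) (xis : smooth_on W (xi Q)) (etas : smooth_on W (Defs.eta Q))
  (tau0 : forall p, W p -> tau Q p = 0) (xin0 : forall p, W p -> xi Q p != 0).
Implicit Types z : jetpt R.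

Definition zeta_of (p : R3) : R := Defs.eta Q p / xi Q p.

Lemma smooth_zeta_of : smooth_on W zeta_of.
Proof.
move=> k; apply: (Ck_mul oW); first exact: etas.
by apply: (Ck_inv oW); [exact: xin0|exact: xis].
Qed.

Lemma eta_zeta p : W p -> Defs.eta Q p = xi Q p * zeta_of p.
Proof. by move=> Wp; rewrite /zeta_of mulrC divfK // xin0. Qed.

(** [dexp] has no subtraction, so the sign is absorbed into a coefficient function. *)
Definition mxi : R3 -> R := fun p => - xi Q p.

Lemma smooth_mxi : smooth_on W mxi.
Proof. by move=> k; exact: Ck_opp. Qed.

(* D_x^b Q[u] = Rx b - xi u_{b+1}, where Rx b involves only u_0, ..., u_b. *)
Fixpoint Rx (b : nat) : dexp (R := R) :=
  match b with
  | 0%N => DB (Defs.eta Q)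
  | b'.+1 => DAdd (dtotx (Rx b')) (DMul (DC 0 b) (dtotx (DB mxi)))
  end.

Definition Ex (b : nat) : dexp (R := R) := DAdd (Rx b) (DMul (DB mxi) (DC 0 b.+1)).

Lemma wf_Rx b : wf W (Rx b).
Proof.
elim: b => [|b IH] //=; split; first exact: wf_dtotx.
by split=> //; split; [|split=> //]; apply: smooth_derive; exact: smooth_mxi.
Qed.

Lemma wf_Ex b : wf W (Ex b).
Proof. by split; [exact: wf_Rx|split=> //; exact: smooth_mxi]. Qed.

Lemma occ_dtotx (e : dexp (R := R)) n : (forall ab, ab \in occ e -> ab.1 = 0 /\ ab.2 <= n)%N ->
  (forall ab, ab \in occ (dtotx e) -> ab.1 = 0 /\ ab.2 <= n.+1)%N.
Proof.
elim: e => /= [g H|a b H|e1 IH1 e2 IH2 H|e1 IH1 e2 IH2 H] ab.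
- by rewrite !inE => /or3P[]/eqP -> //.
- by rewrite inE => /eqP -> /=; have := H (a, b); rewrite inE eqxx => /(_ isT).
- by rewrite mem_cat => /orP[/IH1|/IH2]; apply=> ab' h; apply: H; rewrite mem_cat h ?orbT.
- rewrite !mem_cat -!orbA => /or4P[h|/IH2 h|h|/IH1 h].
  + by have [|-> h'] := H ab; [rewrite mem_cat h|split=> //; apply: leq_trans h' _].
  + by apply: h => ab' h; apply: H; rewrite mem_cat h orbT.
  + by have [|-> h'] := H ab; [rewrite mem_cat h orbT|split=> //; apply: leq_trans h' _].
  + by apply: h => ab' h; apply: H; rewrite mem_cat h.
Qed.

Lemma occ_Rx b ab : ab \in occ (Rx b) -> (ab.1 = 0 /\ ab.2 <= b)%N.
Proof.
elim: b ab => [|b IH] ab; first by rewrite /= inE => /eqP ->.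
rewrite [occ _]/= mem_cat => /orP[|]; first exact: occ_dtotx.
by rewrite !inE => /or4P[]/eqP ->.
Qed.

Lemma Qchar_Ex z : W (base z) -> Qchar Q z = ev (Ex 0) z.
Proof. by move=> Wz; rewrite /Qchar tau0 // mul0r subr0 /= /mxi mulNr. Qed.

Lemma iter_Dx_Qchar b z : W (base z) -> iter b Dx (Qchar Q) z = ev (Ex b) z.
Proof.
elim: b z => [|b IH] z Wz; first exact: Qchar_Ex.
rewrite iterS (Dx_eq oW Wz IH) (Dx_ev (wf_Ex b) Wz) /= /mxi.
set A := ev (dtotx _) _.
by rewrite -addrA [X in _ + X = _]addrC addrA.
Qed.

(** A section of the jet space over (t, x, u) on which every D_x^b Q[u] vanishes. The coordinates
    with t-derivatives get the filler 0. *)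
Definition sigma0 (p : R3) : nat -> nat -> R :=
  fun a b => if a is 0%N then xprol zeta_of b p else 0.

Definition mkjet (s : R3 -> nat -> nat -> R) (p : R3) : jetpt R := ((p.1.1, p.1.2), s p).

Lemma base_sigma0 p : base (mkjet sigma0 p) = p.
Proof. by rewrite /base /= -q_eta. Qed.

(** The direction v = d_x + zeta d_u carries each coordinate u_k of [sigma0] to u_(k+1), so D_x at a
    point of the section is the derivative of the restriction to the section. That restriction is
    zero near p by induction. *)
Lemma Ex_sigma0 b p : W p -> ev (Ex b) (mkjet sigma0 p) = 0.
Proof.
elim: b p => [|b IH] p Wp.
  rewrite -Qchar_Ex ?base_sigma0 // /Qchar base_sigma0 tau0 // mul0r subr0.
  by rewrite -[(mkjet _ _).2 _ _]/(xprol zeta_of 1%N p) xprol1 eta_zeta // subrr.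
have Wb : W (base (mkjet sigma0 p)) by rewrite base_sigma0.
rewrite -iter_Dx_Qchar // iterS (Dx_eq (F' := ev (Ex b)) oW Wb); last first.
  by move=> z Wz; exact: iter_Dx_Qchar.
rewrite (Dx_ev (wf_Ex b) Wb) ev_dtotx.
pose v : R3 := ex2 + zeta_of p *: ex3.
have dsg k : is_derive p v (fun q => sigma0 q 0%N k) (sigma0 p 0%N k.+1).
  have dk : differentiable (xprol zeta_of k) p.
    by apply: smooth_diff Wp; apply: smooth_xprol => //; exact: smooth_zeta_of.
  by apply: (is_derive_eq (differentiable_is_derive v dk)); rewrite vfield_dir.
have D := @ev_chain R R3 W (Ex b) p v (fun q => q.1.1) (fun q => q.1.2) sigma0 0 1
   (fun a b => sigma0 p a b.+1) (wf_Ex b).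
have {}D : is_derive p v (fun q => ev (Ex b) (mkjet sigma0 q))
    (dev (Ex b) (mkjet sigma0 p) 0 1 (fun a b => sigma0 p a b.+1)).
  apply: D => //.
  - apply: (is_derive_eq (is_derive_fst3 _ _)); rewrite /v /ex2 /ex3 /=.
    exact: etrans (add0r _) (mulr0 _).
  - apply: (is_derive_eq (is_derive_snd3 _ _)); rewrite /v /ex2 /ex3 /=.
    by rewrite -[X in _ + X]/(zeta_of p * 0) mulr0 addr0.
  - move=> [a b'] /=; rewrite mem_cat => /orP[/occ_Rx [/= -> _]|]; first exact: dsg.
    by rewrite !inE => /orP[]/eqP [-> ->]; exact: dsg.
rewrite -(is_derive_val D).
have E : \forall q \near p, ev (Ex b) (mkjet sigma0 q) = cst 0 q.
  by apply: filterS (open_near oW Wp) => q Wq; rewrite IH.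
by rewrite (near_eq_derive _ E) derive_cst.
Qed.

(** [Rx b] involves only u_0, ..., u_b, so z may be replaced by the point of [sigma0] over the same
    base, where D_x^b Q[u] = 0 gives the value. *)
Lemma ev_Rx b z : W (base z) -> (forall j, (j <= b)%N -> z.2 0%N j = xprol zeta_of j (base z)) ->
  ev (Rx b) z = xi Q (base z) * xprol zeta_of b.+1 (base z).
Proof.
move=> Wz H; have E := Ex_sigma0 b Wz.
have -> : ev (Rx b) z = ev (Rx b) (mkjet sigma0 (base z)).
  apply: ev_agree; first by rewrite /= -surjective_pairing.
    by rewrite base_sigma0.
  by move=> [a b'] /occ_Rx /= [-> h]; rewrite H.
by move: E; rewrite /= base_sigma0 /mxi mulNr => /eqP; rewrite subr_eq0 => /eqP.
Qed.

(** The equations are triangular: D_x^k Q[u] = 0 is affine in u_(k+1) with coefficient -xi, which is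
    nonzero. The orders k < r thus determine the derivatives up to u_r. *)
Lemma Q_manifold_xprol r z k : W (base z) -> Q_manifold r Q z -> (k <= r)%N ->
  z.2 0%N k = xprol zeta_of k (base z).
Proof.
move=> Wz Qz; elim/ltn_ind: k => [[|k]] IH kr //.
have := Qz 0%N k kr; rewrite /= iter_Dx_Qchar //= ev_Rx //; last first.
  by move=> j jk; apply: IH => //; apply: leq_trans kr; exact: leqW.
rewrite /mxi mulNr => /eqP; rewrite subr_eq0 => /eqP /(mulfI (xin0 Wz)) E.
exact: esym E.
Qed.

(** The term xi u_(k+1) cancels and leaves [Rx k]. Thus k = r is allowed, although the manifold does
    not determine u_(r+1). *)
Lemma prol_coef_x r z k : W (base z) -> Q_manifold r Q z -> (k <= r)%N ->
  prol_coef Q 0 k z = xi Q (base z) * xprol zeta_of k.+1 (base z).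
Proof.
move=> Wz Qz kr; rewrite /prol_coef /= iter_Dx_Qchar // tau0 // mul0r addr0 /= ev_Rx //.
  by rewrite /mxi mulNr subrK.
by move=> j jk; apply: (Q_manifold_xprol Wz Qz); exact: leq_trans kr.
Qed.

Lemma eta_zeta_derive p v : W p ->
  'D_v (Defs.eta Q) p = xi Q p * 'D_v zeta_of p + zeta_of p * 'D_v (xi Q) p.
Proof.
move=> Wp; rewrite (derive_eq_on v oW Wp eta_zeta).
apply: deriveM; apply/diff_derivable; [exact: smooth_diff xis Wp|exact: smooth_diff smooth_zeta_of Wp].
Qed.

Lemma mxi_derive p v : W p -> 'D_v mxi p = - 'D_v (xi Q) p.
Proof. by move=> Wp; apply: deriveN; exact/diff_derivable/(smooth_diff xis Wp). Qed.

Lemma prol_coef_t_algebra (x z xt xu zt zu y w : R) :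
  x * zt + z * xt + (x * zu + z * xu) * y + (- x * w + z * (- xt + - xu * y)) + 0 + x * w =
  x * (zt + y * zu).
Proof. ring. Qed.

(** With eta = xi zeta and u_x = zeta the derivatives of xi cancel; u_tx cancels through the last
    summand of [prol_coef]. *)
Lemma prol_coef_t z : W (base z) -> z.2 0%N 1%N = zeta_of (base z) ->
  prol_coef Q 1 0 z = xi Q (base z) *
    ('D_ex1 zeta_of (base z) + z.2 1%N 0%N * 'D_ex3 zeta_of (base z)).
Proof.
move=> Wz Hz; rewrite /prol_coef tau0 // mul0r.
have -> : iter 1 Dt (iter 0 Dx (Qchar Q)) z = ev (dtott (Ex 0)) z.
  rewrite /= (Dt_eq (F' := ev (Ex 0)) oW Wz); last by move=> z' Wz'; exact: Qchar_Ex.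
  exact: Dt_ev (wf_Ex 0) Wz.
rewrite [ev _ _]/= Hz !mxi_derive // !eta_zeta_derive //.
exact: prol_coef_t_algebra.
Qed.

End OperatorManifold.

(** * The prolonged operator applied to u_t - H *)

Section ProlongationFormula.
Context {R : realType}.
Notation R3 := (R * R * R)%type.
Variable r : nat.
Notation V := (R * R * 'rV[R]_r.+1)%type.
Variables (Om : set V) (H : V -> R).
Hypotheses (Om_open : open Om) (H_smooth : smooth_on Om H).
Implicit Types z : jetpt R.

Let dH w : Om w -> differentiable H w.
Proof. exact: smooth_diff. Qed.

Lemma addV (a b a' b' : R) (m m' : 'rV[R]_r.+1) :
  ((a, b, m) : V) + (a', b', m') = (a + a', b + b', m + m').
Proof. by []. Qed.

Lemma scaleV (a y x : R) (m : 'rV[R]_r.+1) : a *: ((y, x, m) : V) = (a * y, a * x, a *: m).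
Proof. by []. Qed.

Lemma derive1_line (w v : V) (s c : R) (F : R -> V) : Om (w + s *: v) ->
  (forall h, F h = w + h *: v) ->
  derive1 (fun h => c - H (F h)) s = - 'D_v H (w + s *: v).
Proof.
move=> Ow EF; apply: derive1_val.
have -> : (fun h => c - H (F h)) = cst c \- (fun h => H (w + h *: v)).
  by apply/funext => h; rewrite /= EF.
have h2 : is_derive s 1 (fun h : R => H (w + h *: v)) ('D_v H (w + s *: v)).
  by apply/is_derive_line/differentiable_is_derive/dH.
by apply: (is_derive_eq (is_deriveB (is_derive_cst c s (1 : R)) h2)); rewrite sub0r.
Qed.

Lemma pd_x_Lfun z : Om (xjet r z) ->
  pd_x (Defs.Lfun H) z = - 'D_((0, 1, 0) : V) H (xjet r z).
Proof.
case: z => [[t x] j]; rewrite /pd_x /Defs.Lfun /xjet /= => Oz.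
have E (h : R) : ((t, h, \row_k j 0%N k) : V) = (t, 0, \row_k j 0%N k) + h *: (0, 1, 0).
  by rewrite scaleV addV mulr0 mulr1 scaler0 !addr0 add0r.
by rewrite (@derive1_line (t, 0, \row_k j 0%N k) (0, 1, 0) x _ (fun h => (t, h, \row_k j 0%N k))) -?E.
Qed.

Lemma pd_u_Lfun10 z : pd_u 1 0 (Defs.Lfun H) z = 1.
Proof.
case: z => [[t x] j]; rewrite /pd_u; apply: derive1_val => /=.
rewrite -[X in is_derive _ _ _ X]subr0.
apply: (@is_deriveB _ _ _ (fun s => s) (fun s => H (xjet r (t, x, upd j 1 0 s)))).
have -> : (fun s => H (xjet r (t, x, upd j 1 0 s))) = cst (H (xjet r (t, x, j))).
  by apply/funext => s; rewrite /xjet /upd.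
exact: is_derive_cst.
Qed.

Lemma pd_u_Lfun0k z (k : 'I_r.+1) : Om (xjet r z) ->
  pd_u 0 k (Defs.Lfun H) z = - 'D_((0, 0, delta_mx 0 k) : V) H (xjet r z).
Proof.
case: z => [[t x] j] Oz; rewrite /pd_u /=.
pose w : V := (t, x, \row_(i < r.+1) if i == k then 0 else j 0%N i).
have E (s : R) : xjet r (t, x, upd j 0 k s) = w + s *: (0, 0, delta_mx 0 k).
  rewrite scaleV addV !mulr0 !addr0; congr (_, _); apply/rowP => i; rewrite !mxE /upd /=.
  rewrite (val_eqE i k); case: (i == k); first by rewrite mulr1 add0r.
  by rewrite mulr0 addr0.
have E0 : xjet r (t, x, j) = w + j 0%N k *: (0, 0, delta_mx 0 k) by rewrite -E upd_id.
rewrite E0 in Oz *.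
have -> : (fun s => Defs.Lfun H (t, x, upd j 0 k s)) = (fun s => j 1%N 0%N - H (xjet r (t, x, upd j 0 k s))).
  by apply/funext => s; rewrite /Defs.Lfun /upd.
exact: derive1_line.
Qed.

Lemma pd_u_Lfun_other z a b : (a, b) != (1, 0)%N -> ~~ ((a == 0) && (b <= r))%N ->
  pd_u a b (Defs.Lfun H) z = 0.
Proof.
case: z => [[t x] j] h1 h2; rewrite /pd_u /=.
have -> : (fun s => Defs.Lfun H (t, x, upd j a b s)) = cst (Defs.Lfun H (t, x, j)).
  apply/funext => s; rewrite /Defs.Lfun /=; congr (_ - H _).
    rewrite /upd; case: ifP => // /andP[/eqP e1 /eqP e2].
    by rewrite -e1 -e2 eqxx in h1.
  rewrite /xjet /=; congr (_, _); apply/rowP => i; rewrite !mxE /upd.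
  case: ifP => // /andP[/eqP e1 /eqP e2].
  by move: h2; rewrite -e1 -e2 eqxx /= -ltnS ltn_ord.
by rewrite derive1_cst.
Qed.

Variables (W : set R3) (Q : operator R).
Hypotheses (hr : (1 < r)%N) (oW : open W) (xis : smooth_on W (xi Q)) (etas : smooth_on W (Defs.eta Q))
  (tau0 : forall p, W p -> tau Q p = 0) (xin0 : forall p, W p -> xi Q p != 0).
Let zeta := zeta_of Q.

Lemma xjet_Q_manifold z : W (base z) -> Q_manifold r Q z -> xjet r z = xjet_of r zeta (base z).
Proof.
move=> Wz Qz; rewrite /xjet /xjet_of /=; congr (_, _); first exact: surjective_pairing.
apply/rowP => i; rewrite !mxE.
by apply: (Q_manifold_xprol oW xis etas tau0 xin0 Wz Qz); rewrite -ltnS ltn_ord.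
Qed.

Definition rhs_of (c : R3 -> R) (p : R3) : R := H (xjet_of r c p).

Lemma prolongation_formula z : W (base z) -> (L_manifold Om H `&` Q_manifold r Q) z ->
  prolongation r Q (Defs.Lfun H) z = xi Q (base z) *
    ('D_ex1 zeta (base z) + rhs_of zeta (base z) * 'D_ex3 zeta (base z) -
     vfield ex2 zeta (rhs_of zeta) (base z)).
Proof.
move=> Wz [[Oz Lz] Qz].
have zs : smooth_on W zeta by apply: smooth_zeta_of.
have Ex := xjet_Q_manifold Wz Qz.
have z01 : z.2 0%N 1%N = zeta (base z).
  by rewrite (Q_manifold_xprol oW xis etas tau0 xin0 Wz Qz) ?xprol1 // ltnW.
have z10 : z.2 1%N 0%N = rhs_of zeta (base z).
  by apply/eqP; rewrite -subr_eq0 /rhs_of -Ex; apply/eqP.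
rewrite (@vfield_xjet_comp _ _ H W) //; last by apply: dH; rewrite -Ex.
rewrite /prolongation tau0 // mul0r add0r pd_x_Lfun //.
(* The coordinates u_t, u_0, ..., u_r on which the equation depends; all other terms of the
   prolongation vanish. The pair (1, 0) lies in the range of summation because r > 1. *)
pose s : seq (nat * nat) := (1, 0)%N :: [seq (0%N, k) | k <- iota 0 r.+1].
have us : uniq s.
  rewrite /s cons_uniq map_inj_uniq ?iota_uniq ?andbT; last by move=> i j [].
  by apply/negP => /mapP[k _].
rewrite -(@fsbig_widen _ _ _ _ [set` s]); last 2 first.
- move=> [a b] /=; rewrite inE => /predU1P[[-> ->]|/mapP[k]]; first by rewrite addn0 ltnW.
  by rewrite mem_iota add0n ltnS => /andP[_ kr] [-> ->].
- move=> [a b] /= [abr nab]; rewrite pd_u_Lfun_other ?mulr0 //.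
    by apply: contra_notN nab => /eqP ->; rewrite inE eqxx.
  apply: contra_notN nab => /andP[/eqP -> br]; rewrite inE; apply/orP; right.
  by apply/mapP; exists b => //; rewrite mem_iota add0n ltnS.
rewrite -fsbig_seq // big_cons big_map.
rewrite -[iota 0 r.+1]/(index_iota 0 r.+1) big_mkord -Ex.
rewrite [X in _ + (X + _)]/= pd_u_Lfun10 mulr1.
rewrite (prol_coef_t oW xis etas tau0 xin0 Wz z01) z10.
have -> : \sum_(i < r.+1) prol_coef Q 0 i z * pd_u 0 i (Defs.Lfun H) z =
  - (xi Q (base z) * \sum_(k < r.+1) xprol zeta k.+1 (base z) *
      'D_((0, 0, delta_mx 0 k) : V) H (xjet r z)).
  rewrite mulr_sumr -sumrN; apply: eq_bigr => i _.
  rewrite (prol_coef_x oW xis etas tau0 xin0 Wz Qz); last by rewrite -ltnS ltn_ord.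
  by rewrite pd_u_Lfun0k // mulrN mulrA.
move: (\sum_(_ < _) _) => S.
have A (x h y s1 : R) : x * - h + (x * y - x * s1) = x * (y - (h + s1)) by ring.
exact: A.
Qed.

End ProlongationFormula.

(** * Families of solutions and operators *)

Section Jets.
Context {R : realType}.
Notation R3 := (R * R * R)%type.
Notation R2 := (R * R)%type.
Implicit Types (u v : R2 -> R) (O : set R2) (W : set R3).

Lemma is_derive_fst2 (q v : R2) : is_derive q v (fun p : R2 => p.1) v.1.
Proof.
apply: is_derive_eps => e e0; exists 1 => // h _.
have -> : (q + h *: v).1 - q.1 - h * v.1 = q.1 + h * v.1 - q.1 - h * v.1 by [].
by rewrite (addrC q.1) addrK subrr normr0 mulr_ge0 // ltW.
Qed.

Lemma is_derive_snd2 (q v : R2) : is_derive q v (fun p : R2 => p.2) v.2.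
Proof.
apply: is_derive_eps => e e0; exists 1 => // h _.
have -> : (q + h *: v).2 - q.2 - h * v.2 = q.2 + h * v.2 - q.2 - h * v.2 by [].
by rewrite (addrC q.2) addrK subrr normr0 mulr_ge0 // ltW.
Qed.

Definition slice (k : R) (p : R2) : R3 := (p, k).

Lemma slice_derivable (k : R) (p w : R2) : is_derive p w (slice k) (w, 0).
Proof. exact: is_derive_pair. Qed.

Lemma slice_differentiable (k : R) (p : R2) : differentiable (slice k) p.
Proof. exact: differentiable_pair. Qed.

Lemma slice_continuous (k : R) : continuous (slice k).
Proof. by move=> p; exact/differentiable_continuous/slice_differentiable. Qed.

Lemma slice_open (N : set R3) (k : R) : open N -> open [set p : R2 | N (p, k)].
Proof. by move=> oN; apply: (@open_comp _ _ (slice k)) => // p _; exact: slice_continuous. Qed.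

Lemma slice_smooth (N : set R3) (f : R3 -> R) (k : R) : open N -> smooth_on N f ->
  smooth_on [set p : R2 | N (p, k)] (fun p => f (p, k)).
Proof.
move=> oN fs n.
apply: (Ck_precomp (phi := slice k) (L := fun w => (w, 0)) (slice_open oN) _ _ _ (fs n)) => //.
- by move=> p w _; exact: is_derive_val (slice_derivable k p w).
Qed.

Lemma slice_derive_val (f : R3 -> R) (p w : R2) (k : R) : differentiable f (p, k) ->
  'D_w (fun p => f (p, k)) p = 'D_(w, 0) f (p, k).
Proof. by move=> df; exact: is_derive_val (is_derive_comp (slice_derivable k p w) df). Qed.

Lemma cont_graph u p : {for p, continuous u} -> {for p, continuous (fun q => (q.1, q.2, u q))}.
Proof.
move=> cu; apply: cont_pair => //.
by apply: cont_pair; [exact: fst_cont|exact: snd_cont].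
Qed.

Lemma graph_open O W u : open O -> (forall p, O p -> {for p, continuous u}) -> open W ->
  open [set p | O p /\ W (p.1, p.2, u p)].
Proof.
move=> oO cu oW; rewrite openE => p [Op Wp].
have H : \forall q \near p, W (q.1, q.2, u q) by exact: (cont_graph (cu _ Op) (open_near oW Wp)).
exact: filterS2 (open_near oO Op) H.
Qed.

Lemma graph_derive (g : R3 -> R) u (p w : R2) l : is_derive p w u l ->
  differentiable g (p.1, p.2, u p) ->
  is_derive p w (fun q => g (q.1, q.2, u q))
   ('D_ex1 g (p.1, p.2, u p) * w.1 + 'D_ex2 g (p.1, p.2, u p) * w.2 + 'D_ex3 g (p.1, p.2, u p) * l).
Proof. by move=> du dg; apply: is_derive_comp3 => //; [exact: is_derive_fst2|exact: is_derive_snd2]. Qed.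

Lemma Ck_fst2 k O : open O -> Ck k O (fun p : R2 => p.1).
Proof.
move=> oO; apply: (@Ck_precomp _ _ R3 setT (fun q => q.1.1) k O (slice 0) (fun w => (w, 0))) => //.
- by move=> p w _; exact: is_derive_val (slice_derivable 0 p w).
- by apply: Ck_fst; exact: openT.
Qed.

Lemma Ck_snd2 k O : open O -> Ck k O (fun p : R2 => p.2).
Proof.
move=> oO; apply: (@Ck_precomp _ _ R3 setT (fun q => q.1.2) k O (slice 0) (fun w => (w, 0))) => //.
- by move=> p w _; exact: is_derive_val (slice_derivable 0 p w).
- by apply: Ck_snd; exact: openT.
Qed.

(** On the graph of u, where u_x = zeta, the x-derivative of a function of (t, x, u) is given by
    X. *)
Lemma xprol_jet O u W zeta k p : open O -> open W -> smooth_on W zeta ->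
  (forall p, O p -> differentiable u p) ->
  (forall p, O p -> W (p.1, p.2, u p)) ->
  (forall p, O p -> fun_dx u p = zeta (p.1, p.2, u p)) -> O p ->
  iter k fun_dx u p = xprol zeta k (p.1, p.2, u p).
Proof.
move=> oO oW zs du uW uz; elim: k p => [|k IH] p Op //.
rewrite iterS /fun_dx (derive_eq_on _ oO Op IH).
have dk : differentiable (xprol zeta k) (p.1, p.2, u p).
  by apply: smooth_diff (uW _ Op); exact: smooth_xprol.
have := graph_derive (differentiable_is_derive ((0, 1) : R2) (du _ Op)) dk.
move=> /is_derive_val ->.
rewrite -[X in _ + _ * X = _]/(fun_dx u p) uz //.
have A (a b c z : R) : a * 0 + b * 1 + c * z = b + z * c by rewrite mulr0 add0r mulr1 mulrC.
exact: A.
Qed.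

Lemma xjet_jet_of r O u W zeta p : open O -> open W -> smooth_on W zeta ->
  (forall p, O p -> differentiable u p) ->
  (forall p, O p -> W (p.1, p.2, u p)) ->
  (forall p, O p -> fun_dx u p = zeta (p.1, p.2, u p)) -> O p ->
  xjet r (jet_of u p) = xjet_of r zeta (p.1, p.2, u p).
Proof.
move=> oO oW zs du uW uz Op; rewrite /xjet /xjet_of /=; congr (_, _).
  exact: surjective_pairing.
by apply/rowP => i; rewrite !mxE /= (xprol_jet _ oO oW zs du uW uz).
Qed.

Lemma base_jet_of u p : base (jet_of u p) = (p.1, p.2, u p).
Proof. by rewrite /base /=; congr (_, _); exact: surjective_pairing. Qed.

Lemma jet_of_smooth O u a b : smooth_on O u -> smooth_on O (iter a fun_dt (iter b fun_dx u)).
Proof.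
move=> us; elim: a => [|a IH]; last exact: smooth_derive.
by elim: b => [|b IH] //; exact: smooth_derive.
Qed.

(** [jet_of] applies t-derivatives last, so an additional x-derivative has to be commuted past a of
    them. *)
Lemma jet_of_dx O u a b p : open O -> smooth_on O u -> O p ->
  fun_dx (iter a fun_dt (iter b fun_dx u)) p = iter a fun_dt (iter b.+1 fun_dx u) p.
Proof.
move=> oO us; elim: a p => [|a IH] p Op //.
rewrite iterS /fun_dx /fun_dt (derive_comm _ _ oO Op (jet_of_smooth a b us)).
exact: derive_eq_on oO Op IH.
Qed.

Lemma ev_jet_of W O u e : wf W e -> smooth_on O u -> (forall p, O p -> W (p.1, p.2, u p)) ->
  forall p (w : R2), O p ->
  'D_w (fun q => ev e (jet_of u q)) p = dev e (jet_of u p) w.1 w.2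
     (fun a b => 'D_w (iter a fun_dt (iter b fun_dx u)) p).
Proof.
move=> we us uW p w Op.
have D := @ev_chain R R2 W e p w fst snd (fun q a b => iter a fun_dt (iter b fun_dx u) q) w.1 w.2
  (fun a b => 'D_w (iter a fun_dt (iter b fun_dx u)) p) we (uW _ Op)
  (is_derive_fst2 p w) (is_derive_snd2 p w).
have E q : jet_of u q = ((q.1, q.2), fun a b => iter a fun_dt (iter b fun_dx u) q).
  by rewrite /jet_of -surjective_pairing.
rewrite E; under eq_fun do rewrite E; apply: is_derive_val; apply: D.
  by apply: differentiable_is_derive; apply: smooth_diff us Op.
move=> [a b] _; apply: differentiable_is_derive.
exact: smooth_diff (jet_of_smooth a b us) Op.
Qed.

(** On the jet of u a total derivative is the actual derivative of the restricted expression, and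
    the restriction is identically zero on the open set O. *)
Lemma ev_iter_dtotx W O u e b : wf W e -> open O -> smooth_on O u ->
  (forall p, O p -> W (p.1, p.2, u p)) ->
  (forall p, O p -> ev e (jet_of u p) = 0) ->
  forall p, O p -> ev (iter b dtotx e) (jet_of u p) = 0.
Proof.
move=> we oO us uW e0; elim: b => [|b IH] // p Op.
have wb : wf W (iter b dtotx e) by elim: b {IH} => //= b; exact: wf_dtotx.
rewrite iterS ev_dtotx.
have H := @ev_jet_of W O u (iter b dtotx e) wb us uW p ((0, 1) : R2) Op.
rewrite (derive_eq_on (g := fun=> 0) ((0, 1) : R2) oO Op IH) in H; rewrite derive_cst in H.
rewrite [RHS]H; apply: dev_agree => -[a' b'] _ /=.
exact: esym (jet_of_dx a' b' oO us Op).
Qed.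

Lemma ev_iter_dtott W O u e a : wf W e -> open O -> smooth_on O u ->
  (forall p, O p -> W (p.1, p.2, u p)) ->
  (forall p, O p -> ev e (jet_of u p) = 0) ->
  forall p, O p -> ev (iter a dtott e) (jet_of u p) = 0.
Proof.
move=> we oO us uW e0; elim: a => [|a IH] // p Op.
have wb : wf W (iter a dtott e) by elim: a {IH} => //= b; exact: wf_dtott.
rewrite iterS ev_dtott.
have H := @ev_jet_of W O u (iter a dtott e) wb us uW p ((1, 0) : R2) Op.
by rewrite (derive_eq_on (g := fun=> 0) ((1, 0) : R2) oO Op IH) derive_cst in H.
Qed.

(** Provides points of the full manifold, mixed derivatives included, for the nonvacuity clause when
    an operator is built from a family. *)
Lemma Q_manifold_jet_of W (Q : operator R) O u r : open W -> smooth_on W (xi Q) ->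
  smooth_on W (Defs.eta Q) -> (forall p, W p -> tau Q p = 0) ->
  open O -> smooth_on O u -> (forall p, O p -> W (p.1, p.2, u p)) ->
  invariant_on Q O u -> forall p, O p -> Q_manifold r Q (jet_of u p).
Proof.
move=> oW xis etas tau0 oO us uW inv p Op a b _.
have we := wf_Ex oW xis etas 0.
have wb : wf W (iter b dtotx (Ex Q 0)) by elim: b => //= b; exact: wf_dtotx.
have E0 q : O q -> ev (Ex Q 0) (jet_of u q) = 0.
  move=> Oq; have Wq : W (base (jet_of u q)) by rewrite base_jet_of; exact: uW.
  by rewrite -(Qchar_Ex tau0 Wq); exact: inv.
have Eb := ev_iter_dtotx b we oO us uW E0.
rewrite (iter_Dt_ev (e := iter b dtotx (Ex Q 0)) (W := W)) //.
- exact: ev_iter_dtott wb oO us uW Eb _ Op.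
- move=> z Wz; apply: (iter_Dx_ev (W := W)) => // z' Wz'; exact: (Qchar_Ex tau0 Wz').
- by rewrite base_jet_of; exact: uW.
Qed.

End Jets.

(** * First integrals *)

Section LocallyConstant.
Context {R : realType}.
Notation R3 := (R * R * R)%type.
Notation R2 := (R * R)%type.

(** Differentiating f(a, b, K) = g along e and cancelling the terms known to equal g' leaves the
    product of f_kappa and D_e K, which is thus zero. *)
Lemma first_integral_dir (V : normedModType R) (f : R3 -> R) (a b K g : V -> R) p e a' b' g' :
  is_derive p e a a' -> is_derive p e b b' -> differentiable K p -> is_derive p e g g' ->
  (\forall q \near p, f (a q, b q, K q) = g q) -> differentiable f (a p, b p, K p) ->
  'D_ex1 f (a p, b p, K p) * a' + 'D_ex2 f (a p, b p, K p) * b' = g' ->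
  'D_ex3 f (a p, b p, K p) != 0 -> 'D_e K p = 0.
Proof.
move=> da db dK dg E df H n0.
have D := is_derive_comp3 da db (differentiable_is_derive e dK) df.
have := is_derive_val D; rewrite (near_eq_derive _ E) (is_derive_val dg) -H.
move=> /eqP; rewrite -subr_eq0 opprD addrA subrr sub0r oppr_eq0 mulf_eq0 (negbTE n0) /=.
by move/eqP.
Qed.

Lemma const_on_ball (K : R2 -> R) (p1 : R2) (d : R) :
  (forall p, `|p - p1| < d -> [/\ differentiable K p, fun_dt K p = 0 & fun_dx K p = 0]) ->
  forall p, `|p - p1| < d -> K p = K p1.
Proof.
move=> H p hp; set e := p - p1.
have De q : `|q - p1| < d -> is_derive q e K 0.
  move=> /H [dK Kt Kx]; apply: (is_derive_eq (differentiable_is_derive e dK)).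
  have -> : e = e.1 *: ((1, 0) : R2) + e.2 *: (0, 1).
    case: e => [y z]; have S (k a b : R) : k *: ((a, b) : R2) = (k * a, k * b) by [].
    have A (a b a' b' : R) : ((a, b) : R2) + (a', b') = (a + a', b + b') by [].
    by rewrite !S !A !mulr0 !mulr1 addr0 add0r.
  rewrite derive_addv // !derive_scaled //.
  rewrite -[X in _ *: X + _]/(fun_dt K q) -[X in _ + _ *: X]/(fun_dx K q) Kt Kx.
  by rewrite !scaler0 addr0.
have := @derive0_eq R (fun h => K (p1 + h *: e)) 1 0.
have -> : p1 + 1 *: e = p by rewrite scale1r /e addrC subrK.
rewrite scale0r addr0; apply => h.
rewrite min_r // max_l // => /andP[h0 h1].
apply/is_derive_line/De; rewrite addrAC subrr add0r normrZ ger0_norm //.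
by apply: le_lt_trans hp; rewrite ler_piMl.
Qed.

End LocallyConstant.

Section SolutionsAndOperators.
Context {R : realType}.
Notation R3 := (R * R * R)%type.
Notation R2 := (R * R)%type.
Variables (r : nat) (Om : set (R * R * 'rV[R]_r.+1)) (H : R * R * 'rV[R]_r.+1 -> R).
Hypotheses (hr : (1 < r)%N) (Om_open : open Om) (H_smooth : smooth_on Om H).
Implicit Types (W : set R3) (Q : operator R) (F : function_family R).

(** What the reduction property amounts to by the prolongation formula: a smooth zeta = eta / xi
    with jets in the domain of H, satisfying the Frobenius compatibility condition. *)
Definition op_data W Q : Prop :=
  [/\ open W, smooth_on W (xi Q) & smooth_on W (Defs.eta Q)] /\
  [/\ (forall p, W p -> tau Q p = 0), (forall p, W p -> xi Q p != 0),
      (forall p, W p -> Om (xjet_of r (zeta_of Q) p)) &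
      (forall p, W p -> 'D_ex1 (zeta_of Q) p + rhs_of H (zeta_of Q) p * 'D_ex3 (zeta_of Q) p =
         vfield ex2 (zeta_of Q) (rhs_of H (zeta_of Q)) p)].

Lemma data_zeta W Q : op_data W Q -> smooth_on W (zeta_of Q).
Proof. by move=> [[oW xis etas] [tau0 xin0 _ _]]; exact: smooth_zeta_of. Qed.

Lemma data_rhs W Q : op_data W Q -> smooth_on W (rhs_of H (zeta_of Q)).
Proof.
move=> D; have zs := data_zeta D; have [[oW _ _] [_ _ HO _]] := D.
move=> k; have C := Ck_xjet_comp k oW zs H_smooth HO.
exact: C.
Qed.

Lemma reduction_data (p0 : R3) Q : reduction_operators0 Om H p0 Q ->
  exists2 W, W p0 & op_data W Q.
Proof.
move=> [[W1 W1p0 [oW1 [taus xis etas] nz ex red]] tau0].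
have [d d0 Hd] := near_box3 tau0.
pose W := W1 `&` box3 p0 d.
have oW : open W by apply: openI => //; exact: box3_open.
have Wt p : W p -> tau Q p = 0 by move=> [_ /Hd].
have Wx p : W p -> xi Q p != 0.
  move=> Wp; apply/eqP => x0; apply: (nz p Wp.1).
  by rewrite x0 (Wt _ Wp).
have sx : smooth_on W (xi Q) by move=> k; apply: Ck_subset (xis k) => p [].
have se : smooth_on W (Defs.eta Q) by move=> k; apply: Ck_subset (etas k) => p [].
exists W; first by split=> //; split; rewrite subrr normr0.
(* The nonvacuity clause supplies a jet z over p. On the manifold its x-part is determined by p, so
   both remaining claims become statements about z. *)
split=> //; split=> // p Wp; have [z [bz [Lz Qz]]] := ex p Wp.1.
  have Wz : W (base z) by rewrite bz.
  rewrite -bz -(xjet_Q_manifold oW sx se Wt Wx Wz Qz).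
  by have [] := Lz.
have Wz : W (base z) by rewrite bz.
have := prolongation_formula H_smooth hr oW sx se Wt Wx Wz (conj Lz Qz).
rewrite red ?bz; [|exact: Wp.1|by []].
move/esym/eqP; rewrite mulf_eq0 (negbTE (Wx _ Wp)) /= subr_eq0.
by move/eqP.
Qed.

Definition solves W (z g : R3 -> R) (N : set R3) (f : R3 -> R) : Prop :=
  [/\ open N, smooth_on N f, (forall q, N q -> W (q.1.1, q.1.2, f q)) &
   (forall q, N q -> 'D_ex1 f q = along g f q /\ 'D_ex2 f q = along z f q)].

Lemma invariant_solution W Q O v : op_data W Q -> solution_on Om H O v ->
  invariant_on Q O v -> (forall p, O p -> W (p.1, p.2, v p)) ->
  forall p, O p -> fun_dt v p = rhs_of H (zeta_of Q) (p.1, p.2, v p) /\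
    fun_dx v p = zeta_of Q (p.1, p.2, v p).
Proof.
move=> D [oO vs sol] inv vW p Op; have zs := data_zeta D.
have [[oW xis etas] [tau0 xin0 HO _]] := D.
have vx q : O q -> fun_dx v q = zeta_of Q (q.1, q.2, v q).
  move=> Oq; have := inv _ Oq; rewrite /Qchar base_jet_of tau0 ?mul0r ?subr0; last exact: vW.
  rewrite (eta_zeta xin0); last exact: vW.
  by move/eqP; rewrite subr_eq0 => /eqP /(mulfI (xin0 _ (vW _ Oq))) ->.
split; last exact: vx.
have [_ L] := sol _ Op.
have dv q : O q -> differentiable v q by exact: smooth_diff.
move: L; rewrite /Defs.Lfun (xjet_jet_of r oO oW zs dv vW vx Op) => /eqP.
by rewrite subr_eq0 => /eqP.
Qed.

(** The first half of [family_of_invariant_solutions]; the second half is recovered from it in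
    [inv_family_FIS]. *)
Definition inv_family (p0 : R3) Q F : Prop :=
  \forall q \near (p0.1, fam_par F),
     Qchar Q (jet_of (fun p => fam_fun F (p, q.2)) q.1) = 0.

Lemma fam_value (p0 : R3) F : solution_family Om H p0 F ->
  (p0.1.1, p0.1.2, fam_fun F (p0.1, fam_par F)) = p0.
Proof. by move=> [-> _]; rewrite -q_eta. Qed.

Lemma slice_jets (f : R3 -> R) (N : set R3) q : smooth_on N f -> N q ->
  'D_ex1 f q = fun_dt (fun p => f (p, q.2)) q.1 /\
  'D_ex2 f q = fun_dx (fun p => f (p, q.2)) q.1.
Proof.
move=> fs; case: q => [p k] Nq /=; have df := smooth_diff fs Nq.
by rewrite /fun_dt /fun_dx !slice_derive_val.
Qed.

Lemma inv_family_solves W (p0 : R3) Q F : op_data W Q -> W p0 -> solution_family Om H p0 F ->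
  inv_family p0 Q F -> exists N, [/\ N (p0.1, fam_par F),
    solves W (zeta_of Q) (rhs_of H (zeta_of Q)) N (fam_fun F) &
    forall q, N q -> 'D_ex3 (fam_fun F) q != 0].
Proof.
move=> D Wp0 sF inv; have fv := fam_value sF.
have [f0 [N [[oN Nq0] fs f3 sol]]] := sF.
set f := fam_fun F in fs f3 sol f0 inv fv *; set q0 := (p0.1, fam_par F) in Nq0 inv f0 fv *.
have [[oW xis etas] [tau0 xin0 HO _]] := D.
have ct q : N q -> {for q, continuous (fun q : R3 => (q.1.1, q.1.2, f q))}.
  move=> Nq; apply: cont_pair; last exact: smooth_cont fs Nq.
  by apply: cont_pair; [exact: cont_fst3|exact: cont_snd3].
have Wnear : \forall q \near q0, W (q.1.1, q.1.2, f q).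
  have W0 : W (q0.1.1, q0.1.2, f q0) by rewrite fv.
  have c0 : {for q0, continuous (fun q : R3 => (q.1.1, q.1.2, f q))} := ct _ Nq0.
  exact: (c0 _ (open_near oW W0)).
have inv' : \forall q \near q0, Qchar Q (jet_of (fun p => f (p, q.2)) q.1) = 0 by exact: inv.
have [d d0 Hd] := near_box3 (filterI (open_near oN Nq0) (filterI Wnear inv')).
pose B := box3 q0 d; have oB : open B by exact: box3_open.
have fsB : smooth_on B f by move=> k; apply: Ck_subset (fs k) => q /Hd [].
exists B; split; first by split; rewrite subrr normr0.
  split=> //; first by move=> q /Hd [_ []].
  move=> q Bq; have [E1 E2] := slice_jets fsB Bq.
  rewrite E1 E2.
  have sol' : solution_on Om H [set p : R2 | B (p, q.2)] (fun p => f (p, q.2)).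
    split; first exact: slice_open.
      exact: slice_smooth.
    by have [_ _ sol'] := sol q.2; move=> p /Hd [Np _]; exact: sol'.
  have inv2 : invariant_on Q [set p : R2 | B (p, q.2)] (fun p => f (p, q.2)).
    by move=> p /Hd [_ [_ h]].
  have W2 p : [set p : R2 | B (p, q.2)] p -> W (p.1, p.2, f (p, q.2)).
    by move=> /Hd [_ [h _]].
  have Bq1 : [set p : R2 | B (p, q.2)] q.1 by case: q Bq {E1 E2 sol' inv2 W2}.
  have [h1 h2] := invariant_solution D sol' inv2 W2 Bq1.
  have Eq : (q.1, q.2) = q by rewrite -surjective_pairing.
  by rewrite h1 h2 /= Eq.
by move=> q /Hd [Nq _]; exact: f3.
Qed.

Section Follow.
Variables (W : set R3) (z g : R3 -> R) (N : set R3) (f : R3 -> R) (q0 : R3).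
Hypotheses (sf : solves W z g N f) (Nq0 : N q0) (f3 : forall q, N q -> 'D_ex3 f q != 0).
Variables (V N' : set R3) (kap : R3 -> R).
Hypotheses (oV : open V) (kaps : smooth_on V kap) (N'N : N' `<=` N)
  (kapP : forall p, V p -> N' (p.1, kap p) /\ f (p.1, kap p) = p.2).

(** The member of the family through a point of the graph of v has there the same first derivatives
    as v, both being given by g and z. Hence its parameter has zero gradient along v. *)
Lemma follow_const O (v : R2 -> R) : open O -> smooth_on O v ->
  (forall p, O p -> V (p.1, p.2, v p)) ->
  (forall p, O p -> fun_dt v p = g (p.1, p.2, v p) /\ fun_dx v p = z (p.1, p.2, v p)) ->
  forall p, O p -> [/\ differentiable (fun p => kap (p.1, p.2, v p)) p,
    fun_dt (fun p => kap (p.1, p.2, v p)) p = 0,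
    fun_dx (fun p => kap (p.1, p.2, v p)) p = 0 &
    f (p.1, p.2, kap (p.1, p.2, v p)) = v p].
Proof.
move=> oO vs vV sys p Op; have [oN fs fW fsys] := sf.
set K := fun p => kap _.
have Ks : smooth_on O K.
  by move=> k; apply: (Ck_comp3 oO kaps (Ck_fst2 k oO) (Ck_snd2 k oO) (vs k)).
have dK := smooth_diff Ks Op; have dv := smooth_diff vs Op.
have KN q : O q -> N (q.1, q.2, K q).
  by move=> Oq; have [h _] := kapP (vV _ Oq); exact: N'N h.
have Kv q : O q -> f (q.1, q.2, K q) = v q.
  by move=> Oq; have [_ h] := kapP (vV _ Oq).
have E : \forall q \near p, f (q.1, q.2, K q) = v q.
  by apply: filterS (open_near oO Op) => q; exact: Kv.
have df := smooth_diff fs (KN _ Op).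
have [F1 F2] := fsys _ (KN _ Op); have [S1 S2] := sys _ Op.
have n0 := f3 (KN _ Op).
split=> //; last exact: Kv.
- apply: (first_integral_dir (is_derive_fst2 p ((1, 0) : R2)) (is_derive_snd2 p ((1, 0) : R2)) dK
    (differentiable_is_derive _ dv) E df _ n0).
  rewrite -[RHS]/(fun_dt v p) F1 S1 /along /= Kv //.
  exact: etrans (congr2 _ (mulr1 _) (mulr0 _)) (addr0 _).
- apply: (first_integral_dir (is_derive_fst2 p ((0, 1) : R2)) (is_derive_snd2 p ((0, 1) : R2)) dK
    (differentiable_is_derive _ dv) E df _ n0).
  rewrite -[RHS]/(fun_dx v p) F2 S2 /along /= Kv //.
  exact: etrans (congr2 _ (mulr0 _) (mulr1 _)) (add0r _).
Qed.

End Follow.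
End SolutionsAndOperators.

(** * Partners of operators and of families: existence and uniqueness *)

Section Correspondence.
Context {R : realType}.
Notation R3 := (R * R * R)%type.
Notation R2 := (R * R)%type.
Variables (r : nat) (Om : set (R * R * 'rV[R]_r.+1)) (H : R * R * 'rV[R]_r.+1 -> R).
Hypotheses (hr : (1 < r)%N) (Om_open : open Om) (H_smooth : smooth_on Om H).
Variable p0 : R3.
Implicit Types (W : set R3) (Q : operator R) (F : function_family R).

Lemma norm_lt2 (q : R2) (d : R) : (`|q| < d) = (`|q.1| < d) && (`|q.2| < d).
Proof. by have -> : `|q| = Num.max `|q.1| `|q.2| by []; rewrite gt_max. Qed.

Lemma inv_family_FIS Q F : reduction_operators0 Om H p0 Q -> solution_family Om H p0 F ->
  inv_family p0 Q F -> family_of_invariant_solutions Om H p0 Q F.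
Proof.
move=> RQ sF inv; split=> // M Mq0.
have [W Wp0 D] := reduction_data hr H_smooth RQ.
have [N [Nq0 sol f3]] := inv_family_solves D Wp0 sF inv.
have fv := fam_value sF; have [f0 _] := sF.
set f := fam_fun F in sol f3 fv f0 *; set q0 := (p0.1, fam_par F) in Nq0 f0 fv Mq0 *.
have [oN fs _ _] := sol.
have [V [N' [kap [[oV Vp kaps] [oN' N'q0 N'N] kapP kapK]]]] := implicit_inverse oN Nq0 fs (f3 _ Nq0).
have E0 : (q0.1, f q0) = p0 by rewrite f0 /q0 /= -surjective_pairing.
have Vp0 : V p0 by rewrite -E0.
have kp0 : kap p0 = fam_par F by have [_] := kapK _ N'q0; rewrite E0.
have [[oW _ _] _] := D.
(* kap takes p0 to the parameter of the germ, so near p0 it only selects members with a parameter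
   allowed by M. *)
have Mnear : \forall p \near p0, M (p.1, kap p).
  have c : {for p0, continuous (fun p => (p.1, kap p))}.
    by apply: cont_pair; [exact: fst_cont|exact: smooth_cont kaps Vp0].
  by apply: (c M); rewrite /= kp0.
have [d d0 Hd] := near_box3 (filterI (open_near oV Vp0) (filterI (open_near oW Wp0) Mnear)).
exists (box3 p0 d).
  by split; [exact: box3_open|split; rewrite subrr normr0].
move=> O v p1 sv iv Op1 Wp1; have [oO vs solv] := sv.
(* The graph of v may leave the box away from p1; only the part inside it is followed. *)
pose O' := [set p | O p /\ box3 p0 d (p.1, p.2, v p)].
have oO' : open O'.
  by apply: graph_open => //; [move=> p Op; exact: smooth_cont vs Op|exact: box3_open].
have O'p1 : O' p1 by split=> //; rewrite -surjective_pairing.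
have vs' : smooth_on O' v by move=> k; apply: Ck_subset (vs k) => p [].
have sv' : solution_on Om H O' v by split=> // p [Op _]; exact: solv.
have iv' : invariant_on Q O' v by move=> p [Op _]; exact: iv.
have vW p : O' p -> W (p.1, p.2, v p) by move=> [_ /Hd [_ []]].
have vV p : O' p -> V (p.1, p.2, v p) by move=> [_ /Hd []].
have sys := invariant_solution D sv' iv' vW.
have fol := follow_const sol f3 kaps N'N kapP oO' vs' vV sys.
(* O' need not be connected, so constancy of the parameter is obtained on a ball around p1. *)
have [d1 /= d10 Hd1] := (nbhs_normP _ _).1 (open_near oO' O'p1).
have cst := @const_on_ball R (fun p => kap (p.1, p.2, v p)) p1 d1.
exists (kap (p1.1, p1.2, v p1)).
  by have [_ /Hd [_ [_]]] := O'p1; rewrite -surjective_pairing.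
apply/nbhs_normP; exists d1 => // p; rewrite /ball_ /= distrC => hp.
have O'q q : `|q - p1| < d1 -> O' q by move=> hq; apply: Hd1; rewrite /ball_ /= distrC.
have [_ _ _ <-] := fol _ (O'q _ hp).
rewrite -(cst _ p hp); first by rewrite -surjective_pairing.
by move=> q /O'q /fol [].
Qed.

(** Each member of F solves the system of Q, so the parameter kap of F' is constant along it. Its
    value over the base point, as a function of the parameter of F, is the change of parameter
    th. *)
Lemma unique_family Q F F' : reduction_operators0 Om H p0 Q ->
  solution_family Om H p0 F -> inv_family p0 Q F ->
  solution_family Om H p0 F' -> inv_family p0 Q F' -> family_equiv p0 F F'.
Proof.
move=> RQ sF iF sF' iF'.
have [W Wp0 D] := reduction_data hr H_smooth RQ.
have [N [Nq0 sol f3]] := inv_family_solves D Wp0 sF iF.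
have [N2 [N2q0 sol2 f3']] := inv_family_solves D Wp0 sF' iF'.
have [f0 _] := sF; have [f0' _] := sF'; have fv := fam_value sF.
set f := fam_fun F in sol f3 f0 fv *; set q0 := (p0.1, fam_par F) in Nq0 f0 fv *.
set f' := fam_fun F' in sol2 f3' f0' *; set q0' := (p0.1, fam_par F') in N2q0 f0' *.
have [oN fs _ fsys] := sol; have [oN2 fs' _ _] := sol2.
have [V [N' [kap [[oV Vp kaps] [oN' N'q0 N'N] kapP kapK]]]] := implicit_inverse oN2 N2q0 fs' (f3' _ N2q0).
have E0 : (q0'.1, f' q0') = p0 by rewrite f0' /q0' /= -surjective_pairing.
have Vp0 : V p0 by rewrite -E0.
have kp0 : kap p0 = fam_par F' by have [_] := kapK _ N'q0; rewrite E0.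
have Vnear : \forall q \near q0, V (q.1.1, q.1.2, f q).
  have c0 : {for q0, continuous (fun q : R3 => (q.1.1, q.1.2, f q))}.
    apply: cont_pair; last exact: smooth_cont fs Nq0.
    by apply: cont_pair; [exact: cont_fst3|exact: cont_snd3].
  have V0 : V (q0.1.1, q0.1.2, f q0) by rewrite fv.
  exact: (c0 _ (open_near oV V0)).
have [d d0 Hd] := near_box3 (filterI (open_near oN Nq0) Vnear).
pose B := box3 q0 d; have oB : open B by exact: box3_open.
pose K (q : R3) := kap (q.1.1, q.1.2, f q).
have fsB : smooth_on B f by move=> k; apply: Ck_subset (fs k) => q /Hd [].
have Ks : smooth_on B K.
  move=> k; apply: (Ck_comp3 oB kaps (Ck_fst k oB) (Ck_snd k oB) (fsB k)).
  by move=> q /Hd [].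
have fol q : B q -> [/\ differentiable (fun p => kap (p.1, p.2, f (p, q.2))) q.1,
    fun_dt (fun p => kap (p.1, p.2, f (p, q.2))) q.1 = 0,
    fun_dx (fun p => kap (p.1, p.2, f (p, q.2))) q.1 = 0 &
    f' (q.1.1, q.1.2, kap (q.1.1, q.1.2, f (q.1, q.2))) = f (q.1, q.2)].
  move=> Bq.
  have oS := slice_open (k := q.2) oB; have vs := slice_smooth q.2 oB fsB.
  have vV p : [set p : R2 | B (p, q.2)] p -> V (p.1, p.2, f (p, q.2)).
    by move=> /Hd [].
  have sys p : [set p : R2 | B (p, q.2)] p ->
      fun_dt (fun p => f (p, q.2)) p = rhs_of H (zeta_of Q) (p.1, p.2, f (p, q.2)) /\
      fun_dx (fun p => f (p, q.2)) p = zeta_of Q (p.1, p.2, f (p, q.2)).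
    move=> Bp; have [E1 E2] := slice_jets fsB Bp; rewrite /= in E1 E2.
    by rewrite -E1 -E2; apply: fsys; have [] := Hd _ Bp.
  apply: (follow_const sol2 f3' kaps N'N kapP oS vs vV sys).
  by rewrite /= -surjective_pairing.
have Kcst q : B q -> K q = K (p0.1, q.2).
  move=> Bq; have [b1 b2 b3] := Bq.
  pose g p := kap (p.1, p.2, f (p, q.2)).
  have h p : `|p - p0.1| < d -> [/\ differentiable g p, fun_dt g p = 0 & fun_dx g p = 0].
    rewrite norm_lt2 => /andP[h1 h2]; have Bp : B (p, q.2) by split.
    by have [] := fol _ Bp.
  have hq : `|q.1 - p0.1| < d by rewrite norm_lt2; apply/andP; split; [exact: b1|exact: b2].
  have Eq : (q.1, q.2) = q by rewrite -surjective_pairing.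
  by have C := const_on_ball h hq; rewrite /g Eq in C; exact: C.
pose th k := K (p0.1, k).
have Bk k : `|k - fam_par F| < d -> B (p0.1, k).
  by move=> hk; split; rewrite /= ?subrr ?normr0.
have fth k : `|k - fam_par F| < d -> f' (p0.1.1, p0.1.2, th k) = f (p0.1.1, p0.1.2, k).
  by move=> /Bk /fol [_ _ _]; rewrite /th /K /= -!surjective_pairing.
have kn : \forall k \near fam_par F, `|k - fam_par F| < d.
  apply/nbhs_normP; exists d => // k; by rewrite /ball_ /= distrC.
have oU : open [set k | `|k - fam_par F| < d].
  rewrite (_ : [set k | _] = ball (fam_par F) d); first exact: ball_open.
  by apply/seteqP; split=> k; rewrite -ball_normE /ball_ /= distrC.
have ths : smooth_on [set k | `|k - fam_par F| < d] th.
  move=> n; apply: (Ck_precomp (phi := fun k => (p0.1, k)) (L := fun w => (0, w)) oU _ _ Bk (Ks n)).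
    by move=> k _; exact: differentiable_pair.
  by move=> k w _; exact: is_derive_val (is_derive_pair (is_derive_cst _ _ _) (is_derive_id _ _)).
exists th; split.
- exists [set k | `|k - fam_par F| < d] => //.
  by split; [exact: oU|rewrite /= subrr normr0].
- by rewrite /th /K fv.
(* If th' vanished at k, differentiating f'(., th s) = f(., s) at s = k would give f_kappa = 0. *)
- apply: filterS kn => k hk; rewrite derive1E; apply/eqP => th0.
  have dth : is_derive k 1 th 0.
    by rewrite -th0; apply: differentiable_is_derive; apply: smooth_diff ths _.
  have N2k : N2 (p0.1.1, p0.1.2, th k).
    have [_ Vk] := Hd _ (Bk _ hk).
    by have [h _] := kapP _ Vk; exact: N'N h.
  have D1 := is_derive_comp3 (is_derive_cst (p0.1.1 : R) k (1 : R)) (is_derive_cst (p0.1.2 : R) k (1 : R)) dth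
    (smooth_diff fs' N2k).
  have Nk : N (p0.1.1, p0.1.2, k) by have [] := Hd _ (Bk _ hk); rewrite /= -surjective_pairing.
  have /is_derive_ex3 D2 := differentiable_is_derive ex3 (smooth_diff fs Nk).
  have E : \forall s \near k, f' (p0.1.1, p0.1.2, th s) = f (p0.1.1, p0.1.2, s).
    by apply: filterS (open_near oU hk) => s; exact: fth.
  have := is_derive_val D1; rewrite (near_eq_derive _ E) (is_derive_val D2).
  have A (a b c : R) : a * 0 + b * 0 + c * 0 = 0 by rewrite !mulr0 !addr0.
  by rewrite A => f30; have := f3 _ Nk; rewrite f30 eqxx.
apply: filterS (box3_near q0 d0) => q Bq.
rewrite /= -[th q.2]/(K (p0.1, q.2)) -Kcst //; have [_ _ _ C] := fol _ Bq.
have Eq : (q.1, q.2) = q by rewrite -surjective_pairing.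
rewrite Eq in C; apply: etrans C; congr (f' (_, _)); exact: surjective_pairing.
Qed.

(** Every point near p0 lies on a member of F, and zeta there is the x-derivative of that member for
    both operators. With equal zeta the operators differ by the factor xi' / xi. *)
Lemma unique_operator Q Q' F : reduction_operators0 Om H p0 Q ->
  reduction_operators0 Om H p0 Q' -> solution_family Om H p0 F ->
  inv_family p0 Q F -> inv_family p0 Q' F -> operator_equiv p0 Q Q'.
Proof.
move=> RQ RQ' sF iF iF'.
have [W Wp0 D] := reduction_data hr H_smooth RQ.
have [W2 W2p0 D2] := reduction_data hr H_smooth RQ'.
have [N [Nq0 sol f3]] := inv_family_solves D Wp0 sF iF.
have [N2 [N2q0 sol2 _]] := inv_family_solves D2 W2p0 sF iF'.
have [f0 _] := sF.
set f := fam_fun F in sol sol2 f3 f0 *; set q0 := (p0.1, fam_par F) in Nq0 N2q0 f0 *.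
have [oN fs _ fsys] := sol; have [oN2 _ _ fsys2] := sol2.
have oNN : open (N `&` N2) by exact: openI.
have fsN : smooth_on (N `&` N2) f by move=> k; apply: Ck_subset (fs k) => q [].
have [V [N' [kap [[oV Vp kaps] [oN' N'q0 N'N] kapP kapK]]]] :=
  implicit_inverse oNN (conj Nq0 N2q0) fsN (f3 _ Nq0).
have Vp0 : V p0 by move: Vp; rewrite f0 /q0 /= -surjective_pairing.
have [[oW xis etas] [tau0 xin0 _ _]] := D.
have [[oW2 xis2 etas2] [tau02 xin02 _ _]] := D2.
pose U := V `&` (W `&` W2).
have oU : open U by apply: openI => //; exact: openI.
have zz p : U p -> zeta_of Q p = zeta_of Q' p.
  move=> [Vp1 _]; have [/N'N [h1 h2] fk] := kapP _ Vp1.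
  have [_ e1] := fsys _ h1; have [_ e2] := fsys2 _ h2.
  have Ep : (p.1.1, p.1.2, f (p.1, kap p)) = p by rewrite fk -q_eta.
  by rewrite e1 /along /= Ep in e2.
exists (fun p => xi Q' p / xi Q p); split.
  exists U; first by split.
  move=> k; apply: (Ck_mul oU); first by apply: Ck_subset (xis2 k) => p [_ []].
  apply: (Ck_inv oU); first by move=> p [_ [Wp _]]; exact: xin0.
  by apply: Ck_subset (xis k) => p [_ []].
have Up0 : U p0 by [].
apply: filterS (open_near oU Up0) => p Up; have [_ [Wp W2p]] := Up.
split.
- by rewrite mulf_neq0 ?invr_eq0 ?xin0 ?xin02.
- by rewrite tau0 // tau02 // mulr0.
- by rewrite divfK // xin0.
- rewrite (eta_zeta xin0 Wp) (eta_zeta xin02 W2p) zz // mulrA divfK //.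
  exact: xin0.
Qed.

Lemma exists_family Q : reduction_operators0 Om H p0 Q ->
  exists F, solution_family Om H p0 F /\ inv_family p0 Q F.
Proof.
move=> RQ; have [W Wp0 D] := reduction_data hr H_smooth RQ.
have zs := data_zeta D; have gs := data_rhs H_smooth D.
have [[oW xis etas] [tau0 xin0 HO compat]] := D.
have [d [f [d0 fs fp0 fW fsys]]] := frobenius oW zs gs compat Wp0.
pose B := box3 p0 d; have oB : open B by exact: box3_open.
have Bp0 : B p0 by split; rewrite subrr normr0.
have fp0' : (p0.1, p0.2) = p0 by rewrite -surjective_pairing.
have vx k p : [set p : R2 | B (p, k)] p ->
    fun_dx (fun p => f (p, k)) p = zeta_of Q (p.1, p.2, f (p, k)).
  move=> Bp; have [_ <-] := slice_jets fs Bp; have [_ ->] := fsys _ Bp.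
  by [].
(* The parameter is the value of the solution at the base point (t0, x0), so the germ sits at the
   last coordinate of p0. *)
exists (Family f p0.2); split; last first.
  rewrite /inv_family /= fp0'; apply: filterS (open_near oB Bp0) => q Bq.
  have Bq' : [set p : R2 | B (p, q.2)] q.1 by rewrite /= -surjective_pairing.
  have [Wq _] := fW _ Bq'.
  rewrite /Qchar base_jet_of tau0 // mul0r subr0.
  rewrite -[(jet_of _ _).2 _ _]/(fun_dx (fun p => f (p, q.2)) q.1) vx //.
  by rewrite (eta_zeta xin0 Wq) subrr.
split; first by rewrite /= fp0'.
exists B; split; rewrite /= ?fp0' //.
  by move=> q Bq; have [_] := fW _ Bq.
move=> k; have oS := slice_open (k := k) oB; have vs := slice_smooth k oB fs.
split=> // p Bp.
have dv q : [set p : R2 | B (p, k)] q -> differentiable (fun p => f (p, k)) q.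
  exact: smooth_diff.
have vW q : [set p : R2 | B (p, k)] q -> W (q.1, q.2, f (q, k)) by move=> /fW [].
have Ex := xjet_jet_of r oS oW zs dv vW (vx k) Bp.
split; first by rewrite Ex; apply: HO; exact: vW.
rewrite /Defs.Lfun Ex -[(jet_of _ _).2 _ _]/(fun_dt (fun p => f (p, k)) p).
by have [<- _] := slice_jets fs Bp; have [-> _] := fsys _ Bp; rewrite subrr.
Qed.

(** The operator is d_x + z d_u, with z the slope of the member through the given point. Its
    compatibility condition is the symmetry of f_tx on that member, once f_x and f_t are written as
    z and the right-hand side along f. *)
Lemma exists_operator F : solution_family Om H p0 F ->
  exists Q, reduction_operators0 Om H p0 Q /\ inv_family p0 Q F.
Proof.
move=> sF; have [f0 [N [[oN Nq0] fs f3 sol]]] := sF.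
set f := fam_fun F in fs f3 sol f0 *; set q0 := (p0.1, fam_par F) in Nq0 f0 *.
have [V [N' [kap [[oV Vp kaps] [oN' N'q0 N'N] kapP kapK]]]] := implicit_inverse oN Nq0 fs (f3 _ Nq0).
have Vp0 : V p0 by move: Vp; rewrite f0 /q0 /= -surjective_pairing.
pose z (p : R3) := 'D_ex2 f (p.1.1, p.1.2, kap p).
have kapV p : V p -> N' (p.1.1, p.1.2, kap p) /\ f (p.1.1, p.1.2, kap p) = p.2.
  by move=> /kapP; rewrite -surjective_pairing.
have zs : smooth_on V z.
  move=> k; apply: (Ck_comp3 oV (smooth_derive ex2 fs) (Ck_fst k oV) (Ck_snd k oV) (kaps k)).
  by move=> p /kapV [/N'N].
pose Q := Operator (fun=> 0) (fun=> 1) z.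
have Qz : zeta_of Q = z by apply/funext => p; rewrite /zeta_of /= divr1.
have fsN' : smooth_on N' f by move=> k; apply: Ck_subset (fs k).
have NV q : N' q -> V (q.1.1, q.1.2, f q).
  by move=> /kapK [h _]; rewrite -surjective_pairing.
have kapN q : N' q -> kap (q.1.1, q.1.2, f q) = q.2.
  by move=> /kapK [_ h]; rewrite -surjective_pairing.
have Dx q : N' q -> 'D_ex2 f q = z (q.1.1, q.1.2, f q).
  by move=> N'q; rewrite /z /= kapN // -q_eta.
have vx k p : [set p : R2 | N' (p, k)] p ->
    fun_dx (fun p => f (p, k)) p = z (p.1, p.2, f (p, k)).
  by move=> Np; have [_ <-] := slice_jets fsN' Np; rewrite Dx.
have Ex k p : [set p : R2 | N' (p, k)] p ->
    xjet r (jet_of (fun p => f (p, k)) p) = xjet_of r z (p.1, p.2, f (p, k)).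
  move=> Np; have oS := slice_open (k := k) oN'; have vs := slice_smooth k oN' fsN'.
  apply: (xjet_jet_of r oS oV zs _ _ (vx k) Np) => q Nq; first exact: smooth_diff vs Nq.
  exact: (NV (q, k) Nq).
have Lk k p : [set p : R2 | N' (p, k)] p -> L_manifold Om H (jet_of (fun p => f (p, k)) p).
  by move=> Np; have [_ _ s] := sol k; apply: s; exact: N'N.
have Dt q : N' q -> 'D_ex1 f q = rhs_of H z (q.1.1, q.1.2, f q).
  case: q => [p k] Nq; have [-> _] := slice_jets fsN' Nq.
  have [_ /eqP] := Lk k p Nq; rewrite /Defs.Lfun subr_eq0 => /eqP /= L.
  by rewrite [LHS]L -[(p.1, p.2, f (p, k))]/(p.1, p.2, f (p, k)) Ex.
have HO p : V p -> Om (xjet_of r z p).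
  move=> Vp1; have [N'k fk] := kapV _ Vp1.
  have [Ok _] := Lk (kap p) (p.1.1, p.1.2) N'k.
  have Ep : ((p.1.1, p.1.2).1, (p.1.1, p.1.2).2, f (p.1.1, p.1.2, kap p)) = p.
    by rewrite fk [RHS]q_eta.
  by rewrite (Ex _ _ N'k) Ep in Ok.
have gs : smooth_on V (rhs_of H z).
  by move=> k; have C := Ck_xjet_comp k oV zs H_smooth HO; exact: C.
have compat p : V p -> 'D_ex1 z p + rhs_of H z p * 'D_ex3 z p = vfield ex2 z (rhs_of H z) p.
  move=> Vp1; have [N'k fk] := kapV _ Vp1.
  set q : R3 := (p.1.1, p.1.2, kap p) in N'k *.
  have Ep : (q.1.1, q.1.2, f q) = p by rewrite [RHS]q_eta -fk.
  have dz : differentiable z (q.1.1, q.1.2, f q) by rewrite Ep; exact: smooth_diff zs Vp1.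
  have dg : differentiable (rhs_of H z) (q.1.1, q.1.2, f q) by rewrite Ep; exact: smooth_diff gs Vp1.
  have df := smooth_diff fsN' N'k.
  have S1 : 'D_ex1 (fun q => 'D_ex2 f q) q = 'D_ex1 (along z f) q := derive_eq_on ex1 oN' N'k Dx.
  have S2 : 'D_ex2 (fun q => 'D_ex1 f q) q = 'D_ex2 (along (rhs_of H z) f) q :=
    derive_eq_on ex2 oN' N'k Dt.
  have S3 := is_derive_val (along_derive1 (differentiable_is_derive ex1 df) dz).
  have S4 := is_derive_val (along_derive2 (differentiable_is_derive ex2 df) dg).
  have S := etrans (esym S3) (etrans (esym S1)
     (etrans (derive_comm ex2 ex1 oN' N'k fsN') (etrans S2 S4))).
  rewrite (Dt _ N'k) (Dx _ N'k) /along Ep in S.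
  by rewrite /vfield mulrC S mulrC.
exists Q; split; last first.
  apply: filterS (open_near oN' N'q0) => q N'q.
  have Nq : [set p : R2 | N' (p, q.2)] q.1 by rewrite /= -surjective_pairing.
  rewrite /Qchar base_jet_of /= mul0r subr0 mul1r.
  by rewrite -[X in _ - X]/(fun_dx (fun p => f (p, q.2)) q.1) vx // subrr.
split; last by apply: filterS (open_near oV Vp0).
have tau0 p : V p -> tau Q p = 0 by [].
have xin0 p : V p -> xi Q p != 0 by move=> _; exact: oner_neq0.
have xis : smooth_on V (xi Q) by move=> k; exact: Ck_cst.
exists V => //; split=> //.
- by split=> // k; exact: Ck_cst.
- by move=> p _ [] /eqP; rewrite oner_eq0.
(* The jet of the member of the family through p is a point over p on both manifolds. *)
- move=> p Vp1; have [N'k fk] := kapV _ Vp1.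
  have oS := slice_open (k := kap p) oN'; have vs := slice_smooth (kap p) oN' fsN'.
  exists (jet_of (fun s => f (s, kap p)) (p.1.1, p.1.2)); split.
    by rewrite base_jet_of /= fk -q_eta.
  split; first exact: Lk.
  have uV q : [set s : R2 | N' (s, kap p)] q -> V (q.1, q.2, f (q, kap p)).
    by move=> Nq; exact: (NV (q, kap p) Nq).
  have iv : invariant_on Q [set s : R2 | N' (s, kap p)] (fun s => f (s, kap p)).
    move=> q Nq; rewrite /Qchar base_jet_of /= mul0r subr0 mul1r.
    by rewrite -[X in _ - X]/(fun_dx (fun p' => f (p', kap p)) q) vx // subrr.
  have Qm := Q_manifold_jet_of (Q := Q) (r := r) oV xis zs tau0 oS vs uV iv.
  exact: (Qm (p.1.1, p.1.2) N'k).
- move=> zz Vz LQ.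
  rewrite (prolongation_formula H_smooth hr oV xis zs tau0 xin0 Vz LQ) Qz compat //.
  by rewrite subrr mulr0.
Qed.

End Correspondence.

(** * Equivalences *)

Section Equivalences.
Context {R : realType}.
Notation R3 := (R * R * R)%type.
Implicit Types (Q : operator R) (F : function_family R).
Variable p0 : R3.

Lemma smooth_near_cst (V : normedModType R) (p : V) (c : R) : smooth_near p (fun=> c).
Proof. by exists setT; [split=> //; exact: openT|move=> k; exact: Ck_cst]. Qed.

Lemma smooth_near_mul (V : normedModType R) (p : V) (f g : V -> R) :
  smooth_near p f -> smooth_near p g -> smooth_near p (fun q => f q * g q).
Proof.
move=> [U [oU Up] fs] [U' [oU' U'p] gs]; exists (U `&` U'); first by split=> //; exact: openI.
move=> k; apply: Ck_mul; first exact: openI.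
  by apply: Ck_subset (fs k) => q [].
by apply: Ck_subset (gs k) => q [].
Qed.

Lemma smooth_near_inv (V : normedModType R) (p : V) (f : V -> R) : f p != 0 ->
  smooth_near p f -> smooth_near p (fun q => (f q)^-1).
Proof.
move=> f0 [U [oU Up] fs].
have oU' : open [set q | U q /\ 0 < `|f q|].
  apply: open_sub_pos => // q Uq.
  exact: (@continuous_comp _ _ _ f Num.norm q (smooth_cont fs Uq) (@norm_continuous _ _ _)).
exists [set q | U q /\ 0 < `|f q|]; first by split=> //; split=> //; rewrite normr_gt0.
move=> k; apply: Ck_inv => //.
- by move=> q [_]; rewrite normr_gt0.
- by apply: Ck_subset (fs k) => q [].
Qed.

Lemma operator_equiv_refl Q : operator_equiv p0 Q Q.
Proof.
exists (fun=> 1); split; first exact: smooth_near_cst.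
by apply: filterE => p; rewrite !mul1r oner_eq0.
Qed.

Lemma operator_equiv_sym Q Q' : operator_equiv p0 Q Q' -> operator_equiv p0 Q' Q.
Proof.
move=> [lam [ls E]]; have [l0 _ _ _] := nbhs_singleton E.
exists (fun p => (lam p)^-1); split; first exact: smooth_near_inv.
apply: filterS E => p [lp -> -> ->]; split; first by rewrite invr_eq0.
- by rewrite mulKf.
- by rewrite mulKf.
- by rewrite mulKf.
Qed.

Lemma operator_equiv_trans Q Q' Q'' : operator_equiv p0 Q Q' ->
  operator_equiv p0 Q' Q'' -> operator_equiv p0 Q Q''.
Proof.
move=> [lam [ls E]] [mu [ms E']].
exists (fun p => mu p * lam p); split; first exact: smooth_near_mul.
apply: filterS2 E E' => p [l0 t1 x1 e1] [m0 t2 x2 e2].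
by split; [exact: mulf_neq0|rewrite t2 t1 mulrA|rewrite x2 x1 mulrA|rewrite e2 e1 mulrA].
Qed.

Lemma operator_class_eq Q Q' : operator_equiv p0 Q Q' <-> operator_class p0 Q = operator_class p0 Q'.
Proof.
split=> [E|E]; last first.
  have : operator_class p0 Q' Q' by exact: operator_equiv_refl.
  by rewrite -E.
apply/seteqP; split=> P /=; last exact: operator_equiv_trans E.
exact: operator_equiv_trans (operator_equiv_sym E).
Qed.

Lemma family_equiv_refl F : family_equiv p0 F F.
Proof.
exists id; split=> //.
- exists setT; first by split=> //; exact: openT.
  move=> k; have C := Ck_precomp (U := [set: R]) (phi := fun s : R => (0, 0, s) : R3) (L := fun w => (0, 0, w))
    openT _ _ _ (Ck_thd k openT).
  apply: C => // p w _; apply: is_derive_val.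
  exact: (is_derive_pair (is_derive_cst _ _ _) (is_derive_id _ _)).
- by apply: filterE => k; rewrite derive1_id oner_eq0.
- by apply: filterE => -[[t x] k].
Qed.

Lemma smooth_near_comp (f g : R -> R) (k : R) : smooth_near k f -> smooth_near (f k) g ->
  smooth_near k (fun s => g (f s)).
Proof.
move=> [U [oU Uk] fs] [U' [oU' U'k] gs].
have oUU : open [set s | U s /\ U' (f s)].
  rewrite openE => s [Us U's].
  have c : {for s, continuous f} := smooth_cont fs Us.
  have h : \forall s' \near s, U' (f s') by exact: (c _ (open_near oU' U's)).
  exact: filterS2 (open_near oU Us) h.
exists [set s | U s /\ U' (f s)] => //.
move=> n; apply: (@Ck_comp _ _ R U' g n _ 1 (fun=> f) (fun=> 1)) => //.
- by move=> _; apply: Ck_subset (fs n) => s [].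
- by move=> s _; rewrite big_ord1 [_ *: 1]mulr1.
- by move=> s [].
Qed.

Lemma smooth_near_cont (V : normedModType R) (p : V) (f : V -> R) :
  smooth_near p f -> {for p, continuous f}.
Proof. by move=> [U [oU Up] fs]; exact: smooth_cont fs Up. Qed.

Lemma smooth_near_diff (V : normedModType R) (p : V) (f : V -> R) :
  smooth_near p f -> \forall q \near p, differentiable f q.
Proof.
by move=> [U [oU Up] fs]; apply: filterS (open_near oU Up) => q; exact: smooth_diff fs.
Qed.

Lemma derive1_diff (f : R -> R) (k : R) : differentiable f k -> is_derive k 1 f (derive1 f k).
Proof. by move=> df; rewrite derive1E; exact: differentiable_is_derive. Qed.

Lemma derive1_comp_neq0 (f g : R -> R) (k : R) : differentiable f k -> differentiable g (f k) ->
  derive1 f k != 0 -> derive1 g (f k) != 0 -> derive1 (fun s => g (f s)) k != 0.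
Proof.
move=> df dg f0 g0.
have := @derive1_comp R f g k (diff_derivable (v := (1 : R)) df) (diff_derivable (v := (1 : R)) dg).
rewrite -[derive1 (g \o f) k]/(derive1 (fun s => g (f s)) k) => ->.
exact: mulf_neq0.
Qed.

(** The inverse function theorem in one variable, read off from [implicit_inverse] for a function
    that ignores t and x. *)
Lemma local_inverse (th : R -> R) (k0 : R) : smooth_near k0 th -> derive1 th k0 != 0 ->
  exists s : R -> R, [/\ smooth_near (th k0) s, s (th k0) = k0,
    (\forall k \near k0, s (th k) = k) & \forall k \near th k0, th (s k) = k].
Proof.
move=> [U [oU Uk] ths] th0.
pose N : set R3 := [set q | U q.2].
have oN : open N by apply: (@open_comp _ _ snd) => // q _; exact: snd_cont.
pose f (q : R3) := th q.2.
have fs : smooth_on N f.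
  move=> n; apply: (@Ck_comp _ _ R U th n N 1 (fun=> fun q => q.2) (fun=> 1)) => //.
    by move=> _; exact: Ck_thd.
  by move=> s _; rewrite big_ord1 [_ *: 1]mulr1.
pose q0 : R3 := (0, 0, k0).
have f3 : 'D_ex3 f q0 != 0.
  have dth := derive1_diff (smooth_diff ths Uk).
  have /is_derive_ex3 D : is_derive k0 1 (fun s => f (0, 0, s)) (derive1 th k0) by exact: dth.
  by rewrite (is_derive_val D).
have [V [N' [kap [[oV Vp kaps] [oN' N'q0 N'N] kapP kapK]]]] := implicit_inverse oN (Uk : N q0) fs f3.
pose s (k : R) := kap (0, 0, k).
have c0 : continuous (fun k : R => ((0, 0, k) : R3)).
  move=> k; apply: cont_pair; last exact: cvg_id.
  exact: cst_continuous.
have oS : open [set k | V (0, 0, k)] by apply: (@open_comp _ _ (fun k : R => ((0, 0, k) : R3))) => // k _; exact: c0.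
exists s; split.
- exists [set k | V (0, 0, k)]; first by split.
  move=> n; apply: (Ck_precomp (phi := fun k => ((0, 0, k) : R3)) (L := fun w => (0, 0, w)) oS _ _ _ (kaps n)) => // k w _.
  apply: is_derive_val.
  exact: (is_derive_pair (is_derive_cst _ _ _) (is_derive_id _ _)).
- by have [_ h] := kapK _ N'q0.
- have h : \forall k \near k0, N' (0, 0, k) by exact: (c0 k0 _ (open_near oN' N'q0)).
  by apply: filterS h => k /kapK [_].
- by apply: filterS (open_near oS (Vp : [set k | V (0, 0, k)] (th k0))) => k /kapP [_].
Qed.

Lemma near_thd (k : R) (P : R -> Prop) : (\forall s \near k, P s) ->
  \forall q \near (p0.1, k), P q.2.
Proof. by move=> h; exact: (@snd_cont _ _ (p0.1, k) _ h). Qed.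

Lemma near_map_thd (th : R -> R) (k : R) (P : R3 -> Prop) : {for k, continuous th} ->
  (\forall q \near (p0.1, th k), P q) -> \forall q \near (p0.1, k), P (q.1, th q.2).
Proof.
move=> c h.
have c' : {for ((p0.1, k) : R3), continuous (fun q : R3 => (q.1, th q.2))}.
  apply: cont_pair; first exact: fst_cont.
  by apply: (@continuous_comp _ _ _ snd th); [exact: snd_cont|exact: c].
exact: (c' _ h).
Qed.

Lemma family_equiv_sym F F' : family_equiv p0 F F' -> family_equiv p0 F' F.
Proof.
move=> [th [ths th0 thn E]].
have [s [ss s0 sth ths']] := local_inverse ths (nbhs_singleton thn).
rewrite th0 in ss s0 ths'.
have cs := smooth_near_cont ss.
exists s; split=> //.
- have dth := smooth_near_diff ths; have ds := smooth_near_diff ss.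
  rewrite -s0 in dth thn.
  have h1 : \forall k \near fam_par F', differentiable th (s k) by exact: (cs _ dth).
  have h3 := near_join ths'.
  apply: filterS3 ds h1 h3 => k dsk dtk Ek /=.
  (* th composed with s is the identity near k, so a zero derivative of s would give 1 = 0. *)
  apply/eqP => sk0.
  have := @derive1_comp R s th k (diff_derivable (v := (1 : R)) dsk) (diff_derivable (v := (1 : R)) dtk).
  rewrite sk0 mulr0 -[derive1 (th \o s) k]/(derive1 (fun x => th (s x)) k).
  rewrite (near_eq_derive1 (g := id)) // derive1_id => /eqP.
  by rewrite oner_eq0.
- have E' : \forall q \near (p0.1, s (fam_par F')), fam_fun F' (q.1, th q.2) = fam_fun F q.
    by rewrite s0.
  apply: filterS2 (near_map_thd cs E') (near_thd ths') => q /= <- ->.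
  by rewrite -surjective_pairing.
Qed.

Lemma family_equiv_trans F F' F'' : family_equiv p0 F F' ->
  family_equiv p0 F' F'' -> family_equiv p0 F F''.
Proof.
move=> [th [ths th0 thn E]] [mu [mus mu0 mun E']].
have cth := smooth_near_cont ths.
rewrite -th0 in mus mun E'.
exists (fun k => mu (th k)); split.
- exact: smooth_near_comp.
- by rewrite th0.
- have h1 : \forall k \near fam_par F, differentiable mu (th k).
    exact: (cth _ (smooth_near_diff mus)).
  have h2 : \forall k \near fam_par F, derive1 mu (th k) != 0 by exact: (cth _ mun).
  have h : \forall k \near fam_par F, derive1 mu (th k) != 0 /\ derive1 th k != 0 by exact: filterI h2 thn.
  by apply: filterS3 (smooth_near_diff ths) h1 h => k d1 d2 [n2 n1]; exact: derive1_comp_neq0.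
- by apply: filterS2 E (near_map_thd cth E') => q /= <- ->.
Qed.

Lemma family_class_eq F F' : family_equiv p0 F F' <-> family_class p0 F = family_class p0 F'.
Proof.
split=> [E|E]; last first.
  have : family_class p0 F' F' by exact: family_equiv_refl.
  by rewrite -E.
apply/seteqP; split=> P /=; last exact: family_equiv_trans E.
exact: family_equiv_trans (family_equiv_sym E).
Qed.

(** Q'[u] = lam Q[u] holds near p0, and by continuity the graphs of members close to the base member
    pass through that neighbourhood. *)
Lemma inv_family_operator Q Q' F : {for (p0.1, fam_par F), continuous (fam_fun F)} ->
  fam_fun F (p0.1, fam_par F) = p0.2 -> operator_equiv p0 Q Q' ->
  inv_family p0 Q F -> inv_family p0 Q' F.
Proof.
move=> cF f0 [lam [_ E]]; set q0 := (p0.1, fam_par F) in cF f0 *.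
have c : {for q0, continuous (fun q : R3 => (q.1.1, q.1.2, fam_fun F q))}.
  apply: cont_pair; last exact: cF.
  by apply: cont_pair; [exact: cont_fst3|exact: cont_snd3].
have E0 : (q0.1.1, q0.1.2, fam_fun F q0) = p0 by rewrite [RHS]q_eta -f0.
rewrite -E0 in E.
have En : \forall q \near q0, [/\ lam (q.1.1, q.1.2, fam_fun F q) != 0,
   tau Q' (q.1.1, q.1.2, fam_fun F q) = lam (q.1.1, q.1.2, fam_fun F q) * tau Q (q.1.1, q.1.2, fam_fun F q),
   xi Q' (q.1.1, q.1.2, fam_fun F q) = lam (q.1.1, q.1.2, fam_fun F q) * xi Q (q.1.1, q.1.2, fam_fun F q) &
   Defs.eta Q' (q.1.1, q.1.2, fam_fun F q) = lam (q.1.1, q.1.2, fam_fun F q) * Defs.eta Q (q.1.1, q.1.2, fam_fun F q)].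
  exact: (c _ E).
apply: filterS2 En => -[p k] [_ e1 e2 e3]; rewrite /= in e1 e2 e3.
by rewrite /Qchar !base_jet_of /= e1 e2 e3 -!mulrA -!mulrBr => ->; rewrite mulr0.
Qed.

(** For a nearby parameter, members of F' and F agree on a neighbourhood in (t, x), not just at a
    point, so their first derivatives agree as well. *)
Lemma inv_family_reparam Q F F' : family_equiv p0 F' F -> inv_family p0 Q F -> inv_family p0 Q F'.
Proof.
move=> [s [ss s0 _ E]] inv.
have cs := smooth_near_cont ss.
have inv' : \forall q \near (p0.1, s (fam_par F')),
    Qchar Q (jet_of (fun p => fam_fun F (p, q.2)) q.1) = 0 by rewrite s0.
apply: filterS2 (near_join E) (near_map_thd cs inv') => q /= Eq.
have Eq' : \forall p \near q.1, fam_fun F (p, s q.2) = fam_fun F' (p, q.2).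
  have h : \forall q' \near slice q.2 q.1, fam_fun F (q'.1, s q'.2) = fam_fun F' q'.
    by rewrite /slice -surjective_pairing.
  exact: (@slice_continuous R q.2 q.1 _ h).
rewrite /Qchar !base_jet_of (nbhs_singleton Eq').
rewrite -![(jet_of _ _).2 1%N 0%N]/(fun_dt _ _) -![(jet_of _ _).2 0%N 1%N]/(fun_dx _ _).
by rewrite /fun_dt /fun_dx /= !(near_eq_derive _ Eq').
Qed.

End Equivalences.

(** * The map between equivalence classes *)

Section MainTheorem.
Context {R : realType}.
Variables (r : nat) (Om : set (R * R * 'rV[R]_r.+1)) (H : R * R * 'rV[R]_r.+1 -> R).
Hypotheses (hr : (1 < r)%N) (Om_open : open Om) (H_smooth : smooth_on Om H).
Variable p0 : R * R * R.

(** Given as a relation over all representatives, which avoids choosing one; [class_mapE] shows that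
    any representative computes the value. *)
Definition class_map (C : set (operator R)) : set (function_family R) :=
  [set F' | exists Q F, [/\ C = operator_class p0 Q /\ reduction_operators0 Om H p0 Q,
     solution_family Om H p0 F, inv_family p0 Q F & family_equiv p0 F F']].

Lemma solution_family_cont F : solution_family Om H p0 F ->
  {for (p0.1, fam_par F), continuous (fam_fun F)}.
Proof. by move=> [_ [N [[oN Nq] fs _ _]]]; exact: smooth_cont fs Nq. Qed.

Lemma class_mapE Q F : reduction_operators0 Om H p0 Q -> solution_family Om H p0 F ->
  inv_family p0 Q F -> class_map (operator_class p0 Q) = family_class p0 F.
Proof.
move=> RQ sF iF; apply/seteqP; split=> F'; last by move=> E; exists Q, F.
move=> [Q1 [F1 [[/operator_class_eq EQ RQ1] sF1 iF1 E1]]].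
apply: family_equiv_trans E1; apply: (unique_family hr H_smooth RQ) => //.
apply: inv_family_operator iF1; first exact: solution_family_cont.
  by have [] := sF1.
exact: operator_equiv_sym.
Qed.

(** Q has some invariant family, whose class is the image by [class_mapE]; so F is a
    reparametrisation of that family. *)
Lemma class_map_inv Q F : reduction_operators0 Om H p0 Q -> solution_family Om H p0 F ->
  class_map (operator_class p0 Q) = family_class p0 F -> inv_family p0 Q F.
Proof.
move=> RQ sF; have [F1 [sF1 iF1]] := exists_family hr H_smooth RQ.
rewrite (class_mapE RQ sF1 iF1) => /family_class_eq E.
exact: inv_family_reparam (family_equiv_sym E) iF1.
Qed.

End MainTheorem.

Theorem theorem3 (R : realType) (r : nat) (hr : (1 < r)%N)
    (Om : set (R * R * 'rV[R]_r.+1)) (H : R * R * 'rV[R]_r.+1 -> R)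
    (Om_open : open Om) (H_smooth : smooth_on Om H)
    (H_ur : forall w, Om w ->
      'D_((0, 0, delta_mx 0 ord_max) : R * R * 'rV[R]_r.+1) H w != 0)
    (p0 : R * R * R) :
  exists Phi : set (operator R) -> set (function_family R),
    set_bij (operator_class p0 @` reduction_operators0 Om H p0)
            (family_class p0 @` solution_families Om H p0) Phi /\
    forall (Q : operator R) (f : function_family R),
      reduction_operators0 Om H p0 Q -> solution_families Om H p0 f ->
      (Phi (operator_class p0 Q) = family_class p0 f <->
       family_of_invariant_solutions Om H p0 Q f).
Proof.
exists (class_map Om H p0); split; last first.
  move=> Q F RQ sF; split=> [E|[iF _]]; last exact: class_mapE.
  by apply: (inv_family_FIS hr H_smooth) => //; exact: (class_map_inv hr H_smooth RQ sF E).
split.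
- move=> _ [Q RQ <-]; have [F [sF iF]] := exists_family hr H_smooth RQ.
  by exists F => //; rewrite (class_mapE hr H_smooth RQ sF iF).
(* Equal images give Q and Q' a common invariant family, and a family determines its operator up to
   equivalence. *)
- move=> _ _ /set_mem[Q RQ <-] /set_mem[Q' RQ' <-] E.
  have [F [sF iF]] := exists_family hr H_smooth RQ.
  apply/operator_class_eq; apply: (unique_operator hr H_smooth RQ RQ' sF iF).
  apply: (class_map_inv hr H_smooth RQ' sF).
  by rewrite -E (class_mapE hr H_smooth RQ sF iF).
- move=> _ [F sF <-]; have [Q [RQ iF]] := exists_operator hr H_smooth sF.
  exists (operator_class p0 Q); first by exists Q.
  exact: class_mapE.
Qed.
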